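(* Let $\mathbb{X}$ be a Banach space with a basis and let $1<q<\infty$. If $\ell_q$ is isomorphic to a complemented subspace of $\mathbb{X}$, then for any $0<a<1$ the space $\mathbb{X}$ has an almost greedy basis $\mathcal{B}_\kappa$ whose fundamental function is equivalent to $(m^{1/q})_{m=1}^\infty$ and such that $L_m[\mathcal{B}_\kappa,\mathbb{X}]\gtrsim(\log m)^a$ for $m\in\mathbb{N}$.
   Context: A basis $\mathcal{B}=(x_j)_{j=1}^\infty$ of a (real or complex) Banach space $\mathbb{X}$ is a Schauder basis, always assumed semi-normalized, i.e. $0<\inf_j\Vert x_j\Vert\le\sup_j\Vert x_j\Vert<\infty$; $(x_j^* )_{j=1}^\infty$ are its coordinate functionals. For $A\subseteq\mathbb{N}$, $S_A(f)=\sum_{j\in A}x_j^*(f)x_j$ (when well defined), and $\operatorname{supp}(f)=\{j: x_j^*(f)\ne0\}$. Define $$L_m[\mathcal{B},\mathbb{X}]=\sup\left\{\frac{\Vert S_A(f)\Vert}{\Vert f\Vert}: f\in\mathbb{X}\setminus\{0\},\ \max(\operatorname{supp}(f))\le m,\ A\subseteq\mathbb{N}\right\}.$$ The basis is almost greedy if there is a constant $C$ with $\Vert f-S_F(f)\Vert\le C\Vert f-S_A(f)\Vert$ whenever $f\in\mathbb{X}$, $|A|\le|F|<\infty$, and $|x_j^*(f)|\le|x_k^*(f)|$ for all $j\in\mathbb{N}\setminus F$, $k\in F$. Its fundamental function is $\varphi_m[\mathcal{B},\mathbb{X}]=\sup_{|A|\le m}\Vert\sum_{j\in A}x_j\Vert$,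 $m\in\mathbb{N}$. For families of non-negative numbers, $\alpha_i\lesssim\beta_i$ means there is a constant $C$ with $\alpha_i\le C\beta_i$ for all $i$; $\alpha_i\gtrsim\beta_i$ means $\beta_i\lesssim\alpha_i$; two sequences are equivalent if both relations hold. *)

(* Defs.v *)
From HB Require Import structures.
From mathcomp Require Import all_boot all_order all_algebra finmap.
From mathcomp Require Import all_classical all_reals all_analysis.
From mathcomp Require Import complex.
Set Implicit Arguments.
Unset Strict Implicit.
Unset Printing Implicit Defensive.
Import Order.TTheory GRing.Theory Num.Theory.
Import numFieldNormedType.Exports.
Local Open Scope classical_set_scope.
Local Open Scope ring_scope.

Variant scalar_kind := RealScalars | ComplexScalars.

Definition scalars (R : realType) (k : scalar_kind) : numFieldType :=
  match k with RealScalars => R | ComplexScalars => R[i] end.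

Definition real_part (R : realType) (k : scalar_kind) : scalars R k -> R :=
  match k return scalars R k -> R with
  | RealScalars => fun z => z
  | ComplexScalars => fun z : R[i] => complex.Re z
  end.

(* The norm of a normed space over K takes its values in K; over R[i] these are
   nonnegative reals embedded in R[i], so taking the real part is lossless. *)
Definition rabs (R : realType) (k : scalar_kind) (z : scalars R k) : R :=
  real_part `|z|.

Definition rnorm (R : realType) (k : scalar_kind)
    (X : normedModType (scalars R k)) (f : X) : R :=
  real_part `|f|.

Section Bases.
Variables (R : realType) (k : scalar_kind).
Variable X : completeNormedModType (scalars R k).
Implicit Types (x : nat -> X) (f : X).

(* Basis vectors are indexed from 0: x j is the (j+1)-st vector. *)
Definition expansion x f : set (nat -> scalars R k) :=
  [set a | series (fun j => a j *: x j) @ \oo --> f].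

Definition schauder_basis x := forall f, exists! a, expansion x f a.

Definition semi_normalized x :=
  (0 < ereal_inf (range (fun j => (rnorm (x j))%:E)))%E /\
  (ereal_sup (range (fun j => (rnorm (x j))%:E)) < +oo)%E.

Definition is_basis x := schauder_basis x /\ semi_normalized x.

(* coef x f j is the value at f of the coordinate functional of index j. *)
Definition coef x f : nat -> scalars R k := xget (fun=> 0) (expansion x f).

(* Only meaningful when the series converges, e.g. if A or the support of f
   is finite. *)
Definition basis_proj x (A : set nat) f : X :=
  limn (series (fun j => if j \in A then coef x f j *: x j else 0)).

Definition almost_greedy x := exists C : R,
  forall f (A F : {fset nat}), (#|` A| <= #|` F|)%N ->
    (forall i j, i \notin F -> j \in F ->
       rabs (coef x f i) <= rabs (coef x f j)) ->
    rnorm (f - basis_proj x [set` F] f) <= C * rnorm (f - basis_proj x [set` A] f).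

Definition fundamental x (m : nat) : \bar R :=
  ereal_sup [set (rnorm (\sum_(j <- A) x j))%:E |
             A in [set A : {fset nat} | (#|` A| <= m)%N]].

(* Since indices start at 0, max (supp f) <= m reads: coef x f j = 0 for all
   j >= m. *)
Definition conditionality x (m : nat) : \bar R :=
  ereal_sup [set r : \bar R | exists f (A : set nat),
    [/\ f != 0, forall j, (m <= j)%N -> coef x f j = 0 &
        r = (rnorm (basis_proj x A f) / rnorm f)%:E]].

End Bases.

(* Domination of nonnegative sequences indexed by m >= 1. *)
Definition dominated (R : realType) (u v : nat -> \bar R) :=
  exists C : R, forall m, (0 < m)%N -> (u m <= C%:E * v m)%E.

Definition equivalent (R : realType) (u v : nat -> \bar R) :=
  dominated u v /\ dominated v u.

Section EllQ.
Variables (R : realType) (k : scalar_kind).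

Definition ellq (q : R) : set (nat -> scalars R k) :=
  [set a | cvgn (series (fun n => rabs (a n) `^ q))].

Definition ellq_norm (q : R) (a : nat -> scalars R k) : R :=
  (limn (series (fun n => rabs (a n) `^ q))) `^ q^-1.

Variable X : completeNormedModType (scalars R k).

Definition complemented (Y : set X) :=
  exists P : {linear X -> X},
    [/\ continuous P, range P = Y & forall y, Y y -> P y = y].

(* T is only constrained on ellq q; it is a linear bijection of ellq q onto Y,
   bounded together with its inverse. *)
Definition ellq_isomorphic_to (q : R) (Y : set X) :=
  exists T : (nat -> scalars R k) -> X,
    [/\ forall (c : scalars R k) a b, ellq q a -> ellq q b ->
          T (fun n => c * a n + b n) = c *: T a + T b,
        T @` ellq q = Y,
        (exists C : R, forall a, ellq q a -> rnorm (T a) <= C * ellq_norm q a) &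
        (exists C : R, forall a, ellq q a -> ellq_norm q a <= C * rnorm (T a))].

End EllQ.

(* Main.v *)
Require Import Defs.
From HB Require Import structures.
From mathcomp Require Import all_boot all_order all_algebra finmap.
From mathcomp Require Import all_classical all_reals all_analysis.
From mathcomp Require Import complex ring lra zify.
Import Order.TTheory GRing.Theory Num.Theory.
Import numFieldNormedType.Exports.
Local Open Scope classical_set_scope.
Local Open Scope ring_scope.

Set Implicit Arguments.
Unset Strict Implicit.
Unset Printing Implicit Defensive.

(** Two constructions are composed: a basis [b] of [X] whose conditionality
    grows like a power, and a passage to blocks of length [2 ^ n] which makes
    [b] almost greedy at the price of replacing [m] by [log m].

    The first one takes place in [ellq]. For [- 1 / q < s < 1 - 1 / q] the
    columns of the lower triangular Toeplitz matrix of [(1 - z) ^ - s] form a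
    basis of [ellq]: the partial sum operator of order [m] is the identity on
    the first [m] coordinates and, below them, the corner of the product of the
    matrix and its inverse. A telescoping identity (lemma [tri_prod]) shows that
    this corner is [(x / r) ^ s / (x + r)] up to a bounded factor, a kernel
    which Schur's test bounds on [ellq] (lemma [corner_schur]). The sum of the
    first [n] vectors has coordinates of order [i ^ s], hence norm of order
    [n ^ (s + 1 / q)]. Let [u] and [v] be these bases for the parameters
    [a (1 - 1 / q)] and [- a / q]: the norms of the two sums differ by the
    factor [n ^ a], so that the basis with vectors [u j + v j] and [u j - v j]
    of the sum of two copies of [ellq] is conditional of order [n ^ a]. As
    [ellq] is complemented in [X], the space [X] is isomorphic to the sum of
    [X] and [ellq], and a given basis of [X] may be interleaved with the one
    just found (lemma [conditional_basis]).

    In the second one the vectors of the [n]-th block are a multiple of [b n]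
    plus the centred unit vectors of that block of [ellq]. They live in the sum
    of [X] and the sequences with null block means, which is again isomorphic
    to [X], since the missing block means form a copy of [ellq] that [X]
    absorbs (lemma [block_splitting_of_ellq]). Combinations constant on blocks
    reproduce those of [b] (lemma [blocked_transfer]), which turns [n ^ a] into
    [(log m) ^ a].

    Almost greediness rests on two estimates (lemmas [blocked_upper] and
    [blocked_lower]): a finite sum is controlled by the [ellq] norm of its
    coefficients together with their [l_1] norm for the weight
    [j ^ (- (1 - 1 / q))], and the coefficients of a vector of norm 1 differ
    from an element of the unit ball of [ellq] by [O(j ^ (- 1 / q))]. Given
    these, let [t] be the threshold of a greedy sum of a vector of norm 1. Up
    to the index [N] of order [t ^ - q], the greedy sum differs from a partial
    sum by at most [N] terms with coefficients at most [t], which is harmless;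
    beyond [N] the selected coefficients are dominated by the element of
    [ellq], and there are at most [N] of them (lemma [greedy_sum_le]). Counting
    large coefficients in the same way gives the fundamental function. The
    partial sums are bounded by Baire's theorem (lemma [basis_constant]). *)

(** * Inequalities for real powers *)

Section RealInequalities.
Variable R : realType.
Implicit Types (s t x y q b : R).

(** Young's inequality for the numbers [(1 + t) ^ s] and 1. *)
Lemma bernoulli_powR s t : 0 <= s -> s <= 1 -> -1 <= t ->
  (1 + t) `^ s <= 1 + s * t.
Proof.
move=> s0 s1 t1.
have [->|sn0] := eqVneq s 0; first by rewrite powRr0 mul0r addr0.
have [->|sn1] := eqVneq s 1; first by rewrite mul1r powRr1//; lra.
have sp : 0 < s by rewrite lt_neqAle eq_sym sn0.
have s1p : 0 < 1 - s by rewrite subr_gt0 lt_neqAle sn1.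
have t0 : 0 <= 1 + t by lra.
have := @conjugate_powR R ((1 + t) `^ s) 1 s^-1 (1 - s)^-1
  (powR_ge0 _ _) ler01.
rewrite !invr_gt0 => /(_ sp s1p); rewrite !invrK addrC subrK => /(_ erefl).
by rewrite mulr1 powR1 -powRrM mulfV// powRr1//; lra.
Qed.

(** The graph of [x ^ q] lies above its tangent at [y]; this is again Young's
    inequality, for [x] and [y ^ (q - 1)]. *)
Lemma powR_tangent q x y : 1 < q -> 0 <= x -> 0 <= y ->
  q * (x * y `^ (q - 1)) <= x `^ q + (q - 1) * y `^ q.
Proof.
move=> q1 x0 y0; have q0 : 0 < q by lra.
have qm : 0 < q - 1 by lra.
have := @conjugate_powR R x (y `^ (q - 1)) q (q / (q - 1)) x0 (powR_ge0 _ _) q0.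
rewrite divr_gt0// => /(_ isT).
have -> : q^-1 + (q / (q - 1))^-1 = 1 by field; rewrite !gt_eqF.
move=> /(_ erefl); rewrite -powRrM.
have -> : (q - 1) * (q / (q - 1)) = q by field; rewrite gt_eqF.
move=> h; apply: (le_trans (ler_wpM2l (ltW q0) h)).
rewrite le_eqVlt; apply/orP; left; apply/eqP; field.
by rewrite !gt_eqF.
Qed.

(** The tangent inequality at the weighted mean of [y], averaged. *)
Lemma jensen_powR (I : Type) (r : seq I) (P : pred I) (w y : I -> R) q :
  1 < q -> (forall i, P i -> 0 <= w i) -> (forall i, P i -> 0 <= y i) ->
  (\sum_(i <- r | P i) w i * y i) `^ q <=
  (\sum_(i <- r | P i) w i) `^ (q - 1) * \sum_(i <- r | P i) w i * y i `^ q.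
Proof.
move=> q1 w0 y0; have q0 : 0 < q by lra.
set W := \sum_(i <- r | P i) w i; set S := \sum_(i <- r | P i) w i * y i.
have W0 : 0 <= W by exact: sumr_ge0.
have S0 : 0 <= S by apply: sumr_ge0 => i Pi; rewrite mulr_ge0 ?w0 ?y0.
have T0 : 0 <= \sum_(i <- r | P i) w i * y i `^ q.
  by apply: sumr_ge0 => i Pi; rewrite mulr_ge0 ?w0 ?powR_ge0.
have [WE|Wn0] := eqVneq W 0.
  suff -> : S = 0.
    by rewrite powR0 ?gt_eqF// mulr_ge0// powR_ge0.
  move: WE; rewrite /W /S; elim: (r) => [|i l IH]; first by rewrite !big_nil.
  rewrite !big_cons; case: ifP => // Pi /eqP.
  rewrite paddr_eq0 ?w0// ?sumr_ge0// => /andP[/eqP -> /eqP /IH ->].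
  by rewrite mul0r addr0.
have Wp : 0 < W by rewrite lt_neqAle eq_sym Wn0.
set m := S / W.
have m0 : 0 <= m by rewrite divr_ge0.
have SE : S = m * W by rewrite /m divfK.
have key : q * (S * m `^ (q - 1)) <=
    \sum_(i <- r | P i) w i * y i `^ q + W * ((q - 1) * m `^ q).
  rewrite /S /W !mulr_suml mulr_sumr -big_split /=.
  apply: ler_sum => i Pi.
  have := powR_tangent q1 (y0 i Pi) m0 => /(ler_wpM2l (w0 i Pi)).
  by rewrite mulrDr !mulrA [w i * q]mulrC.
have mq : m * m `^ (q - 1) = m `^ q by rewrite mulr_powRB1.
have {}key : W * m `^ q <= \sum_(i <- r | P i) w i * y i `^ q.
  move: key; rewrite SE.
  have -> : q * (m * W * m `^ (q - 1)) = q * W * (m * m `^ (q - 1)) by ring.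
  by rewrite mq; lra.
rewrite SE powRM// -(mulr_powRB1 (ltW Wp) q0).
have -> : m `^ q * (W * W `^ (q - 1)) = W `^ (q - 1) * (W * m `^ q) by ring.
by rewrite ler_wpM2l ?powR_ge0.
Qed.

Lemma powR_superadditive q x y : 1 <= q -> 0 <= x -> 0 <= y ->
  x `^ q + y `^ q <= (x + y) `^ q.
Proof.
move=> q1 x0 y0; have q0 : 0 < q by lra.
have mono u v : 0 <= u -> u <= v -> u `^ (q - 1) <= v `^ (q - 1).
  by move=> u0 uv; rewrite ge0_ler_powR ?nnegrE ?(le_trans u0 uv)//; lra.
rewrite -(mulr_powRB1 x0 q0) -(mulr_powRB1 y0 q0) -(mulr_powRB1 (addr_ge0 x0 y0) q0).
by rewrite mulrDl lerD// ler_wpM2l// mono//; lra.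
Qed.

Lemma powR_quasi_convex q x y : 0 <= q -> 0 <= x -> 0 <= y ->
  (x + y) `^ q <= 2 `^ q * (x `^ q + y `^ q).
Proof.
move=> q0 x0 y0.
have h u v : 0 <= u -> u <= v -> (u + v) `^ q <= 2 `^ q * v `^ q.
  move=> u0 uv; have v0 : 0 <= v by lra.
  by rewrite -powRM// ge0_ler_powR ?nnegrE//; lra.
have := powR_ge0 x q; have := powR_ge0 y q; have := powR_ge0 2 q => p2 py px.
case: (leP x y) => [xy|/ltW yx].
  by apply: (le_trans (h _ _ x0 xy)); rewrite ler_wpM2l//; lra.
rewrite addrC; apply: (le_trans (h _ _ y0 yx)).
by rewrite ler_wpM2l//; lra.
Qed.

(** Bernoulli's inequality at [- 1 / (i + 1)]; the right-hand sides telescope. *)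
Lemma powR_increment_lb b (i : nat) : 0 < b -> b < 1 ->
  (1 - b) * i.+1%:R `^ (- b) <= i.+1%:R `^ (1 - b) - i%:R `^ (1 - b).
Proof.
move=> b0 b1; set z : R := i.+1%:R.
have zp : 0 < z by rewrite ltr0n.
have iE : i%:R = z * (1 + (- z^-1)) :> R.
  by rewrite mulrDr mulr1 mulrN mulfV ?gt_eqF// /z -natr1 addrK.
have zi1 : z^-1 <= 1 by rewrite invf_le1// ler1n.
have zim : -1 <= - z^-1 by rewrite lerN2.
have z10 : 0 <= 1 + - z^-1 by rewrite subr_ge0.
have h := @bernoulli_powR (1 - b) (- z^-1) ltac:(lra) ltac:(lra) zim.
rewrite iE powRM ?(ltW zp)//.
have -> : z `^ (1 - b) = z * z `^ (- b).
  by rewrite powRD ?(gt_eqF zp) ?implybT// powRr1// ltW.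
have pz := powR_gt0 (- b) zp.
have zb : 0 <= z * z `^ (- b) by rewrite mulr_ge0 ?ltW.
apply: (@le_trans _ _ (z * z `^ (- b) * (1 - (1 + (1 - b) * (- z^-1))))).
  rewrite le_eqVlt; apply/orP; left; apply/eqP; field.
  by rewrite gt_eqF.
rewrite -[X in _ <= X - _]mulr1 -mulrBr ler_wpM2l//.
move: h; rewrite mulrN; set u := (1 - b) * z^-1; set v := _ `^ _; lra.
Qed.

Lemma sum_powRN_le b n : 0 < b -> b < 1 ->
  \sum_(i < n) i.+1%:R `^ (- b) <= n%:R `^ (1 - b) / (1 - b).
Proof.
move=> b0 b1; rewrite ler_pdivlMr ?subr_gt0// mulrC.
elim: n => [|n IH]; first by rewrite big_ord0 mulr0 powR_ge0.
rewrite big_ord_recr /= mulrDr; have := powR_increment_lb n b0 b1; lra.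
Qed.

Lemma powR_decrement_lb b (i : nat) : 0 < b -> b < 1 ->
  b * i.+2%:R `^ (- b - 1) <= i.+1%:R `^ (- b) - i.+2%:R `^ (- b).
Proof.
move=> b0 b1; set z : R := i.+2%:R.
have zp : 0 < z by rewrite ltr0n.
have z1 : 1 < z by rewrite ltr1n.
have iE : i.+1%:R = z * (1 + (- z^-1)) :> R.
  by rewrite mulrDr mulr1 mulrN mulfV ?gt_eqF// /z -[i.+2%:R]natr1 addrK.
have zi1 : z^-1 < 1 by rewrite invf_lt1.
have zip : 0 < z^-1 by rewrite invr_gt0.
have zim : -1 <= - z^-1 by rewrite lerN2 ltW.
have z10 : 0 <= 1 + - z^-1 by rewrite subr_ge0 ltW.
have h := @bernoulli_powR b (- z^-1) ltac:(lra) ltac:(lra) zim.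
have up : 0 < (1 - z^-1) `^ b by rewrite powR_gt0// subr_gt0.
have b1p : 0 < b * z^-1 by rewrite mulr_gt0.
have hi : 1 + b * z^-1 <= (1 - z^-1) `^ (- b).
  rewrite powRN -[X in _ <= X]mul1r ler_pdivlMr//.
  move: h b1p up; rewrite mulrN; set u := b * z^-1; set v := _ `^ _.
  by move=> h u0 v0; nra.
rewrite iE powRM ?(ltW zp)//.
have pz := powR_gt0 (- b) zp.
have -> : z `^ (- b - 1) = z `^ (- b) * z^-1.
  by rewrite powRB ?(gt_eqF zp) ?implybT// powRr1// ltW.
have -> : b * (z `^ (- b) * z^-1) = z `^ (- b) * (b * z^-1) by ring.
rewrite -[X in _ <= _ - X]mulr1 -mulrBr ler_wpM2l ?(ltW pz)//.
move: hi; set u := b * z^-1; set v := _ `^ _; lra.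
Qed.

Lemma tail_powRN_le b r n : 0 < b -> b < 1 ->
  \sum_(i < n) (r + i).+2%:R `^ (- b - 1) <= r.+1%:R `^ (- b) / b.
Proof.
move=> b0 b1; rewrite ler_pdivlMr// mulrC.
suff : b * \sum_(i < n) (r + i).+2%:R `^ (- b - 1) <=
    r.+1%:R `^ (- b) - (r + n).+1%:R `^ (- b).
  by have := powR_ge0 (r + n).+1%:R (- b); lra.
elim: n => [|n IH]; first by rewrite big_ord0 mulr0 addn0 subrr.
rewrite big_ord_recr /= mulrDr addnS.
by have := powR_decrement_lb (r + n) b0 b1; lra.
Qed.

(** Discrete form of the substitution x = r u in the integral of
    x ^ (- b) / (x + r): split at x = r and drop the smaller summand of the
    denominator on each side. *)
Lemma hilbert_sum_le b r n : 0 < b -> b < 1 ->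
  \sum_(x < n) x.+1%:R `^ (- b) / (x + r).+1%:R <=
  ((1 - b)^-1 + b^-1) * r.+1%:R `^ (- b).
Proof.
move=> b0 b1.
have F0 (x : nat) : 0 <= x.+1%:R `^ (- b) / (x + r).+1%:R :> R.
  by rewrite divr_ge0 ?powR_ge0.
apply: (@le_trans _ _ (\sum_(x < r.+1 + n) x.+1%:R `^ (- b) / (x + r).+1%:R)).
  rewrite addnC big_split_ord /= lerDl.
  exact: sumr_ge0.
rewrite big_split_ord /= mulrDl; apply: lerD.
  apply: (@le_trans _ _ (\sum_(i < r.+1) i.+1%:R `^ (- b) / r.+1%:R)).
    apply: ler_sum => i _; rewrite ler_wpM2l ?powR_ge0// lef_pV2 ?posrE ?ltr0n//.
    by rewrite ler_nat; lia.
  rewrite -mulr_suml ler_pdivrMr ?ltr0n//.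
  apply: (le_trans (sum_powRN_le _ b0 b1)).
  rewrite powRD ?pnatr_eq0 ?implybT// powRr1//.
  by rewrite le_eqVlt; apply/orP; left; apply/eqP; ring.
rewrite mulrC; apply: le_trans (tail_powRN_le r n b0 b1).
apply: ler_sum => i _; rewrite powRB ?pnatr_eq0 ?implybT// powRr1//.
rewrite addSn ler_wpM2l ?powR_ge0// lef_pV2 ?posrE ?ltr0n// ler_nat; lia.
Qed.

End RealInequalities.

(** * The fractional kernel *)

Section FractionalKernel.
Variable R : realType.
Implicit Types (s : R).

(** The coefficient of [z ^ k] in [(1 - z) ^ (- s - 1)]. *)
Definition frac_prod s (k : nat) : R := \prod_(i < k) (1 + s / i.+1%:R).

(** The coefficient of [z ^ k] in [(1 - z) ^ - s]. *)
Definition frac_coef s (k : nat) : R :=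
  if k is k'.+1 then s * frac_prod s k' / k'.+1%:R else 1.

Lemma frac_prodS s k :
  frac_prod s k.+1 = frac_prod s k * (1 + s / k.+1%:R).
Proof. by rewrite /frac_prod big_ord_recr. Qed.

Lemma frac_prod0 s : frac_prod s 0 = 1.
Proof. by rewrite /frac_prod big_ord0. Qed.

Lemma frac_coef_sum s k : \sum_(i < k.+1) frac_coef s i = frac_prod s k.
Proof.
elim: k => [|k IH]; first by rewrite big_ord1 frac_prod0.
by rewrite big_ord_recr IH /= frac_prodS mulrDr mulr1; congr (_ + _); ring.
Qed.

(** Factor by factor, [1 + s / i >= ((i + 1) / i) ^ s], and the right-hand
    sides have a telescoping product. *)
Lemma frac_prod_ge s k : 0 <= s -> s <= 1 -> k.+1%:R `^ s <= frac_prod s k.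
Proof.
move=> s0 s1; elim: k => [|k IH]; first by rewrite frac_prod0 powR1.
have kp : 0 < k.+1%:R :> R by rewrite ltr0n.
have -> : k.+2%:R = k.+1%:R * (1 + k.+1%:R^-1) :> R.
  by rewrite mulrDr mulr1 mulfV ?gt_eqF// natr1.
have ki : 0 <= k.+1%:R^-1 :> R by rewrite invr_ge0 ltW.
rewrite powRM ?addr_ge0 ?(ltW kp)// frac_prodS.
apply: ler_pM; rewrite ?powR_ge0//.
by apply: bernoulli_powR => //; rewrite (le_trans _ ki)// lerN10.
Qed.

Lemma frac_prod_gt0 s k : -1 < s -> 0 < frac_prod s k.
Proof.
move=> s1; rewrite /frac_prod; apply: prodr_gt0 => i _.
have ip : 0 < i.+1%:R :> R by rewrite ltr0n.
have -> : 1 + s / i.+1%:R = (i.+1%:R + s) / i.+1%:R by rewrite mulrDl mulfV ?gt_eqF.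
rewrite divr_gt0//.
have : 1 <= i.+1%:R :> R by rewrite ler1n.
by move=> ?; lra.
Qed.

Lemma frac_prod_le_neg s k : -1 < s -> s <= 0 ->
  frac_prod s k <= k.+1%:R `^ s.
Proof.
move=> s1 s0; elim: k => [|k IH]; first by rewrite frac_prod0 powR1.
have kp : 0 < k.+1%:R :> R by rewrite ltr0n.
have -> : k.+2%:R = k.+1%:R * (1 + k.+1%:R^-1) :> R.
  by rewrite mulrDr mulr1 mulfV ?gt_eqF// natr1.
rewrite frac_prodS.
have : 0 < k.+1%:R^-1 :> R by rewrite invr_gt0.
have : k.+1%:R^-1 <= 1 :> R by rewrite invf_le1// ler1n.
move: (k.+1%:R^-1) => y y1 y0.
rewrite powRM ?(ltW kp)//; last lra.
have h := @bernoulli_powR _ (- s) y ltac:(lra) ltac:(lra) ltac:(lra).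
have p0 : 0 < (1 + y) `^ (- s) by rewrite powR_gt0//; lra.
have su : 0 <= 1 + s * y by nra.
apply: ler_pM; rewrite ?(ltW (frac_prod_gt0 _ _))//.
rewrite -[s in X in _ <= X]opprK powRN -[X in _ <= X]mul1r ler_pdivlMr//.
by apply: (le_trans (ler_wpM2l su h)); nra.
Qed.

(** As in the lower bound, but with the factors [(i / (i - 1)) ^ s]; the first
    factor [1 + s] is left out of the comparison and costs the constant 2. *)
Lemma frac_prod_le s k : -1 < s -> s < 1 -> frac_prod s k <= 2 * k.+1%:R `^ s.
Proof.
move=> s1 s2; have [s0|s0] := leP s 0.
  apply: (le_trans (frac_prod_le_neg _ s1 s0)).
  by have := powR_ge0 k.+1%:R s; lra.
case: k => [|k]; first by rewrite frac_prod0 powR1; lra.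
apply: (@le_trans _ _ (2 * k.+1%:R `^ s)); last first.
  by rewrite ler_wpM2l// ge0_ler_powR ?nnegrE ?ler_nat// ltW.
elim: k => [|k IH]; first by rewrite frac_prodS frac_prod0 powR1 divr1; lra.
have kp2 : 0 < k.+2%:R :> R by rewrite ltr0n.
have kE : k.+1%:R = k.+2%:R * (1 + - k.+2%:R^-1) :> R.
  by rewrite mulrDr mulr1 mulrN mulfV ?gt_eqF// -[in X in X - 1]natr1 addrK.
rewrite frac_prodS; move: IH; rewrite kE.
have : 0 < k.+2%:R^-1 :> R by rewrite invr_gt0.
have : k.+2%:R^-1 < 1 :> R by rewrite invf_lt1// ltr1n.
move: (k.+2%:R^-1) => y y1 y0 IH.
have h := @bernoulli_powR _ s (- y) ltac:(lra) ltac:(lra) ltac:(lra).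
have su : 0 <= 1 + s * y by nra.
apply: (le_trans (ler_wpM2r su IH)).
rewrite -mulrA ler_wpM2l// powRM ?(ltW kp2)//; last lra.
rewrite -mulrA -[X in _ <= X]mulr1 ler_wpM2l ?powR_ge0//.
by apply: (le_trans (ler_wpM2r su h)); nra.
Qed.

(** The sum telescopes: as a function of [r] with [d = r + x + 1] fixed, the
    right-hand side has increment [frac_coef (- s) r * frac_coef s (d - r)].
    It is the kernel of the corner of a fractional Toeplitz operator, and up
    to constants it equals [(x / r) ^ s / (x + r)]. *)
Lemma frac_coef_partial_conv s r x : 
  \sum_(l < r.+1) frac_coef (- s) l * frac_coef s (r + x.+1 - l) =
  s * frac_prod (- s) r * frac_prod s x / (r + x).+1%:R.
Proof.
elim: r x => [|r IH] x.
  by rewrite big_ord1 subn0 !add0n /= frac_prod0 mul1r mulr1.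
rewrite big_ord_recr.
have -> : (r.+1 + x.+1 = r + x.+2)%N by lia.
rewrite IH /= (_ : (r + x.+2 - r.+1 = x.+1)%N); last by lia.
rewrite /= !frac_prodS.
have rn : r.+1%:R != 0 :> R by rewrite pnatr_eq0.
have xn : x.+1%:R != 0 :> R by rewrite pnatr_eq0.
have -> : (r + x.+1).+1%:R = r.+1%:R + x.+1%:R :> R by rewrite -natrD; congr _%:R; lia.
have -> : (r.+1 + x).+1%:R = r.+1%:R + x.+1%:R :> R by rewrite -natrD; congr _%:R; lia.
have dn : r.+1%:R + x.+1%:R != 0 :> R by rewrite -natrD pnatr_eq0.
by move: r.+1%:R x.+1%:R rn xn dn => u v un vn uvn; field; rewrite un vn uvn.
Qed.

Lemma frac_coef_conv s d :
  \sum_(l < d.+1) frac_coef (- s) l * frac_coef s (d - l) = (d == 0%N)%:R.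
Proof.
case: d => [|d]; first by rewrite big_ord1 /= mulr1.
rewrite big_ord_recr /= subnn /=.
have := frac_coef_partial_conv s d 0; rewrite addn1 => ->.
by rewrite frac_prod0 addn0 /=; ring.
Qed.

(** The kernel [(x / r) ^ s / (x + r)] of Hardy and Hilbert type, for indices
    starting from 0. *)
Definition corner_kernel s (x r : nat) : R :=
  x.+1%:R `^ s * r.+1%:R `^ (- s) / (x + r).+1%:R.

Lemma corner_kernel_ge0 s x r : 0 <= corner_kernel s x r.
Proof. by rewrite /corner_kernel !mulr_ge0 ?powR_ge0. Qed.

Lemma frac_corner_le s x r : -1 < s -> s < 1 ->
  `|s * frac_prod (- s) r * frac_prod s x / (r + x).+1%:R| <=
  4 * corner_kernel s x r.
Proof.
move=> s1 s2; have s1' : -1 < - s by lra. have s2' : - s < 1 by lra.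
have p1 := frac_prod_gt0 r s1'; have p2 := frac_prod_gt0 x s1.
have l1 := frac_prod_le r s1' s2'; have l2 := frac_prod_le x s1 s2.
rewrite !normrM [X in _ * X]ger0_norm ?invr_ge0// (gtr0_norm p1) (gtr0_norm p2).
rewrite /corner_kernel addnC mulrA ler_wpM2r ?invr_ge0//.
have sn : `|s| <= 1 by rewrite ler_norml; lra.
apply: (@le_trans _ _ (1 * (2 * r.+1%:R `^ (- s)) * (2 * x.+1%:R `^ s))).
  apply: ler_pM => //; rewrite ?mulr_ge0 ?(ltW p1) ?(ltW p2)//.
  by apply: ler_pM => //; rewrite ltW.
by rewrite le_eqVlt; apply/orP; left; apply/eqP; ring.
Qed.

Section Schur.
Variables (q s : R).
Hypotheses (q1 : 1 < q) (s_gt : - q^-1 < s) (s_lt : s < 1 - q^-1).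

Let b := s + q^-1.
Let c := (1 - b)^-1 + b^-1.

Let b0 : 0 < b. Proof. by move: s_gt; rewrite /b -subr_gt0 opprK. Qed.
Let b1 : b < 1. Proof. by rewrite /b -ltrBrDr. Qed.
Let c0 : 0 <= c. Proof. by rewrite /c addr_ge0// invr_ge0 ?subr_ge0 ltW. Qed.
Let q0 : 0 < q. Proof. exact: lt_trans q1. Qed.

Let corner_row x m :
  \sum_(r < m) corner_kernel s x r * r.+1%:R `^ (- q^-1) <=
  c * x.+1%:R `^ (- q^-1).
Proof.
apply: (@le_trans _ _ (x.+1%:R `^ s *
    \sum_(r < m) r.+1%:R `^ (- b) / (r + x).+1%:R)).
  rewrite mulr_sumr; apply: ler_sum => r _.
  rewrite /corner_kernel /b opprD powRD ?pnatr_eq0 ?implybT// addnC.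
  by rewrite le_eqVlt; apply/orP; left; apply/eqP; ring.
apply: (le_trans (ler_wpM2l (powR_ge0 _ _) (hilbert_sum_le x m b0 b1))).
have -> : (- q^-1) = s + (- b) by rewrite /b; ring.
rewrite powRD ?pnatr_eq0 ?implybT// -/c.
by rewrite le_eqVlt; apply/orP; left; apply/eqP; ring.
Qed.

Let corner_col r n :
  \sum_(x < n) corner_kernel s x r * x.+1%:R `^ (- (1 - q^-1)) <=
  c * r.+1%:R `^ (- (1 - q^-1)).
Proof.
have b0' : 0 < 1 - b by have := b1; lra.
have b1' : 1 - b < 1 by have := b0; lra.
apply: (@le_trans _ _ (r.+1%:R `^ (- s) *
    \sum_(x < n) x.+1%:R `^ (- (1 - b)) / (x + r).+1%:R)).
  rewrite mulr_sumr; apply: ler_sum => x _.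
  have -> : - (1 - b) = s + (- (1 - q^-1)) by rewrite /b; ring.
  rewrite /corner_kernel powRD ?pnatr_eq0 ?implybT//.
  by rewrite le_eqVlt; apply/orP; left; apply/eqP; ring.
apply: (le_trans (ler_wpM2l (powR_ge0 _ _) (hilbert_sum_le r n b0' b1'))).
have -> : - (1 - q^-1) = - s + (- (1 - b)) by rewrite /b; ring.
rewrite powRD ?pnatr_eq0 ?implybT// subKr [(_^-1 + _^-1)]addrC -/c.
by rewrite le_eqVlt; apply/orP; left; apply/eqP; ring.
Qed.

(** Schur's test with the weight [r ^ (- 1 / q)]. Its two conditions are
    discrete Hilbert sums with exponents [s + 1 / q] and [1 - 1 / q - s], which
    converge exactly when both lie strictly between 0 and 1. *)
Lemma corner_schur : exists2 C, 0 <= C & forall n m (z : nat -> R),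
  (forall r, 0 <= z r) ->
  \sum_(x < n) (\sum_(r < m) corner_kernel s x r * z r) `^ q <=
  C * \sum_(r < m) z r `^ q.
Proof.
exists (c `^ (q - 1) * c); first by rewrite mulr_ge0 ?powR_ge0.
move=> n m z z0.
pose w (x r : nat) := corner_kernel s x r * r.+1%:R `^ (- q^-1).
have qn : q != 0 by rewrite gt_eqF.
have rp (r : nat) : 0 < r.+1%:R :> R by rewrite ltr0n.
have row (x : nat) : (\sum_(r < m) corner_kernel s x r * z r) `^ q <=
  c `^ (q - 1) * \sum_(r < m) (corner_kernel s x r * x.+1%:R `^ (- (1 - q^-1)))
     * r.+1%:R `^ (1 - q^-1) * z r `^ q.
  have -> : \sum_(r < m) corner_kernel s x r * z r =
      \sum_(r < m) w x r * (r.+1%:R `^ q^-1 * z r).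
    apply: eq_bigr => r _; rewrite /w -mulrA; congr (_ * _).
    by rewrite mulrA -powRD ?pnatr_eq0 ?implybT// addNr powRr0 mul1r.
  apply: (le_trans (@jensen_powR _ _ _ _ _ _ _ q1 _ _)).
  - by move=> r _; rewrite /w mulr_ge0 ?powR_ge0 ?corner_kernel_ge0.
  - by move=> r _; rewrite mulr_ge0 ?powR_ge0.
  have W0 : 0 <= \sum_(r < m) w x r.
    by apply: sumr_ge0 => r _; rewrite /w mulr_ge0 ?powR_ge0 ?corner_kernel_ge0.
  have h : (\sum_(r < m) w x r) `^ (q - 1) <=
           c `^ (q - 1) * x.+1%:R `^ (- (1 - q^-1)).
    have -> : - (1 - q^-1) = (- q^-1) * (q - 1).
      by rewrite mulrBr mulNr mulVf// mulr1; ring.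
    rewrite powRrM -powRM ?powR_ge0//.
    rewrite ge0_ler_powR ?nnegrE ?mulr_ge0 ?powR_ge0//; first by have := q1; lra.
    exact: corner_row.
  apply: (le_trans (ler_wpM2r _ h)).
    apply: sumr_ge0 => r _.
    by rewrite /w !mulr_ge0 ?powR_ge0 ?corner_kernel_ge0.
  rewrite -mulrA ler_wpM2l ?powR_ge0// mulr_sumr; apply: ler_sum => r _.
  rewrite powRM ?powR_ge0// -powRrM mulVf// powRr1 ?(ltW (rp _))//.
  have -> : r.+1%:R `^ (1 - q^-1) = r.+1%:R * r.+1%:R `^ (- q^-1).
    by rewrite powRD ?pnatr_eq0 ?implybT// powRr1// (ltW (rp _)).
  by rewrite /w le_eqVlt; apply/orP; left; apply/eqP; ring.
apply: (@le_trans _ _ (\sum_(x < n) (c `^ (q - 1) * \sum_(r < m)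
   (corner_kernel s x r * x.+1%:R `^ (- (1 - q^-1)))
     * r.+1%:R `^ (1 - q^-1) * z r `^ q))).
  by apply: ler_sum => x _; exact: row.
rewrite -mulr_sumr -mulrA ler_wpM2l ?powR_ge0// exchange_big /= mulr_sumr.
apply: ler_sum => r _.
rewrite -!mulr_suml; apply: ler_wpM2r; first exact: powR_ge0.
apply: (le_trans (ler_wpM2r (powR_ge0 _ _) (corner_col r n))).
by rewrite -mulrA -powRD ?pnatr_eq0 ?implybT// addNr powRr0 mulr1.
Qed.

(** One factor [corner_kernel s x r] is kept for the Schur sum over [x], the
    other [q - 1] are bounded uniformly in [x]. *)
Lemma corner_column : exists2 C, 0 <= C & forall n r,
  \sum_(x < n) corner_kernel s x r `^ q <= C * r.+1%:R `^ (- (q - 1)).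
Proof.
exists c => // n r.
have qn : q != 0 by rewrite gt_eqF.
have rp (k : nat) : 0 < k.+1%:R :> R by rewrite ltr0n.
have h (x : nat) : corner_kernel s x r `^ q <=
  corner_kernel s x r * x.+1%:R `^ (- (1 - q^-1)) *
  (r.+1%:R `^ (q^-1 - 1)) `^ (q - 1).
  have k0 := corner_kernel_ge0 s x r.
  rewrite -(mulr_powRB1 k0 q0) -mulrA ler_wpM2l//.
  have -> : - (1 - q^-1) = (- q^-1) * (q - 1).
    by rewrite mulrBr mulNr mulVf// mulr1; ring.
  rewrite powRrM -powRM ?powR_ge0//.
  rewrite ge0_ler_powR ?nnegrE ?mulr_ge0 ?powR_ge0//; first by have := q1; lra.
  rewrite powRN mulrC ler_pdivlMr ?powR_gt0//.
  rewrite /corner_kernel.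
  have -> : x.+1%:R `^ s * r.+1%:R `^ (- s) / (x + r).+1%:R * x.+1%:R `^ q^-1 =
    x.+1%:R `^ b * r.+1%:R `^ (- s) / (x + r).+1%:R.
    by rewrite /b [in RHS]powRD ?pnatr_eq0 ?implybT//; ring.
  have -> : q^-1 - 1 = (- s) + (- (1 - b)) by rewrite /b; ring.
  rewrite [X in _ <= X]powRD ?pnatr_eq0 ?implybT// mulrAC mulrC ler_wpM2l ?powR_ge0//.
  apply: (@le_trans _ _ ((x + r).+1%:R `^ b / (x + r).+1%:R)).
    rewrite ler_wpM2r ?invr_ge0// ge0_ler_powR ?nnegrE ?(ltW b0)//.
    by rewrite ler_nat; lia.
  have -> : (x + r).+1%:R `^ b / (x + r).+1%:R = (x + r).+1%:R `^ (- (1 - b)) :> R.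
    by rewrite opprB powRB ?pnatr_eq0 ?implybT// powRr1.
  rewrite !powRN lef_pV2 ?posrE ?powR_gt0//.
  rewrite ge0_ler_powR ?nnegrE ?subr_ge0 ?(ltW b1)//.
  by rewrite ler_nat; lia.
apply: (le_trans (ler_sum _ (fun (x : 'I_n) _ => h x))).
rewrite -mulr_suml.
apply: (le_trans (ler_wpM2r (powR_ge0 _ _) (corner_col r n))).
rewrite -mulrA ler_wpM2l// -powRrM -powRD ?pnatr_eq0 ?implybT//.
rewrite (_ : _ + _ = - (q - 1))//.
by field.
Qed.

End Schur.
End FractionalKernel.

(** * Real-valued norms over real or complex scalars *)

Section Scalars.
Variables (R : realType) (k : scalar_kind).
Local Notation K := (scalars R k).

Definition of_real : R -> K :=
  match k return R -> scalars R k with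
  | RealScalars => fun r => r
  | ComplexScalars => fun r => (r%:C)%C
  end.

Lemma of_realD : {morph of_real : x y / x + y}.
Proof. by rewrite /of_real; case: k => //= x y; rewrite rmorphD. Qed.

Lemma of_realM : {morph of_real : x y / x * y}.
Proof. by rewrite /of_real; case: k => //= x y; rewrite rmorphM. Qed.

Lemma of_realN : {morph of_real : x / - x}.
Proof. by rewrite /of_real; case: k => //= x; rewrite rmorphN. Qed.

Lemma of_real1 : of_real 1 = 1.
Proof. by rewrite /of_real; case: k => //=; rewrite rmorph1. Qed.

Lemma of_real0 : of_real 0 = 0.
Proof. by rewrite /of_real; case: k => //=; rewrite rmorph0. Qed.

Lemma of_realK : cancel of_real (@real_part R k).
Proof. by rewrite /of_real /real_part; case: k. Qed.

Lemma real_partK (z : K) : 0 <= z -> of_real (real_part z) = z.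
Proof.
rewrite /of_real /real_part; move: z; case: k => //= -[x y].
by rewrite lecE /= => /andP[/eqP -> _].
Qed.

Lemma le_of_real x y : (of_real x <= of_real y) = (x <= y).
Proof. by rewrite /of_real; case: k => //=; rewrite lecR. Qed.

Lemma lt_of_real x y : (of_real x < of_real y) = (x < y).
Proof. by rewrite /of_real; case: k => //=; rewrite ltcR. Qed.

Lemma norm_rabs (z : K) : `|z| = of_real (rabs z).
Proof. by rewrite /rabs real_partK. Qed.

Lemma rabs_ge0 (z : K) : 0 <= rabs z.
Proof. by rewrite -le_of_real of_real0 -norm_rabs. Qed.

Lemma of_real_inj : injective of_real. Proof. exact: can_inj of_realK. Qed.

Lemma rabsM (y z : K) : rabs (y * z) = rabs y * rabs z.
Proof. by apply: of_real_inj; rewrite of_realM -!norm_rabs normrM. Qed.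

Lemma rabsD (y z : K) : rabs (y + z) <= rabs y + rabs z.
Proof. by rewrite -le_of_real of_realD -!norm_rabs ler_normD. Qed.

Lemma rabsN (z : K) : rabs (- z) = rabs z.
Proof. by apply: of_real_inj; rewrite -!norm_rabs normrN. Qed.

Lemma rabs0 : rabs (0 : K) = 0.
Proof. by apply: of_real_inj; rewrite -!norm_rabs normr0 of_real0. Qed.

Lemma rabs1 : rabs (1 : K) = 1.
Proof. by apply: of_real_inj; rewrite -!norm_rabs normr1 of_real1. Qed.

Lemma rabs_eq0 (z : K) : rabs z = 0 -> z = 0.
Proof. by move=> h; apply/eqP; rewrite -normr_eq0 norm_rabs h of_real0. Qed.

Lemma rabs_of_real r : rabs (of_real r) = `|r|.
Proof.
have [r0|/ltW r0] := leP 0 r; apply: of_real_inj; rewrite -norm_rabs.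
  by rewrite !ger0_norm// -of_real0 le_of_real.
by rewrite !ler0_norm ?of_realN// -of_real0 le_of_real.
Qed.

Lemma rabsB_le (y z : K) : rabs y <= rabs z + rabs (y - z).
Proof. by rewrite -[X in rabs X <= _](subrK z) addrC rabsD. Qed.

Lemma rabs_sum (I : Type) (r : seq I) (P : pred I) (F : I -> K) :
  rabs (\sum_(i <- r | P i) F i) <= \sum_(i <- r | P i) rabs (F i).
Proof.
elim/big_ind2 : _ => [|x1 x2 y1 y2 h1 h2|//]; first by rewrite rabs0.
exact: le_trans (rabsD _ _) (lerD h1 h2).
Qed.

Lemma of_real_sum (I : Type) (r : seq I) (P : pred I) (F : I -> R) :
  of_real (\sum_(i <- r | P i) F i) = \sum_(i <- r | P i) of_real (F i).
Proof. by apply: (big_morph of_real); [exact: of_realD | exact: of_real0]. Qed.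

Lemma of_real_eq0 r : (of_real r == 0) = (r == 0).
Proof. by rewrite -of_real0 (inj_eq of_real_inj). Qed.

Lemma of_realV r : of_real r^-1 = (of_real r)^-1.
Proof.
have [->|r0] := eqVneq r 0; first by rewrite invr0 of_real0 invr0.
have h : of_real r * of_real r^-1 = 1 by rewrite -of_realM mulfV// of_real1.
have r0' : of_real r != 0 by rewrite of_real_eq0.
by apply: (mulfI r0'); rewrite h mulfV.
Qed.

Lemma of_real_nat n : of_real n%:R = n%:R.
Proof.
by elim: n => [|n IH]; rewrite ?of_real0// -!natr1 of_realD IH of_real1.
Qed.

Section Norm.
Variable X : normedModType K.
Implicit Types (f g : X) (u : nat -> X).

Lemma norm_rnorm f : `|f| = of_real (rnorm f).
Proof. by rewrite /rnorm real_partK. Qed.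

Lemma rnorm_ge0 f : 0 <= rnorm f.
Proof. by rewrite -le_of_real of_real0 -norm_rnorm. Qed.

Lemma rnorm0 : rnorm (0 : X) = 0.
Proof. by apply: of_real_inj; rewrite -norm_rnorm normr0 of_real0. Qed.

Lemma rnorm_eq0 f : rnorm f = 0 -> f = 0.
Proof. by move=> h; apply/eqP; rewrite -normr_eq0 norm_rnorm h of_real0. Qed.

Lemma rnorm_gt0 f : f != 0 -> 0 < rnorm f.
Proof.
move=> f0; rewrite lt_neqAle rnorm_ge0 andbT eq_sym.
by apply: contra_neq f0 => /rnorm_eq0.
Qed.

Lemma rnormZ (a : K) f : rnorm (a *: f) = rabs a * rnorm f.
Proof.
by apply: of_real_inj; rewrite of_realM -!norm_rnorm -norm_rabs normrZ.
Qed.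

Lemma rnormD f g : rnorm (f + g) <= rnorm f + rnorm g.
Proof. by rewrite -le_of_real of_realD -!norm_rnorm ler_normD. Qed.

Lemma rnormN f : rnorm (- f) = rnorm f.
Proof. by apply: of_real_inj; rewrite -!norm_rnorm normrN. Qed.

Lemma rnormB f g : rnorm (f - g) <= rnorm f + rnorm g.
Proof. by rewrite -[rnorm g]rnormN rnormD. Qed.

Lemma rnorm_distC f g : rnorm (f - g) = rnorm (g - f).
Proof. by rewrite -rnormN opprB. Qed.

Lemma rnorm_sum (I : Type) (r : seq I) (P : pred I) (F : I -> X) :
  rnorm (\sum_(i <- r | P i) F i) <= \sum_(i <- r | P i) rnorm (F i).
Proof.
elim/big_ind2 : _ => [|x1 x2 y1 y2 h1 h2|//]; first by rewrite rnorm0.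
exact: le_trans (rnormD _ _) (lerD h1 h2).
Qed.

Definition tends u f := forall e : R, 0 < e ->
  exists N, forall n, (N <= n)%N -> rnorm (f - u n) < e.

Lemma tendsP u f : u @ \oo --> f <-> tends u f.
Proof.
split=> [h e e0|h].
  have e0' : 0 < of_real e by rewrite -of_real0 lt_of_real.
  move/cvgrPdist_lt: h => /(_ _ e0') h. case: h => N _ hN.
  exists N => n Nn; rewrite -lt_of_real -norm_rnorm.
  exact: hN.
apply/cvgrPdist_lt => e e0.
have eE : of_real (real_part e) = e by rewrite real_partK ?ltW.
have [|N hN] := h (real_part e); first by rewrite -lt_of_real eE of_real0.
exists N => // n /= Nn; rewrite norm_rnorm -eE lt_of_real.
exact: hN.
Qed.

Lemma tends_unique u f g : tends u f -> tends u g -> f = g.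
Proof. by move=> /tendsP h1 /tendsP h2; apply: (cvg_unique _ h1 h2). Qed.

Lemma tendsD u v f g : tends u f -> tends v g ->
  tends (fun n => u n + v n) (f + g).
Proof. by move=> /tendsP h1 /tendsP h2; apply/tendsP; exact: cvgD. Qed.


End Norm.
End Scalars.

(** * The sequence space *)

#[global] Opaque powR.

Section Ellq.
Variables (R : realType) (k : scalar_kind) (q : R).
Hypothesis q1 : 1 < q.
Local Notation K := (scalars R k).
Local Notation ellq := (@ellq R k q).
Local Notation nq := (@ellq_norm R k q).
Implicit Types (a b : nat -> K).

Let q0 : 0 < q. Proof. exact: lt_trans q1. Qed.
Let qge0 : 0 <= q. Proof. exact: ltW. Qed.
Let qn0 : q != 0. Proof. exact: lt0r_neq0. Qed.

Definition qsum a n : R := \sum_(i < n) rabs (a i) `^ q.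

Lemma powR_leE (x y : R) : 0 <= x -> 0 <= y -> (x `^ q <= y `^ q) = (x <= y).
Proof.
move=> x0 y0; apply/idP/idP => [h|h]; last by rewrite ge0_ler_powR.
by rewrite leNgt; apply/negP => /(gt0_ltr_powR q0); rewrite !nnegrE ltNge h => /(_ y0 x0).
Qed.

Lemma powR_invK (x : R) : 0 <= x -> (x `^ q^-1) `^ q = x.
Proof. by move=> x0; rewrite -powRrM mulVf// powRr1. Qed.

Lemma qsum_series a : series (fun n => rabs (a n) `^ q) = qsum a.
Proof. by apply/funext => n; rewrite /series /= big_mkord. Qed.

Lemma qsum_nd a : {homo qsum a : m n / (m <= n)%N >-> m <= n}.
Proof.
move=> m n mn; rewrite /qsum -(subnKC mn) big_split_ord /= lerDl.
by apply: sumr_ge0 => i _; exact: powR_ge0.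
Qed.

Lemma qsum_ge0 a n : 0 <= qsum a n.
Proof. by apply: sumr_ge0 => i _; exact: powR_ge0. Qed.

Lemma ellq_cvg a : ellq a -> cvgn (qsum a).
Proof. by rewrite /Defs.ellq /mkset qsum_series. Qed.

Lemma bounded_ellq a B : (forall n, qsum a n <= B) -> ellq a.
Proof.
move=> h; rewrite /Defs.ellq /mkset qsum_series.
apply: nondecreasing_is_cvgn; first exact: qsum_nd.
by exists B => _ [n _ <-].
Qed.

Lemma ellq_norm_ge0 a : 0 <= nq a.
Proof. exact: powR_ge0. Qed.

Lemma ellq_norm_powR a : ellq a -> nq a `^ q = limn (qsum a).
Proof.
move=> h; rewrite /ellq_norm qsum_series powR_invK//.
apply: limr_ge; first exact: ellq_cvg.
by near=> n; exact: qsum_ge0.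
Unshelve. all: by end_near.
Qed.

Lemma qsum_le_norm a n : ellq a -> qsum a n <= nq a `^ q.
Proof.
move=> h; rewrite ellq_norm_powR//; apply: nondecreasing_cvgn_le.
  exact: qsum_nd.
exact: ellq_cvg.
Qed.

Lemma ellq_norm_le a B : 0 <= B -> (forall n, qsum a n <= B `^ q) ->
  ellq a /\ nq a <= B.
Proof.
move=> B0 h; have ha := bounded_ellq h; split=> //.
rewrite -powR_leE ?ellq_norm_ge0// ellq_norm_powR//.
apply: limr_le; first exact: ellq_cvg.
by near=> n; exact: h.
Unshelve. all: by end_near.
Qed.

#[local] Opaque ellq_norm.
#[local] Opaque Defs.ellq.

Lemma ellq_norm_scale a b C : 0 <= C -> ellq b ->
  (forall i, rabs (a i) <= C * rabs (b i)) -> ellq a /\ nq a <= C * nq b.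
Proof.
move=> C0 hb h; apply: ellq_norm_le; first by rewrite mulr_ge0 ?ellq_norm_ge0.
move=> n; rewrite powRM ?ellq_norm_ge0//.
apply: (@le_trans _ _ (C `^ q * qsum b n)); last first.
  by rewrite ler_wpM2l ?powR_ge0// qsum_le_norm.
rewrite /qsum mulr_sumr; apply: ler_sum => i _.
by rewrite -powRM ?rabs_ge0// powR_leE ?mulr_ge0 ?rabs_ge0.
Qed.

(** Quasi-convexity and superadditivity of [x ^ q] take the place of Minkowski's
    inequality; hence the constant 2. *)
Lemma ellqD a b : ellq a -> ellq b ->
  ellq (fun n => a n + b n) /\ nq (fun n => a n + b n) <= 2 * (nq a + nq b).
Proof.
move=> ha hb.
have sn : 0 <= nq a + nq b by rewrite addr_ge0 ?ellq_norm_ge0.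
apply: ellq_norm_le; first by rewrite mulr_ge0.
move=> n; rewrite powRM//.
apply: (@le_trans _ _ (2 `^ q * (qsum a n + qsum b n))).
  rewrite /qsum -big_split mulr_sumr; apply: ler_sum => i _.
  apply: le_trans (powR_quasi_convex qge0 (rabs_ge0 _) (rabs_ge0 _)).
  by rewrite powR_leE ?addr_ge0 ?rabs_ge0// rabsD.
rewrite ler_wpM2l ?powR_ge0//.
apply: le_trans (powR_superadditive (ltW q1) (ellq_norm_ge0 _) (ellq_norm_ge0 _)).
by apply: lerD; apply: qsum_le_norm.
Qed.

Lemma ellqZ (c : K) a : ellq a ->
  ellq (fun n => c * a n) /\ nq (fun n => c * a n) <= rabs c * nq a.
Proof.
move=> ha; apply: ellq_norm_scale => //; first exact: rabs_ge0.
by move=> i; rewrite rabsM.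
Qed.

Lemma ellq_lin (c : K) a b : ellq a -> ellq b -> ellq (fun n => c * a n + b n).
Proof. by move=> ha hb; have [h _] := ellqZ c ha; have [] := ellqD h hb. Qed.

Lemma ellqB a b : ellq a -> ellq b ->
  ellq (fun n => a n - b n) /\ nq (fun n => a n - b n) <= 2 * (nq a + nq b).
Proof.
move=> ha hb.
have [h1 h2] : ellq (fun n => - b n) /\ nq (fun n => - b n) <= 1 * nq b.
  by apply: ellq_norm_scale => // i; rewrite rabsN mul1r.
have [h3 h4] := ellqD ha h1.
split; first exact: h3.
apply: (le_trans h4).
apply: ler_wpM2l; first exact: ler0n.
rewrite lerD2l.
rewrite -[nq b]mul1r.
exact: h2.
Qed.

Lemma rabs_le_norm a i : ellq a -> rabs (a i) <= nq a.
Proof.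
move=> ha; rewrite -powR_leE ?rabs_ge0 ?ellq_norm_ge0//.
apply: le_trans (qsum_le_norm i.+1 ha).
by rewrite /qsum big_ord_recr /= lerDr qsum_ge0.
Qed.

Lemma ellq0 : ellq (fun=> 0) /\ nq (fun=> 0) = 0.
Proof.
have [h1 h2] : ellq (fun=> 0) /\ nq (fun=> 0) <= 0.
  apply: ellq_norm_le => // n; rewrite /qsum big1 ?powR_ge0// => i _.
  by rewrite rabs0 powR0.
by split => //; apply/eqP; rewrite eq_le h2 ellq_norm_ge0.
Qed.

Lemma finite_ellq a N : (forall n, (N <= n)%N -> a n = 0) -> ellq a.
Proof.
move=> h; apply: (@bounded_ellq _ (qsum a N)) => n.
have [nN|/ltnW Nn] := leqP n N; first exact: qsum_nd.
rewrite /qsum -(subnKC Nn) big_split_ord /= [X in _ + X]big1 ?addr0// => i _.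
by rewrite h ?leq_addr// rabs0 powR0.
Qed.

Lemma finite_ellq_norm a N : (forall n, (N <= n)%N -> a n = 0) ->
  nq a = qsum a N `^ q^-1.
Proof.
move=> h; have ha := finite_ellq h.
have le n : qsum a n <= qsum a N.
  have [nN|/ltnW Nn] := leqP n N; first exact: qsum_nd.
  rewrite /qsum -(subnKC Nn) big_split_ord /= [X in _ + X]big1 ?addr0// => i _.
  by rewrite h ?leq_addr// rabs0 powR0.
apply/eqP; rewrite eq_le; apply/andP; split.
  have [] := @ellq_norm_le a (qsum a N `^ q^-1) (powR_ge0 _ _) => //.
  by move=> n; rewrite powR_invK ?qsum_ge0.
rewrite -powR_leE.
rewrite powR_invK.
apply: qsum_le_norm.
exact: ha.
exact: qsum_ge0.
exact: powR_ge0.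
exact: ellq_norm_ge0.
Qed.

Definition trunc_from m a : nat -> K := fun n => if (m <= n)%N then a n else 0.
Definition trunc_to m a : nat -> K := fun n => if (n < m)%N then a n else 0.

Lemma trunc_to_ellq m a : ellq (trunc_to m a).
Proof. by apply: (@finite_ellq _ m) => n; rewrite /trunc_to ltnNge => ->. Qed.

Lemma trunc_from_ellq m a : ellq a -> ellq (trunc_from m a) /\ nq (trunc_from m a) <= nq a.
Proof.
move=> ha; rewrite -[nq a]mul1r.
apply: ellq_norm_scale => // i; rewrite mul1r /trunc_from.
by case: ifP => //; rewrite rabs0 rabs_ge0.
Qed.

Lemma trunc_from_cvg0 a : ellq a -> forall e, 0 < e ->
  exists N, forall n, (N <= n)%N -> nq (trunc_from n a) < e.
Proof.
move=> ha e e0; pose e' := e / 2.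
have e'0 : 0 < e' by rewrite divr_gt0.
have cv : qsum a @ \oo --> nq a `^ q.
  by rewrite ellq_norm_powR//; exact: ellq_cvg.
have : 0 < e' `^ q by rewrite powR_gt0.
move/cvgrPdist_lt: cv => /[apply] -[N _ hN].
exists N => n Nn; apply: (@le_lt_trans _ _ e'); last by rewrite /e'; lra.
have [] // := @ellq_norm_le (trunc_from n a) e' (ltW e'0).
move=> m; have [mn|/ltnW nm] := leqP m n.
  rewrite /qsum big1 ?powR_ge0// => i _.
  by rewrite /trunc_from leqNgt (leq_trans (ltn_ord i) mn) /= rabs0 powR0.
have := hN n Nn; have := qsum_le_norm m ha.
rewrite ltr_norml /qsum -(subnKC nm) !big_split_ord /=.
rewrite [X in _ -> _ -> X + _ <= _]big1 ?add0r; last first.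
  by move=> i _; rewrite /trunc_from leqNgt (ltn_ord i) /= rabs0 powR0.
have -> : \sum_(i < m - n) rabs (trunc_from n a (n + i)) `^ q =
   \sum_(i < m - n) rabs (a (n + i)%N) `^ q.
  by apply: eq_bigr => i _; rewrite /trunc_from leq_addr.
by move=> h /andP[_ h2]; rewrite /qsum in h2; lra.
Qed.

End Ellq.

#[global] Opaque ellq_norm Defs.ellq.

(** A map of [ellq] into a normed space, known only through its restriction
    to [ellq]. *)
Section LinearOnEllq.
Variables (R : realType) (k : scalar_kind) (q : R).
Hypothesis q1 : 1 < q.
Local Notation K := (scalars R k).
Variables (X : normedModType K) (La : (nat -> K) -> X).

Definition ellq_linear := forall (c : K) a b, ellq q a -> ellq q b ->
  La (fun n => c * a n + b n) = c *: La a + La b.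

Hypothesis Lin : ellq_linear.

Lemma ellq_linear0 : La (fun=> 0) = 0.
Proof.
have [h _] := @ellq0 R k q q1.
have := @Lin (-1) _ _ h h; rewrite scaleN1r addNr => <-.
by congr La; apply/funext => n; rewrite mulr0 addr0.
Qed.

Lemma ellq_linearD a b : ellq q a -> ellq q b ->
  La (fun n => a n + b n) = La a + La b.
Proof.
move=> ha hb; rewrite -[X in _ = X + _]scale1r -Lin//; congr La.
by apply/funext => n; rewrite mul1r.
Qed.

Lemma ellq_linearB a b : ellq q a -> ellq q b ->
  La (fun n => a n - b n) = La a - La b.
Proof.
move=> ha hb; rewrite addrC -[X in _ = X + _]scaleN1r -Lin//; congr La.
by apply/funext => n; rewrite mulN1r addrC.
Qed.

Lemma ellq_linear_sum (I : Type) (r : seq I) (P : pred I) (c : I -> K) (w : I -> nat -> K) :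
  (forall i, ellq q (w i)) ->
  ellq q (fun n => \sum_(i <- r | P i) c i * w i n) /\
  La (fun n => \sum_(i <- r | P i) c i * w i n) =
  \sum_(i <- r | P i) c i *: La (w i).
Proof.
move=> hw; elim: r => [|i r [IH1 IH2]].
  have E : (fun n => \sum_(i <- [::] | P i) c i * w i n) = (fun=> 0).
    by apply/funext => n; rewrite big_nil.
  by rewrite E ellq_linear0 big_nil; split => //; have [] := @ellq0 R k q q1.
rewrite big_cons; case: ifP => Pi; last first.
  have -> : (fun n => \sum_(j <- i :: r | P j) c j * w j n) =
      (fun n => \sum_(j <- r | P j) c j * w j n).
    by apply/funext => n; rewrite big_cons Pi.
  by [].
have -> : (fun n => \sum_(j <- i :: r | P j) c j * w j n) =
    (fun n => c i * w i n + \sum_(j <- r | P j) c j * w j n).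
  by apply/funext => n; rewrite big_cons Pi.
split; first exact: (@ellq_lin R k q q1 (c i) _ _ (hw i) IH1).
by rewrite (Lin _ (hw i) IH1) IH2.
Qed.

End LinearOnEllq.


(** * Completeness *)

Section Completeness.
Variables (R : realType).

Lemma geometric_small (C e : R) : 0 < e -> exists N, forall n, (N <= n)%N ->
  C * 2^-1 ^+ n < e.
Proof.
move=> e0; pose D := `|C| + 1.
have D0 : 0 < D by rewrite ltr_wpDl.
have h0 : 0 <= 2^-1 :> R by lra.
have /cvgrPdist_lt h : (2^-1 : R) ^+ n @[n --> \oo] --> (0 : R).
  by apply: cvg_expr; rewrite ger0_norm; lra.
have [|N _ hN] := h (e / D); first by rewrite divr_gt0.
exists N => n Nn; have := hN n Nn.
rewrite sub0r normrN ger0_norm ?exprn_ge0// ltr_pdivlMr// mulrC.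
apply: le_lt_trans; rewrite ler_wpM2r ?exprn_ge0//.
by rewrite (le_trans (ler_norm _))// lerDl.
Qed.

Lemma real_cauchy_cvg (u : nat -> R) :
  (forall e, 0 < e -> exists N, forall m n, (N <= m)%N -> (N <= n)%N ->
    `|u m - u n| < e) ->
  exists l, forall e, 0 < e -> exists N, forall n, (N <= n)%N -> `|l - u n| < e.
Proof.
move=> h.
have cu : cvgn u.
  apply/cauchy_cvgP; apply: cauchy_exP => e e0.
  have [N hN] := h e e0; exists (u N); exists N => // n /= Nn.
  by rewrite -ball_normE /ball_ /=; exact: hN.
exists (limn u) => e e0.
have /cvgrPdist_lt/(_ e e0)[N _ hN] := cu.
by exists N => n Nn; exact: hN.
Qed.

Variable k : scalar_kind.
Local Notation K := (scalars R k).

Lemma scalars_cauchy_cvg (u : nat -> K) :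
  (forall e : R, 0 < e -> exists N, forall m n, (N <= m)%N -> (N <= n)%N ->
    rabs (u m - u n) < e) ->
  exists l, forall e : R, 0 < e ->
    exists N, forall n, (N <= n)%N -> rabs (l - u n) < e.
Proof.
rewrite /rabs /real_part; move: u; case: k => /= u h.
  by have [l hl] := real_cauchy_cvg h; exists l.
have nE (z : R[i]) : complex.Re `|z| = Num.sqrt (complex.Re z ^+ 2 + complex.Im z ^+ 2).
  by case: z.
have re_le (z : R[i]) : `|complex.Re z| <= complex.Re `|z|.
  by rewrite nE -sqrtr_sqr ler_wsqrtr// lerDl sqr_ge0.
have im_le (z : R[i]) : `|complex.Im z| <= complex.Re `|z|.
  by rewrite nE -sqrtr_sqr ler_wsqrtr// lerDr sqr_ge0.
have le_re_im (z : R[i]) : complex.Re `|z| <= `|complex.Re z| + `|complex.Im z|.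
  rewrite nE -[X in _ <= X]ger0_norm ?addr_ge0// -sqrtr_sqr ler_wsqrtr//.
  rewrite sqrrD !real_normK ?num_real// -addrA [X in _ <= _ + X]addrC addrA lerDl.
  by rewrite mulrn_wge0// mulr_ge0.
have [e e0|lr hlr] := @real_cauchy_cvg (fun n => complex.Re (u n)).
  have [N hN] := h e e0; exists N => m n Nm Nn.
  apply: le_lt_trans (hN m n Nm Nn); rewrite (le_trans _ (re_le _))//.
  by case: (u m) (u n) => [? ?] [? ?].
have [e e0|li hli] := @real_cauchy_cvg (fun n => complex.Im (u n)).
  have [N hN] := h e e0; exists N => m n Nm Nn.
  apply: le_lt_trans (hN m n Nm Nn); rewrite (le_trans _ (im_le _))//.
  by case: (u m) (u n) => [? ?] [? ?].
exists (Complex lr li) => e e0.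
have e20 : 0 < e / 2 by lra.
have [N1 h1] := hlr _ e20; have [N2 h2] := hli _ e20.
exists (maxn N1 N2) => n; rewrite geq_max => /andP[n1 n2].
apply: (le_lt_trans (le_re_im _)).
have := h1 n n1; have := h2 n n2; case: (u n) => a b /=.
move=> ? ?; lra.
Qed.

Variable X : completeNormedModType K.

Lemma cauchy_tends (u : nat -> X) :
  (forall e : R, 0 < e -> exists N, forall m n, (N <= m)%N -> (N <= n)%N ->
    rnorm (u m - u n) < e) -> exists f, tends u f.
Proof.
move=> h.
have cu : cvgn u.
  apply/cauchy_cvgP; apply: cauchy_exP => e e0.
  have eE : of_real k (real_part e) = e by rewrite real_partK ?ltW.
  have [|N hN] := h (real_part e); first by rewrite -(@lt_of_real R k) eE of_real0.
  exists (u N); exists N => // n /= Nn.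
  by rewrite -ball_normE /ball_ /= norm_rnorm -eE lt_of_real; exact: hN.
by exists (limn u); apply/tendsP.
Qed.

(** Baire's category argument: if no member of the cover were dense in a ball,
    one could choose nested balls, the [n]-th of which misses the [n]-th
    member, and their common point would not be covered. *)
Lemma baire_cover (A : nat -> X -> Prop) : (forall f, exists i, A i f) ->
  exists i f0, exists2 r : R, 0 < r & forall g, rnorm (g - f0) < r ->
    forall e : R, 0 < e -> exists2 h, A i h & rnorm (g - h) < e.
Proof.
move=> cover; apply: contrapT => none.
have esc i (f : X) (r : R) : exists p : X * R, 0 < r ->
    [/\ rnorm (p.1 - f) < r, 0 < p.2 & forall h, A i h -> p.2 <= rnorm (p.1 - h)].
  have [r0|rn] := pselect (0 < r); last by exists (f, r) => /rn.
  apply: contrapT => np; apply: none; exists i, f, r => // g gr e e0.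
  apply: contrapT => nh; apply: np; exists (g, e) => _; split => //= h Ah.
  by rewrite leNgt; apply/negP => ge; apply: nh; exists h.
have [F hF] : exists F : nat -> X * R -> X * R, forall i (p : X * R), 0 < p.2 ->
    [/\ rnorm ((F i p).1 - p.1) + (F i p).2 < p.2, 0 < (F i p).2,
        (F i p).2 <= p.2 / 2 &
        forall h, A i h -> (F i p).2 < rnorm ((F i p).1 - h)].
  pose G i (p : X * R) := projT1 (cid (esc i p.1 p.2)).
  pose m i p := Order.min (Order.min (p.2 - rnorm ((G i p).1 - p.1)) p.2) (G i p).2 / 2.
  exists (fun i p => ((G i p).1, m i p)) => i p p0.
  have := projT2 (cid (esc i p.1 p.2)) p0; rewrite -/(G i p) => -[g1 g2 g3] /=.
  have dp : 0 < p.2 - rnorm ((G i p).1 - p.1) by rewrite subr_gt0.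
  have m1 : Order.min (Order.min (p.2 - rnorm ((G i p).1 - p.1)) p.2) (G i p).2 <=
      p.2 - rnorm ((G i p).1 - p.1) by rewrite !ge_min lexx.
  have m2 : Order.min (Order.min (p.2 - rnorm ((G i p).1 - p.1)) p.2) (G i p).2 <= p.2.
    by rewrite !ge_min lexx orbT.
  have m3 : Order.min (Order.min (p.2 - rnorm ((G i p).1 - p.1)) p.2) (G i p).2 <= (G i p).2.
    by rewrite !ge_min lexx !orbT.
  have m4 : 0 < Order.min (Order.min (p.2 - rnorm ((G i p).1 - p.1)) p.2) (G i p).2.
    by rewrite !lt_min dp p0 g2.
  rewrite /m; move: (Order.min _ _) m1 m2 m3 m4 => t m1 m2 m3 m4.
  split; [lra | lra | lra | move=> h /g3; lra].
pose p n := (fix p n := if n is n'.+1 then F n' (p n') else ((0 : X), (1 : R))) n.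
have p0 n : 0 < (p n).2.
  by elim: n => [//|n IH] /=; have [] := hF n (p n) IH.
have nest m n : rnorm ((p (n + m)%N).1 - (p n).1) + (p (n + m)%N).2 <= (p n).2.
  elim: m => [|m IH]; first by rewrite addn0 subrr rnorm0 add0r.
  rewrite addnS; have [h _ _ _] := hF (n + m)%N (p (n + m)%N) (p0 _).
  rewrite -/(p (n + m).+1) in h.
  have := rnormD ((p (n + m).+1).1 - (p (n + m)%N).1) ((p (n + m)%N).1 - (p n).1).
  rewrite addrA subrK => h2; lra.
have pn n : (p n).2 <= 2^-1 ^+ n.
  elim: n => [|n IH]; first by rewrite expr0.
  have [_ _ h _] := hF n (p n) (p0 _); rewrite -/(p n.+1) in h.
  by rewrite exprS; lra.
have near0 n m1 m2 : (n <= m1)%N -> (n <= m2)%N ->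
    rnorm ((p m1).1 - (p m2).1) <= 2 * 2^-1 ^+ n.
  move=> /subnKC <- /subnKC <-.
  have := nest (m1 - n)%N n; have := nest (m2 - n)%N n; have := pn n.
  have := p0 (n + (m1 - n))%N; have := p0 (n + (m2 - n))%N.
  have := rnormB ((p (n + (m1 - n))%N).1 - (p n).1) ((p (n + (m2 - n))%N).1 - (p n).1).
  rewrite opprB addrA subrK; lra.
have [f hf] : exists f, tends (fun n => (p n).1) f.
  apply: cauchy_tends => e e0; have [N hN] := geometric_small 2 e0.
  exists N => m1 m2 h1 h2; apply: le_lt_trans (near0 _ _ _ h1 h2) (hN N (leqnn _)).
have [i Ai] := cover f.
have [_ _ _ /(_ f Ai)] := hF i (p i) (p0 i); rewrite -/(p i.+1) => gap.
have gap0 : 0 < rnorm ((p i.+1).1 - f) - (p i.+1).2 by rewrite subr_gt0.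
have [N hN] := hf _ gap0.
have := hN (i.+1 + N)%N (leq_addl _ _); have := nest N i.+1.
have := p0 (i.+1 + N)%N.
have := rnormD ((p i.+1).1 - (p (i.+1 + N)%N).1) ((p (i.+1 + N)%N).1 - f).
rewrite addrA subrK [X in _ <= X + _]rnorm_distC [X in _ <= _ + X]rnorm_distC.
move: (rnorm ((p i.+1).1 - f)) gap gap0.
move: (p i.+1).2 (p (i.+1 + N)%N).2 => t1 t2 ? gap gap0.
by move=> ? ? ? ?; lra.
Qed.

End Completeness.

(** * Schauder bases *)

Section Bases.
Variables (R : realType) (k : scalar_kind).
Local Notation K := (scalars R k).
Variable X : completeNormedModType K.
Implicit Types (x : nat -> X) (a : nat -> K) (f g : X).

Definition psum x a n : X := \sum_(j < n) a j *: x j.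

Lemma expansionP x f a : expansion x f a <-> tends (psum x a) f.
Proof.
rewrite /expansion /= -tendsP.
have -> // : series (fun j => a j *: x j) = psum x a.
by apply/funext => n; rewrite /series /= big_mkord.
Qed.

Lemma psumS x a n : psum x a n.+1 = psum x a n + a n *: x n.
Proof. by rewrite /psum big_ord_recr. Qed.

Lemma psum_lin x c a b n :
  psum x (fun j => c * a j + b j) n = c *: psum x a n + psum x b n.
Proof.
rewrite /psum scaler_sumr -big_split; apply: eq_bigr => j _ /=.
by rewrite scalerDl scalerA.
Qed.

Lemma psumB x a b n : psum x (fun j => a j - b j) n = psum x a n - psum x b n.
Proof.
rewrite /psum -sumrB; apply: eq_bigr => j _ /=.
by rewrite scalerBl.
Qed.

Lemma tends_bounded (u : nat -> X) f : tends u f ->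
  exists B : R, forall n, rnorm (u n) <= B.
Proof.
move=> /(_ 1 ltr01)[N hN].
exists (\sum_(i < N) rnorm (u i) + (rnorm f + 1)) => n.
have S0 : 0 <= \sum_(i < N) rnorm (u i) by apply: sumr_ge0 => i _; exact: rnorm_ge0.
have [nN|Nn] := ltnP n N.
  rewrite (bigD1 (Ordinal nN)) //= -addrA lerDl.
  rewrite addr_ge0 ?addr_ge0 ?rnorm_ge0//.
  by apply: sumr_ge0 => i _; exact: rnorm_ge0.
have := hN n Nn; have := rnormB f (f - u n); rewrite opprB addrC subrK.
by move=> ? ?; lra.
Qed.

Section Schauder.
Variable x : nat -> X.
Hypothesis sx : schauder_basis x.

Lemma coef_tends f : tends (psum x (coef x f)) f.
Proof.
apply/expansionP; rewrite /coef; have [a [ha _]] := sx f.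
exact: xgetI ha.
Qed.

Lemma coef_unique f a : tends (psum x a) f -> coef x f = a.
Proof.
move=> /expansionP ha; have [b [hb ub]] := sx f.
by rewrite -(ub _ ha); apply/esym/ub/expansionP/coef_tends.
Qed.

Lemma coef_lin c f g j : coef x (c *: f + g) j = c * coef x f j + coef x g j.
Proof.
suff -> : coef x (c *: f + g) = fun j => c * coef x f j + coef x g j by [].
apply: coef_unique => e e0.
pose e' := e / (rabs c + 2).
have c0 := rabs_ge0 c.
have e'0 : 0 < e' by rewrite divr_gt0//; lra.
have [N1 h1] := coef_tends f e'0; have [N2 h2] := coef_tends g e'0.
exists (maxn N1 N2) => n; rewrite geq_max => /andP[n1 n2].
rewrite psum_lin opprD addrACA -scalerBr.
apply: (le_lt_trans (rnormD _ _)); rewrite rnormZ.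
have := h1 n n1; have := h2 n n2 => a1 a2.
have := ler_wpM2l c0 (ltW a2).
have : (rabs c + 2) * e' = e by rewrite /e' mulrC divfK//; apply: lt0r_neq0; lra.
move: (rabs c) (rnorm _) (rnorm _) c0 a1 a2 => r u v c0 a1 a2; nra.
Qed.

Lemma coefB f g j : coef x (f - g) j = coef x f j - coef x g j.
Proof.
have -> : f - g = (-1) *: g + f by rewrite scaleN1r addrC.
by rewrite coef_lin mulN1r addrC.
Qed.

Lemma coef_basis i j : coef x (x i) j = (i == j)%:R.
Proof.
suff -> : coef x (x i) = fun j => (i == j)%:R by [].
apply: coef_unique => e e0; exists i.+1 => n ni.
rewrite /psum (bigD1 (Ordinal ni)) //= eqxx scale1r big1 ?addr0 ?subrr ?rnorm0//.
move=> l /eqP h; case: eqP => [il|]; last by rewrite scale0r.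
by exfalso; apply: h; apply/val_inj.
Qed.

Lemma psum_coefB f g n :
  psum x (coef x (f - g)) n = psum x (coef x f) n - psum x (coef x g) n.
Proof. by rewrite -psumB; apply: eq_bigr => j _; rewrite coefB. Qed.

Lemma psum_coefZ c f n :
  psum x (coef x (c *: f)) n = c *: psum x (coef x f) n.
Proof.
have f0 : coef x 0 = fun=> 0.
  apply: coef_unique => e e0; exists 0%N => n0 _.
  by rewrite /psum big1 ?subrr ?rnorm0// => i _; rewrite scale0r.
rewrite /psum scaler_sumr; apply: eq_bigr => j _.
by rewrite -[c *: f]addr0 coef_lin f0 addr0 scalerA.
Qed.

Lemma psum_coef0 n : psum x (coef x 0) n = 0.
Proof. by have := psum_coefZ 0 0 n; rewrite !scale0r. Qed.

Variable c : R.
Hypotheses (c0 : 0 < c) (cx : forall j, c <= rnorm (x j)).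

(** Baire's theorem applied to the sets of vectors whose partial sums are
    bounded by a fixed integer; differences and rescaling move the resulting
    ball to the origin. *)
Let dense_bounded : exists2 M : R, 0 < M & forall (rho e : R) g, 0 < rho -> 0 < e ->
  rnorm g <= rho -> exists2 h, (forall n, rnorm (psum x (coef x h) n) <= M * rho) &
    rnorm (g - h) < e.
Proof.
pose A (i : nat) f := forall n, rnorm (psum x (coef x f) n) <= i%:R.
have [|i [f0 [r r0 hr]]] := @baire_cover R k X A.
  move=> f; have [B hB] := tends_bounded (coef_tends f).
  exists (Num.Def.truncn B).+1 => n; apply: (le_trans (hB n)).
  by apply/ltW/truncnS_gt.
pose M : R := 2 * (i%:R + 1) * 2 / r.
have i0 : 0 <= i%:R :> R by [].
exists M; first by rewrite /M divr_gt0// mulr_gt0// mulr_gt0//; lra.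
move=> rho e g rho0 e0 grho.
pose t := r / (2 * rho).
have t0 : 0 < t by rewrite divr_gt0// mulr_gt0.
have tg : rnorm (of_real k t *: g) < r.
  rewrite rnormZ rabs_of_real gtr0_norm//.
  apply: (@le_lt_trans _ _ (t * rho)); first by rewrite ler_wpM2l// ltW.
  have -> : t * rho = r / 2 by rewrite /t; field; rewrite gt_eqF.
  by lra.
have te0 : 0 < t * e / 2 by rewrite divr_gt0// mulr_gt0.
have [|h1 A1 d1] := hr (f0 + of_real k t *: g) _ _ te0.
  by rewrite addrC addKr.
have [|h2 A2 d2] := hr f0 _ _ te0; first by rewrite subrr rnorm0.
exists ((of_real k t)^-1 *: (h1 - h2)).
  move=> n; rewrite psum_coefZ psum_coefB rnormZ -of_realV rabs_of_real.
  rewrite gtr0_norm ?invr_gt0//.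
  apply: (@le_trans _ _ (t^-1 * (i%:R + i%:R))).
    rewrite ler_wpM2l ?invr_ge0 ?(ltW t0)//.
    by apply: (le_trans (rnormB _ _)); apply: lerD.
  have -> : t^-1 = 2 * rho / r by rewrite /t; field; rewrite !gt_eqF.
  rewrite /M.
  have -> : 2 * rho / r * (i%:R + i%:R) = 2 * i%:R * 2 / r * rho by ring.
  rewrite ler_wpM2r ?(ltW rho0)// ler_wpM2r ?invr_ge0 ?(ltW r0)//.
  by lra.
have tn : of_real k t != 0 by rewrite of_real_eq0 gt_eqF.
have -> : g - (of_real k t)^-1 *: (h1 - h2) =
   (of_real k t)^-1 *: ((f0 + of_real k t *: g - h1) - (f0 - h2)).
  rewrite -[g in LHS](scalerK tn) -scalerBr; congr (_ *: _).
  rewrite [in RHS]opprD [f0 + _]addrC -[_ + f0 - h1]addrA [f0 - h1]addrC addrA.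
  by rewrite [RHS]addrA addrK opprD addrA.
rewrite rnormZ -of_realV rabs_of_real gtr0_norm ?invr_gt0//.
rewrite mulrC -ltr_pdivlMr ?invr_gt0// invrK mulrC.
apply: (le_lt_trans (rnormB _ _)).
by move: d1 d2; move: (rnorm _) (rnorm _) => u v ? ?; lra.
Qed.

(** The approximation of the preceding lemma is iterated on the remainders;
    the approximants form a series for [f] whose partial sums converge
    geometrically, coefficient by coefficient, so that their limit is the
    expansion of [f]. *)
Lemma basis_constant : exists2 C : R, 0 < C &
  forall f n, rnorm (psum x (coef x f) n) <= C * rnorm f.
Proof.
have [M M0 dense] := dense_bounded.
exists (2 * M); first by rewrite mulr_gt0.
move=> f n.
have [->|fn0] := eqVneq f 0.
  by rewrite psum_coef0 rnorm0 mulr0.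
have rho0 := rnorm_gt0 fn0; set rho := rnorm f in rho0 *.
have [F hF] : exists F : nat -> X -> X, forall i g, rnorm g <= rho * 2^-1 ^+ i ->
    (forall n, rnorm (psum x (coef x (F i g)) n) <= M * (rho * 2^-1 ^+ i)) /\
    rnorm (g - F i g) <= rho * 2^-1 ^+ i.+1.
  have step i g : exists h, rnorm g <= rho * 2^-1 ^+ i ->
    (forall n, rnorm (psum x (coef x h) n) <= M * (rho * 2^-1 ^+ i)) /\
    rnorm (g - h) <= rho * 2^-1 ^+ i.+1.
    have [le|nle] := pselect (rnorm g <= rho * 2^-1 ^+ i); last by exists 0.
    have p i' : 0 < rho * 2^-1 ^+ i' by rewrite mulr_gt0// exprn_gt0// invr_gt0.
    by have [h h1 /ltW h2] := dense _ _ g (p i) (p i.+1) le; exists h.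
  exists (fun i g => projT1 (cid (step i g))) => i g.
  exact: projT2 (cid (step i g)).
pose g i := (fix g i := if i is i'.+1 then g i' - F i' (g i') else f) i.
have g_le i : rnorm (g i) <= rho * 2^-1 ^+ i.
  elim: i => [|i IH]; first by rewrite expr0 mulr1.
  by have [_] := hF i (g i) IH.
have F_le i m : rnorm (psum x (coef x (F i (g i))) m) <= M * rho * 2^-1 ^+ i.
  by rewrite -mulrA; have [] := hF i (g i) (g_le i).
pose s i m := psum x (coef x (f - g i)) m.
have sS i m : s i.+1 m = s i m + psum x (coef x (F i (g i))) m.
  rewrite /s; have -> : f - g i.+1 = (f - g i) - (- F i (g i)).
    by rewrite opprK (_ : g i.+1 = g i - F i (g i))// opprB addrA addrAC.
  by rewrite psum_coefB -[- F i (g i)]scaleN1r psum_coefZ scaleN1r opprK.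
have s_le i l m : rnorm (s (i + l)%N m - s i m) <=
    2 * M * rho * (2^-1 ^+ i - 2^-1 ^+ (i + l)).
  elim: l => [|l IH]; first by rewrite addn0 !subrr rnorm0 mulr0.
  rewrite addnS sS addrAC; apply: (le_trans (rnormD _ _)).
  have := F_le (i + l)%N m; rewrite exprS.
  move: IH; move: (rnorm _) (rnorm _) (_ ^+ _) (_ ^+ _) => u v w y; nra.
have s0 m : s 0%N m = 0.
  by rewrite /s (_ : g 0%N = f)// subrr psum_coef0.
have Mr0 : 0 < M * rho by rewrite mulr_gt0.
have pw i : 0 < 2^-1 ^+ i :> R by rewrite exprn_gt0// invr_gt0.
have s_dist i1 i2 N m : (N <= i1)%N -> (N <= i2)%N ->
    rnorm (s i1 m - s i2 m) <= 4 * M * rho * 2^-1 ^+ N.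
  move=> /subnKC <- /subnKC <-.
  have := s_le N (i1 - N)%N m; have := s_le N (i2 - N)%N m.
  have := rnormB (s (N + (i1 - N))%N m - s N m) (s (N + (i2 - N))%N m - s N m).
  rewrite opprB addrA subrK.
  have := pw (N + (i1 - N))%N; have := pw (N + (i2 - N))%N; have := pw N.
  move: (_ ^+ _) (_ ^+ _) (_ ^+ _) (rnorm _) (rnorm _) (rnorm _) => u v w u' v' w'.
  nra.
have coef_s i m : (coef x (f - g i) m) *: x m = s i m.+1 - s i m.
  by rewrite /s psumS addrAC subrr add0r.
have [b hb] : exists b : nat -> K, forall m e, 0 < e -> exists N, forall i, (N <= i)%N ->
    rabs (b m - coef x (f - g i) m) < e.
  have lim m : exists l, forall e : R, 0 < e -> exists N, forall i, (N <= i)%N ->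
      rabs (l - coef x (f - g i) m) < e.
    apply: scalars_cauchy_cvg => e e0.
    have [N hN] := geometric_small (8 * M * rho) (mulr_gt0 e0 c0).
    exists N => i1 i2 h1 h2; have := hN N (leqnn N).
    have : rabs (coef x (f - g i1) m - coef x (f - g i2) m) * rnorm (x m) =
        rnorm ((s i1 m.+1 - s i2 m.+1) - (s i1 m - s i2 m)).
      rewrite -rnormZ scalerBl !coef_s; congr rnorm.
      by rewrite !opprB addrACA [RHS]addrACA [- s i2 m.+1 + _]addrC.
    have := rnormB (s i1 m.+1 - s i2 m.+1) (s i1 m - s i2 m).
    have := s_dist _ _ _ m.+1 h1 h2; have := s_dist _ _ _ m h1 h2.
    have := cx m; have := rabs_ge0 (coef x (f - g i1) m - coef x (f - g i2) m).
    move: (rnorm (x m)) (rabs _) => z u u0 v0.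
    move=> h3 h4 h5 h6 h7.
    have zp : 0 < z by apply: lt_le_trans v0.
    rewrite -(ltr_pM2r zp); apply: (@lt_le_trans _ _ (e * c)); last first.
      by rewrite ler_wpM2l// ltW.
    by lra.
  exists (fun m => projT1 (cid (lim m))) => m.
  exact: projT2 (cid (lim m)).
have psb m : tends (fun i => s i m) (psum x b m).
  move=> e e0.
  elim: m e e0 => [|m IH] e e0.
    by exists 0%N => i _; rewrite /s /psum !big_ord0 subrr rnorm0.
  have e20 : 0 < e / 2 by lra.
  have xm0 : 0 < rnorm (x m) by apply: lt_le_trans (cx m).
  have [N1 h1] := IH _ e20; have [N2 h2] := hb m _ (divr_gt0 e20 xm0).
  exists (maxn N1 N2) => i; rewrite geq_max => /andP[/h1 i1 /h2 i2].
  rewrite /s !psumS -/(s i m) opprD addrACA -scalerBl.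
  apply: (le_lt_trans (rnormD _ _)); rewrite rnormZ.
  move: i2; rewrite ltr_pdivlMr// => i2.
  by move: i1 i2; move: (rnorm _) (rabs _ * _) => u v; lra.
have unif i m : rnorm (psum x b m - s i m) <= 4 * M * rho * 2^-1 ^+ i.
  apply/ler_addgt0Pr => e e0; have [N hN] := psb m _ e0.
  have := hN (N + i)%N (leq_addr _ _).
  have := s_dist _ _ _ m (leq_addl N i) (leqnn i).
  have := rnormD (psum x b m - s (N + i)%N m) (s (N + i)%N m - s i m).
  rewrite addrA subrK; move: (rnorm _) (rnorm _) (rnorm _) => u v w; lra.
have -> : coef x f = b.
  apply: coef_unique => e e0.
  have e30 : 0 < e / 3 by lra.
  have [N1 h1] := geometric_small (4 * M * rho) e30.
  have [N2 h2] := geometric_small rho e30.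
  pose i := maxn N1 N2.
  have [N3 h3] := coef_tends (f - g i) e30.
  exists N3 => m m3.
  have := h1 i (leq_maxl _ _); have := h2 i (leq_maxr _ _); have := h3 m m3.
  have := g_le i; have := unif i m; rewrite -/(s i m).
  have := rnormD (g i) ((f - g i - s i m) - (psum x b m - s i m)).
  have -> : g i + ((f - g i - s i m) - (psum x b m - s i m)) = f - psum x b m.
    by rewrite opprB [f - g i - _ + _]addrA subrK addrA addrCA subrr addr0.
  have := rnormB (f - g i - s i m) (psum x b m - s i m).
  move: (rnorm _) (rnorm _) (rnorm _) (rnorm _) (rnorm _) => v1 v2 v3 v4 v5; lra.
apply/ler_addgt0Pr => e e0; have [N hN] := psb n _ e0.
have := hN N (leqnn _); have := s_le 0%N N n; rewrite add0n s0 subr0 expr0.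
have := rnormD (psum x b n - s N n) (s N n); rewrite subrK.
have := pw N; move: (_ ^+ _) (rnorm _) (rnorm _) (rnorm _) => u v w y.
nra.
Qed.

Lemma coef_bounded : exists2 C : R, 0 < C &
  forall f j, rabs (coef x f j) <= C * rnorm f.
Proof.
have [C C0 hC] := basis_constant.
exists (2 * C / c); first by rewrite divr_gt0// mulr_gt0.
move=> f j; rewrite mulrAC ler_pdivlMr//.
have : rabs (coef x f j) * rnorm (x j) <= 2 * C * rnorm f.
  rewrite -rnormZ.
  have -> : coef x f j *: x j = psum x (coef x f) j.+1 - psum x (coef x f) j.
    by rewrite psumS addrAC subrr add0r.
  apply: (le_trans (rnormB _ _)); have := hC f j.+1; have := hC f j.
  move: (rnorm _) (rnorm _) (rnorm _) => u v w; lra.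
apply: le_trans; by rewrite ler_wpM2l ?rabs_ge0.
Qed.

End Schauder.

Lemma semi_normalizedP x : semi_normalized x <->
  exists c C : R, 0 < c /\ forall j, c <= rnorm (x j) /\ rnorm (x j) <= C.
Proof.
split=> [[h1 h2]|[c [C [c0 h]]]].
  pose I := ereal_inf (range (fun j => (rnorm (x j))%:E)).
  pose S := ereal_sup (range (fun j => (rnorm (x j))%:E)).
  have hI j : (I <= (rnorm (x j))%:E)%E by apply: ereal_inf_lbound; exists j.
  have hS j : ((rnorm (x j))%:E <= S)%E by apply: ereal_sup_ubound; exists j.
  have Ifin : I \is a fin_num.
    rewrite ge0_fin_numE; last exact: ltW.
    by apply: le_lt_trans (hI 0%N) _; rewrite ltry.
  have Sfin : S \is a fin_num.
    rewrite ge0_fin_numE//; apply: le_trans (hS 0%N).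
    by rewrite lee_fin rnorm_ge0.
  exists (fine I), (fine S); split.
    by rewrite -lte_fin fineK.
  by move=> j; rewrite -!lee_fin !fineK.
split.
  apply: (@lt_le_trans _ _ c%:E); first by rewrite lte_fin.
  by apply: le_ereal_inf_tmp => _ [j _ <-]; rewrite lee_fin; have [] := h j.
apply: (@le_lt_trans _ _ C%:E); last by rewrite ltry.
by apply: ge_ereal_sup => _ [j _ <-]; rewrite lee_fin; have [] := h j.
Qed.

(** Reconstruction by bounded biorthogonal functionals. The vector [Q f] is
    recovered instead of [f] so that systems living in complementary subspaces
    can be combined. *)
Record coord_system x (a : X -> nat -> K) (Q : X -> X) : Prop := CoordSystem {
  coord_tends : forall f, tends (psum x (a f)) (Q f);
  coord_lin : forall c f g j, a (c *: f + g) j = c * a f j + a g j;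
  coord_bounded : exists2 C : R, 0 < C & forall f j, rabs (a f j) <= C * rnorm f;
  coord_biorth : forall i j, a (x i) j = (i == j)%:R;
  coord_norm : exists C : R, forall j, rnorm (x j) <= C
}.

Lemma coord_psum x (a : X -> nat -> K) Q : coord_system x a Q ->
  forall b n j, a (psum x b n) j = if (j < n)%N then b j else 0.
Proof.
move=> cs b n j.
have a0 : a 0 j = 0.
  by have := coord_lin cs (-1) 0 0 j; rewrite scaleN1r addNr mulN1r addNr.
elim: n => [|n IH]; first by rewrite /psum big_ord0 a0.
rewrite psumS addrC (coord_lin cs) IH (coord_biorth cs) ltnS.
case: (ltngtP j n) => [jn|jn|->]; rewrite ?mulr0 ?mulr1 ?add0r ?addr0//.
Qed.

(** Expansions are unique because the functionals are bounded; for the same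
    reason [a (x j) j = 1] keeps the norm of [x j] away from 0. *)
Lemma basis_of_coord_system x (a : X -> nat -> K) : coord_system x a id ->
  is_basis x /\ forall f, coef x f = a f.
Proof.
move=> cs; have [C C0 hC] := coord_bounded cs.
have uniq f b : tends (psum x b) f -> a f = b.
  move=> hb; apply/funext => j; apply/eqP; rewrite -subr_eq0; apply/eqP/rabs_eq0.
  apply/eqP; rewrite eq_le rabs_ge0 andbT; apply/ler_addgt0Pr => e e0; rewrite add0r.
  have [N hN] := hb _ (divr_gt0 e0 C0).
  have := hN (N + j.+1)%N (leq_addr _ _).
  rewrite ltr_pdivlMr// => /ltW; rewrite mulrC; apply: le_trans.
  apply: le_trans (hC _ j).
  have -> : f - psum x b (N + j.+1)%N = (-1) *: psum x b (N + j.+1)%N + f.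
    by rewrite scaleN1r addrC.
  rewrite (coord_lin cs) (coord_psum cs) (_ : (j < N + j.+1)%N) ?mulN1r 1?addrC//.
  by rewrite addnS ltnS leq_addl.
have sb : schauder_basis x.
  move=> f; exists (a f); split; first by apply/expansionP; exact: coord_tends cs f.
  by move=> b /expansionP/uniq.
split; last by move=> f; apply: (coef_unique sb); exact: coord_tends cs f.
split => //; apply/semi_normalizedP; have [B hB] := coord_norm cs.
exists C^-1, B; split; first by rewrite invr_gt0.
move=> j; split; last exact: hB.
rewrite -[C^-1]mul1r ler_pdivrMr// mulrC; apply: le_trans (hC (x j) j).
by rewrite (coord_biorth cs) eqxx rabs1.
Qed.

End Bases.

(** * Complemented copies of the sequence space *)

Section Interleaving.
Variables (R : realType) (k : scalar_kind) (q : R).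
Hypothesis q1 : 1 < q.
Local Notation K := (scalars R k).
Implicit Types a b : nat -> K.

Definition evens a : nat -> K := fun n => a n.*2.
Definition odds a : nat -> K := fun n => a n.*2.+1.
Definition interleave a b : nat -> K :=
  fun n => if odd n then b n./2 else a n./2.

Lemma evens_interleave a b : evens (interleave a b) = a.
Proof. by apply/funext => n; rewrite /evens /interleave odd_double doubleK. Qed.

Lemma odds_interleave a b : odds (interleave a b) = b.
Proof.
apply/funext => n; rewrite /odds /interleave /= odd_double /=.
by congr b; rewrite uphalf_double.
Qed.

Lemma interleaveK a : interleave (evens a) (odds a) = a.
Proof.
apply/funext => n; rewrite /interleave /evens /odds.
by case: ifP => o; rewrite -[RHS](congr1 a (odd_double_half n)) o ?add0n// add1n.
Qed.

Lemma interleave_lin c a b a' b' :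
  interleave (fun n => c * a n + a' n) (fun n => c * b n + b' n) =
  fun n => c * interleave a b n + interleave a' b' n.
Proof. by apply/funext => n; rewrite /interleave; case: ifP. Qed.

Lemma qsum_double a n : qsum q a n.*2 = qsum q (evens a) n + qsum q (odds a) n.
Proof.
elim: n => [|n IH]; first by rewrite /qsum !big_ord0 addr0.
rewrite doubleS /qsum !big_ord_recr /= -!/(qsum _ _ _) IH -!addrA; congr (_ + _).
by rewrite addrCA.
Qed.

Lemma ellq_evens a : ellq q a -> ellq q (evens a) /\
  ellq_norm q (evens a) <= ellq_norm q a.
Proof.
move=> ha; apply: ellq_norm_le => //; first exact: ellq_norm_ge0.
move=> n; apply: le_trans (qsum_le_norm q1 n.*2 ha).
by rewrite qsum_double lerDl qsum_ge0.
Qed.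

Lemma ellq_odds a : ellq q a -> ellq q (odds a) /\
  ellq_norm q (odds a) <= ellq_norm q a.
Proof.
move=> ha; apply: ellq_norm_le => //; first exact: ellq_norm_ge0.
move=> n; apply: le_trans (qsum_le_norm q1 n.*2 ha).
by rewrite qsum_double lerDr qsum_ge0.
Qed.

Lemma ellq_interleave a b : ellq q a -> ellq q b -> ellq q (interleave a b) /\
  ellq_norm q (interleave a b) <= ellq_norm q a + ellq_norm q b.
Proof.
move=> ha hb; apply: ellq_norm_le => //; first by rewrite addr_ge0 ?ellq_norm_ge0.
move=> n; apply: (@le_trans _ _ (qsum q (interleave a b) n.*2)).
  by apply: qsum_nd; rewrite -addnn leq_addr.
rewrite qsum_double evens_interleave odds_interleave.
apply: le_trans (powR_superadditive (ltW q1) (ellq_norm_ge0 _ _) (ellq_norm_ge0 _ _)).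
by apply: lerD; exact: qsum_le_norm.
Qed.

End Interleaving.

Lemma addrBDACA (V : zmodType) (a b c d e g : V) :
  (a + b) - (c + d) + (e + g) = (a - c + e) + (b - d + g).
Proof. by rewrite opprD (addrACA a b) (addrACA (a - c)). Qed.

Section EllqSummand.
Variables (R : realType) (k : scalar_kind) (q : R).
Hypothesis q1 : 1 < q.
Local Notation K := (scalars R k).
Variable X : completeNormedModType K.

(** An isomorphism of [X] onto the direct sum of [X] and [ellq]: the map
    [f |-> (D f, cc f)], with inverse [(g, a) |-> E g + La a]. *)
Record ellq_splitting (D E : X -> X) (cc : X -> nat -> K) (La : (nat -> K) -> X)
    (M : R) : Prop := EllqSplitting {
  spl_gt0 : 0 < M;
  spl_Dlin : forall c f g, D (c *: f + g) = c *: D f + D g;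
  spl_Elin : forall c f g, E (c *: f + g) = c *: E f + E g;
  spl_cclin : forall c f g n, cc (c *: f + g) n = c * cc f n + cc g n;
  spl_Lalin : ellq_linear q La;
  spl_cc : forall f, ellq q (cc f);
  spl_Dle : forall f, rnorm (D f) <= M * rnorm f;
  spl_Ele : forall f, rnorm (E f) <= M * rnorm f;
  spl_ccle : forall f, ellq_norm q (cc f) <= M * rnorm f;
  spl_Lale : forall a, ellq q a -> rnorm (La a) <= M * ellq_norm q a;
  spl_DE : cancel E D;
  spl_DLa : forall a, ellq q a -> D (La a) = 0;
  spl_ccE : forall f, cc (E f) = fun=> 0;
  spl_ccLa : forall a, ellq q a -> cc (La a) = a;
  spl_id : forall f, E (D f) + La (cc f) = f
}.

Lemma continuous_linear_le (P : {linear X -> X}) : continuous P ->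
  exists2 M : R, 0 < M & forall f, rnorm (P f) <= M * rnorm f.
Proof.
move=> cP.
have /linear_boundedP/pinfty_ex_gt0[r r0 hr] : bounded_near P (nbhs 0).
  exact/continuous_linear_bounded/cP.
have rE : of_real k (real_part r) = r by rewrite real_partK ?ltW.
exists (real_part r); first by rewrite -(@lt_of_real R k) rE of_real0.
move=> f; rewrite -(@le_of_real R k) of_realM rE -!norm_rnorm.
exact: hr.
Qed.

(** Half of the copy of [ellq] inside [X] is enough to rebuild [X], because
    [ellq] is isomorphic to the sum of two copies of itself. *)
Lemma ellq_splitting_of_complemented (Y : set X) :
  complemented Y -> ellq_isomorphic_to q Y ->
  exists D E cc La M, ellq_splitting D E cc La M.
Proof.
move=> [P [cP rP idP]] [T [Tlin TY [C1 hC1] [C2 hC2]]].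
have [M0 M00 hP] := continuous_linear_le cP.
pose C := `|C1| + `|C2| + M0 + 1.
have n1 := ler_norm C1; have n2 := ler_norm C2.
have p1 := normr_ge0 C1; have p2 := normr_ge0 C2.
have C0 : 0 < C by rewrite /C; lra.
have TleC (a : nat -> K) : ellq q a -> rnorm (T a) <= C * ellq_norm q a.
  move=> ha; apply: (le_trans (hC1 a ha)); rewrite ler_wpM2r ?ellq_norm_ge0//.
  by rewrite /C; lra.
have leTC (a : nat -> K) : ellq q a -> ellq_norm q a <= C * rnorm (T a).
  move=> ha; apply: (le_trans (hC2 a ha)); rewrite ler_wpM2r ?rnorm_ge0//.
  by rewrite /C; lra.
have PleC f : rnorm (P f) <= C * rnorm f.
  apply: (le_trans (hP f)); rewrite ler_wpM2r ?rnorm_ge0//.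
  by rewrite /C; lra.
have T_lin : ellq_linear q T by [].
have Tinj a b : ellq q a -> ellq q b -> T a = T b -> a = b.
  move=> ha hb hab; apply/funext => n; apply/eqP; rewrite -subr_eq0.
  apply/eqP/rabs_eq0; have [hc _] := ellqB q1 ha hb.
  have := rabs_le_norm q1 n hc; have := leTC _ hc.
  rewrite (ellq_linearB T_lin)// hab subrr rnorm0 mulr0 => h1 h2.
  by apply/eqP; rewrite eq_le rabs_ge0 andbT (le_trans h2).
have PT (a : nat -> K) : ellq q a -> P (T a) = T a.
  by move=> ha; apply: idP; rewrite -TY; exists a.
have PP f : P (P f) = P f by apply: idP; rewrite -rP; exists f.
have inv f : exists a, ellq q a /\ T a = P f.
  have : Y (P f) by rewrite -rP; exists f.
  by rewrite -TY => -[a ha Ta]; exists a.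
have [S hS] : exists S : X -> nat -> K, forall f, ellq q (S f) /\ T (S f) = P f.
  exists (fun f => projT1 (cid (inv f))) => f.
  exact: projT2 (cid (inv f)).
have S_ellq f : ellq q (S f) := (hS f).1.
have TS f : T (S f) = P f := (hS f).2.
have S_lin c f g : S (c *: f + g) = fun n => c * S f n + S g n.
  apply: (Tinj _ _ (S_ellq _)); first by apply: ellq_lin.
  by rewrite (T_lin _ _ _ (S_ellq f) (S_ellq g)) !TS linearP.
have S_uniq f a : ellq q a -> P f = T a -> S f = a.
  by move=> ha h; apply: (Tinj _ _ (S_ellq f) ha); rewrite TS.
have S_le f : ellq_norm q (S f) <= C * C * rnorm f.
  apply: (le_trans (leTC _ (S_ellq f))); rewrite TS -mulrA ler_wpM2l ?(ltW C0)//.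
have [z1 z2] := @ellq0 R k q q1.
have il_ev (a : nat -> K) : ellq q a -> ellq q (interleave a (fun=> 0)) /\
    ellq_norm q (interleave a (fun=> 0)) <= ellq_norm q a.
  move=> ha; have [h1 h2] := @ellq_interleave R k q q1 a (fun=> 0) ha z1.
  split; first exact: h1.
  by rewrite z2 addr0 in h2.
have il_od (a : nat -> K) : ellq q a -> ellq q (interleave (fun=> 0) a) /\
    ellq_norm q (interleave (fun=> 0) a) <= ellq_norm q a.
  move=> ha; have [h1 h2] := @ellq_interleave R k q q1 (fun=> 0) a z1 ha.
  split; first exact: h1.
  by rewrite z2 add0r in h2.
have evS f := ellq_evens q1 (S_ellq f).
have odS f := ellq_odds q1 (S_ellq f).
pose D f := f - P f + T (evens (S f)).
pose E f := f - P f + T (interleave (S f) (fun=> 0)).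
pose cc f := odds (S f).
pose La (a : nat -> K) := T (interleave (fun=> 0) a).
have PE f : P (E f) = T (interleave (S f) (fun=> 0)).
  by rewrite /E linearD linearB PP subrr add0r (PT _ (il_ev _ (S_ellq f)).1).
have PLa (a : nat -> K) : ellq q a -> P (La a) = La a.
  by move=> ha; rewrite /La (PT _ (il_od _ ha).1).
have SE f : S (E f) = interleave (S f) (fun=> 0).
  exact: S_uniq (il_ev _ (S_ellq f)).1 (PE f).
have SLa (a : nat -> K) : ellq q a -> S (La a) = interleave (fun=> 0) a.
  by move=> ha; exact: S_uniq (il_od _ ha).1 (PLa _ ha).
have compl_le f : rnorm (f - P f) <= (1 + C) * rnorm f.
  by apply: (le_trans (rnormB _ _)); rewrite mulrDl mul1r lerD2l.
have TSle f (a : nat -> K) : ellq q a -> ellq_norm q a <= ellq_norm q (S f) ->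
    rnorm (T a) <= C * (C * C) * rnorm f.
  move=> ha h; apply: (le_trans (TleC _ ha)); rewrite -mulrA ler_wpM2l ?(ltW C0)//.
  exact: le_trans h (S_le f).
pose M := 1 + C + C * (C * C) + C * C.
have CC0 : 0 < C * C by rewrite mulr_gt0.
have CCC0 : 0 < C * (C * C) by rewrite mulr_gt0.
exists D, E, cc, La, M; split.
- by rewrite /M; lra.
- move=> c f g; rewrite /D S_lin.
  have -> : evens (fun n => c * S f n + S g n) =
    fun n => c * evens (S f) n + evens (S g) n by [].
  rewrite (T_lin _ _ _ (evS f).1 (evS g).1) linearP.
  by rewrite !scalerDr scalerN addrBDACA.
- move=> c f g; rewrite /E S_lin.
  have -> : interleave (fun n => c * S f n + S g n) (fun=> 0) =
    fun n => c * interleave (S f) (fun=> 0) n + interleave (S g) (fun=> 0) n.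
    rewrite -interleave_lin; congr interleave.
    by apply/funext => n; rewrite mulr0 addr0.
  rewrite (T_lin _ _ _ (il_ev _ (S_ellq f)).1 (il_ev _ (S_ellq g)).1) linearP.
  by rewrite !scalerDr scalerN addrBDACA.
- by move=> c f g n; rewrite /cc /odds S_lin.
- move=> c a b ha hb; rewrite /La.
  have -> : interleave (fun=> 0) (fun n => c * a n + b n) =
    fun n => c * interleave (fun=> 0) a n + interleave (fun=> 0) b n.
    rewrite -interleave_lin; congr interleave.
    by apply/funext => n; rewrite mulr0 addr0.
  exact: T_lin (il_od _ ha).1 (il_od _ hb).1.
- by move=> f; exact: (odS f).1.
- move=> f; apply: (le_trans (rnormD _ _)).
  have h1 := compl_le f; have h2 := TSle f _ (evS f).1 (evS f).2.
  have h3 : 0 <= C * C * rnorm f by rewrite mulr_ge0 ?rnorm_ge0// ltW.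
  by rewrite /M; move: h1 h2 h3; move: (rnorm (T _)) (rnorm _) (rnorm f) => u v w; lra.
- move=> f; apply: (le_trans (rnormD _ _)).
  have h1 := compl_le f.
  have h2 := TSle f _ (il_ev _ (S_ellq f)).1 (il_ev _ (S_ellq f)).2.
  have h3 : 0 <= C * C * rnorm f by rewrite mulr_ge0 ?rnorm_ge0// ltW.
  by rewrite /M; move: h1 h2 h3; move: (rnorm (T _)) (rnorm _) (rnorm f) => u v w; lra.
- move=> f; apply: (le_trans (odS f).2); apply: (le_trans (S_le f)).
  by rewrite ler_wpM2r ?rnorm_ge0// /M; lra.
- move=> a ha; apply: (le_trans (TleC _ (il_od _ ha).1)).
  apply: (le_trans (ler_wpM2l (ltW C0) (il_od _ ha).2)).
  rewrite ler_wpM2r ?ellq_norm_ge0// /M.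
  by lra.
- move=> f; rewrite /D SE evens_interleave TS PE /E.
  by rewrite addrK subrK.
- move=> a ha; rewrite /D (SLa _ ha) evens_interleave (PLa _ ha) subrr add0r.
  exact: (ellq_linear0 q1 T_lin).
- by move=> f; rewrite /cc SE odds_interleave.
- by move=> a ha; rewrite /cc (SLa _ ha) odds_interleave.
- move=> f.
  have PD : P (D f) = T (evens (S f)).
    by rewrite /D linearD linearB PP subrr add0r (PT _ (evS f).1).
  have SD : S (D f) = evens (S f) by exact: S_uniq (evS f).1 PD.
  rewrite /E SD PD /La /cc {1}/D addrK -addrA.
  rewrite -(ellq_linearD T_lin); last 2 first.
  - exact: (il_ev _ (evS f).1).1.
  - exact: (il_od _ (odS f).1).1.
  have -> : (fun n => interleave (evens (S f)) (fun=> 0) n +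
      interleave (fun=> 0) (odds (S f)) n) = S f.
    rewrite -[RHS]interleaveK; apply/funext => n; rewrite /interleave.
    by case: ifP => _; rewrite ?addr0 ?add0r.
  by rewrite TS subrK.
Qed.

End EllqSummand.

(** * The fractional bases of the sequence space *)

Section FractionalBasis.
Variables (R : realType).

Lemma powR_small (p C e : R) : 0 < p -> 0 < e ->
  exists N, forall n, (N <= n)%N -> C * n.+1%:R `^ (- p) < e.
Proof.
move=> p0 e0; pose D := (`|C| + 1) / e.
have D0 : 0 < D by rewrite divr_gt0// ltr_wpDl.
exists (Num.Def.truncn (D `^ p^-1)) => n Nn.
have h : D `^ p^-1 < n.+1%:R.
  by apply: (lt_le_trans (truncnS_gt _)); rewrite ler_nat.
have {}h : D < n.+1%:R `^ p.
  have := gt0_ltr_powR p0; move=> /(_ (D `^ p^-1) n.+1%:R).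
  rewrite !nnegrE powR_ge0 ler0n => /(_ isT isT h).
  by rewrite -powRrM mulVf ?gt_eqF// powRr1// ltW.
rewrite powRN ltr_pdivrMr ?powR_gt0//.
move: h; rewrite /D ltr_pdivrMr// mulrC => /(lt_trans _); apply.
by rewrite (le_lt_trans (ler_norm C))// ltrDl.
Qed.

Let corner_index (l m x : nat) : (l < m)%N -> exists r,
  [/\ (m = l + r.+1)%N, (m - l).-1 = r, (m + x - l = (r + x).+1)%N &
      (m + x == l)%N = false].
Proof.
move=> lm; exists (m - l.+1)%N; split; [lia | lia | lia |].
by apply/negbTE; rewrite neq_ltn; apply/orP; right; lia.
Qed.

Let rev_index (r m : nat) : (r < m)%N -> (m - (m - r.+1).+1 = r)%N.
Proof. lia. Qed.

Let eps_step (c d e' e a b : R) : 0 <= c -> 2 * (c + 1) * e' = e ->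
  a <= c * d -> d < e' -> b < e' -> 2 * (a + b) < e.
Proof. by move=> c0 <- h1 h2 h3; nra. Qed.

Let eps_split (C a b d e' e : R) : 0 < C -> 8 * (1 + C) * e' = e ->
  d <= 2 * (1 + C) * a -> a < e' -> b < e / 4 -> 2 * (b + d) < e.
Proof. by move=> C0 <- h1 h2 h3; nra. Qed.

(** The lower triangular Toeplitz matrix of [(1 - z) ^ - t]. *)
Definition tri (t : R) (i j : nat) : R :=
  if (j <= i)%N then frac_coef t (i - j) else 0.

Lemma sum_shift (V : nmodType) (m l : nat) (F : nat -> V) : (l <= m)%N ->
  \sum_(j < m) (if (l <= j)%N then F (j - l)%N else 0) = \sum_(t < m - l) F t.
Proof.
move=> /subnKC; move: (m - l)%N => r <-; rewrite big_split_ord /= big1 ?add0r.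
  by apply: eq_bigr => t _; rewrite leq_addr addKn.
by move=> i _; rewrite leqNgt ltn_ord.
Qed.

Lemma sum_cut (V : nmodType) (m d : nat) (F : nat -> V) : (d < m)%N ->
  \sum_(t < m) (if (t <= d)%N then F t else 0) = \sum_(t < d.+1) F t.
Proof.
move=> dm; rewrite -(subnKC dm) big_split_ord /= [X in _ + X]big1 ?addr0.
  by apply: eq_bigr => t _; rewrite -ltnS ltn_ord.
by move=> i _; rewrite addSn ltnNge leq_addr.
Qed.

(** The truncated product of the triangular Toeplitz matrix of [(1 - z) ^ - s]
    and its inverse: the identity on the first [m] rows, and below them the
    corner kernel. *)
Lemma tri_prod (s : R) (m i l : nat) : (l < m)%N ->
  \sum_(j < m) tri s i j * tri (- s) j l =
  if (i < m)%N then (i == l)%:R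
  else s * frac_prod (- s) (m - l).-1 * frac_prod s (i - m) / (i - l)%:R.
Proof.
move=> lm.
have -> : \sum_(j < m) tri s i j * tri (- s) j l =
    \sum_(j < m) (if (l <= j)%N then
      (fun t => if (t + l <= i)%N then frac_coef (- s) t * frac_coef s (i - l - t) else 0)
        (j - l)%N else 0).
  apply: eq_bigr => j _; rewrite /tri; case: (leqP l j) => lj; last by rewrite mulr0.
  rewrite subnK//; case: (leqP j i) => ji; last by rewrite mul0r.
  by rewrite mulrC; congr (_ * frac_coef _ _); lia.
rewrite (@sum_shift _ m l (fun t => if (t + l <= i)%N then
   frac_coef (- s) t * frac_coef s (i - l - t) else 0) (ltnW lm)).
case: ltnP => im.
  have [li|il] := leqP l i; last first.
    rewrite big1 ?(ltn_eqF il)// => t _; case: leqP => // h.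
    by have := leq_trans (leq_addl t l) h; rewrite leqNgt il.
  have -> : (i == l) = (i - l == 0)%N by rewrite subn_eq0 eqn_leq li andbT.
  rewrite -(frac_coef_conv s) -(@sum_cut _ (m - l) (i - l)
    (fun t => frac_coef (- s) t * frac_coef s (i - l - t))); last first.
    by apply: ltn_sub2r.
  apply: eq_bigr => t _; congr (if _ then _ else _).
  by rewrite leq_subRL ?(addnC l).
have [r rE] : exists r, (m - l = r.+1)%N.
  by exists (m - l).-1; rewrite prednK// subn_gt0.
rewrite rE /=; have ile : (i - l = r + (i - m).+1)%N by lia.
rewrite ile addnS -frac_coef_partial_conv; apply: eq_bigr => t _.
have -> : (t + l <= i)%N by have := ltn_ord t; lia.
by rewrite addnS.
Qed.

Variables (k : scalar_kind) (q s : R).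
Hypotheses (q1 : 1 < q) (s_gt : - q^-1 < s) (s_lt : s < 1 - q^-1).
Local Notation K := (scalars R k).
Local Notation "r %:K" := (of_real k r) (at level 1, format "r %:K").
Implicit Types (y : nat -> K).

Let q0 : 0 < q. Proof. exact: lt_trans q1. Qed.
Let qi1 : q^-1 < 1. Proof. by rewrite invf_lt1. Qed.
Let qi0 : 0 < q^-1. Proof. by rewrite invr_gt0. Qed.
Let s1 : -1 < s. Proof. by apply: lt_trans s_gt; rewrite ltrN2. Qed.
Let s2 : s < 1. Proof. by apply: lt_trans s_lt _; rewrite ltrBlDr ltrDl. Qed.

(** The [j]-th column of the matrix [tri s]; the coefficient functionals are the
    rows of its inverse [tri (- s)]. *)
Definition frac_vec (j : nat) : nat -> K := fun i => (tri s i j)%:K.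

Definition frac_fun y (j : nat) : K := \sum_(l < j.+1) (tri (- s) j l)%:K * y l.

Definition frac_part m y : nat -> K :=
  fun i => \sum_(j < m) frac_fun y j * frac_vec j i.

Lemma frac_fun_wide m y j : (j < m)%N ->
  frac_fun y j = \sum_(l < m) (tri (- s) j l)%:K * y l.
Proof.
move=> jm; rewrite /frac_fun -(@sum_cut _ m j (fun l => (tri (- s) j l)%:K * y l))//.
by apply: eq_bigr => l _; rewrite /tri /=; case: (l <= j)%N; rewrite ?of_real0 ?mul0r.
Qed.

Lemma frac_fun_lin (c : K) y y' j :
  frac_fun (fun n => c * y n + y' n) j = c * frac_fun y j + frac_fun y' j.
Proof.
rewrite /frac_fun mulr_sumr -big_split; apply: eq_bigr => l _ /=.
by rewrite mulrDr mulrCA.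
Qed.

Lemma frac_part_lin (c : K) m y y' :
  frac_part m (fun n => c * y n + y' n) =
  fun n => c * frac_part m y n + frac_part m y' n.
Proof.
apply/funext => i; rewrite /frac_part mulr_sumr -big_split; apply: eq_bigr => j _ /=.
by rewrite frac_fun_lin mulrDl mulrA.
Qed.

Lemma frac_partE m y i : frac_part m y i =
  \sum_(l < m) (\sum_(j < m) tri s i j * tri (- s) j l)%:K * y l.
Proof.
rewrite /frac_part.
under eq_bigr => j _ do rewrite (frac_fun_wide _ (ltn_ord j)) mulr_suml.
rewrite exchange_big /=; apply: eq_bigr => l _.
rewrite of_real_sum mulr_suml; apply: eq_bigr => j _.
by rewrite /frac_vec of_realM mulrAC [X in X * _]mulrC.
Qed.

Lemma frac_part_lt m y i : (i < m)%N -> frac_part m y i = y i.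
Proof.
move=> im; rewrite frac_partE (bigD1 (Ordinal im)) //= tri_prod// im eqxx.
rewrite of_real1 mul1r big1 ?addr0// => l li.
rewrite tri_prod// im (_ : (i == l) = false) ?of_real0 ?mul0r//.
by apply: contraNF li => /eqP il; apply/eqP/val_inj.
Qed.

Lemma frac_part_ge m y x : rabs (frac_part m y (m + x)) <=
  4 * \sum_(r < m) corner_kernel s x r * rabs (y (m - r.+1)%N).
Proof.
rewrite frac_partE; apply: (le_trans (rabs_sum _ _ _)).
rewrite (reindex_inj rev_ord_inj) /= mulr_sumr; apply: ler_sum => r _.
have rm := ltn_ord r.
rewrite rabsM rabs_of_real tri_prod; last by lia.
rewrite (ltnNge (m + x)%N) leq_addr /= mulrA ler_wpM2r ?rabs_ge0//.
have -> : (m - (m - r.+1)).-1 = r :> nat by lia.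
have -> : (m + x - m = x)%N by lia.
have -> : (m + x - (m - r.+1) = (r + x).+1)%N by lia.
exact: frac_corner_le.
Qed.

Lemma qsum_corner m y (n : nat) : qsum q (frac_part m y) n <=
  qsum q y m + 4 `^ q * \sum_(x < n)
    (\sum_(r < m) corner_kernel s x r * rabs (y (m - r.+1)%N)) `^ q.
Proof.
apply: (@le_trans _ _ (qsum q (frac_part m y) (m + n)%N)).
  by apply: qsum_nd; exact: leq_addl.
rewrite /qsum big_split_ord /=; apply: lerD.
  by apply: ler_sum => i _; rewrite frac_part_lt.
rewrite mulr_sumr; apply: ler_sum => x _.
have h0 : 0 <= \sum_(r < m) corner_kernel s x r * rabs (y (m - r.+1)%N).
  by apply: sumr_ge0 => r _; rewrite mulr_ge0 ?rabs_ge0 ?corner_kernel_ge0.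
rewrite -powRM// ge0_ler_powR ?(ltW q0) ?nnegrE ?rabs_ge0 ?mulr_ge0//.
exact: frac_part_ge.
Qed.

(** A partial sum operator is the identity above the corner and the corner
    kernel below it, so that Schur's test bounds all of them at once. *)
Lemma frac_part_bounded : exists2 C : R, 0 < C & forall m y, ellq q y ->
  ellq q (frac_part m y) /\ ellq_norm q (frac_part m y) <= C * ellq_norm q y.
Proof.
have [C C0 hC] := corner_schur q1 s_gt s_lt.
pose D := 1 + 4 `^ q * C.
have D0 : 0 < D by rewrite /D ltr_pwDl// mulr_ge0 ?powR_ge0.
exists (D `^ q^-1); first by rewrite powR_gt0.
move=> m y hy; apply: ellq_norm_le => //.
  by rewrite mulr_ge0 ?powR_ge0 ?ellq_norm_ge0.
move=> n; apply: (le_trans (qsum_corner _ _ _)).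
rewrite powRM ?powR_ge0 ?ellq_norm_ge0// powR_invK ?(ltW D0)//.
apply: (@le_trans _ _ (D * qsum q y m)); last first.
  by rewrite ler_wpM2l ?(ltW D0)// qsum_le_norm.
rewrite /D mulrDl mul1r lerD2l -mulrA ler_wpM2l ?powR_ge0//.
apply: (le_trans (hC n m (fun r => rabs (y (m - r.+1)%N)) _)).
  by move=> r; exact: rabs_ge0.
rewrite ler_wpM2l// /qsum (reindex_inj rev_ord_inj) /=.
apply: ler_sum => r _; rewrite le_eqVlt; apply/orP; left; apply/eqP.
by rewrite rev_index.
Qed.

Definition unit_vec (l : nat) : nat -> K := fun i => (i == l)%:R.

(** Below row [m] the error is the column of the corner kernel at distance
    [m - l] from the corner, whose norm tends to 0. *)
Lemma frac_part_unit_vec (l : nat) (e : R) : 0 < e -> exists N, forall m, (N <= m)%N ->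
  ellq q (fun i => unit_vec l i - frac_part m (unit_vec l) i) /\
  ellq_norm q (fun i => unit_vec l i - frac_part m (unit_vec l) i) < e.
Proof.
move=> e0; have [C C0 hC] := corner_column q1 s_gt s_lt.
pose e2 := e / 2; have e20 : 0 < e2 by rewrite divr_gt0.
have [|N hN] := @powR_small (q - 1) (4 `^ q * C) (e2 `^ q) _ (powR_gt0 _ e20).
  by rewrite subr_gt0.
exists (N + l.+1)%N => m mN.
suff [h1 h2] : ellq q (fun i => unit_vec l i - frac_part m (unit_vec l) i) /\
  ellq_norm q (fun i => unit_vec l i - frac_part m (unit_vec l) i) <= e2.
  by split; [exact: h1 | apply: (le_lt_trans h2); rewrite /e2; lra].
apply: (ellq_norm_le q1); first exact: ltW.
move=> n; set v := fun i => _.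
apply: (@le_trans _ _ (qsum q v (m + n)%N)); first by apply: qsum_nd; exact: leq_addl.
rewrite /qsum big_split_ord /= big1 ?add0r; last first.
  by move=> i _; rewrite /v frac_part_lt// subrr rabs0 powR0// gt_eqF.
have lm : (l < m)%N by apply: leq_trans mN; exact: leq_addl.
apply: (@le_trans _ _ (\sum_(x < n) 4 `^ q * corner_kernel s x (m - l.+1) `^ q)).
  apply: ler_sum => x _.
  rewrite -powRM ?corner_kernel_ge0// ge0_ler_powR ?(ltW q0) ?nnegrE ?rabs_ge0 ?mulr_ge0 ?corner_kernel_ge0//.
  have [r [mE r1 r2 r3]] := corner_index x lm.
  rewrite /v /unit_vec r3.
  rewrite sub0r rabsN frac_partE (bigD1 (Ordinal lm)) //= eqxx mulr1.
  rewrite tri_prod// (ltnNge (m + x)%N) leq_addr /= big1 ?addr0; last first.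
    move=> j /eqP jl; have [jl'|_] := eqVneq (nat_of_ord j) l; last by rewrite mulr0.
    by exfalso; apply: jl; apply/val_inj.
  rewrite rabs_of_real.
  rewrite addKn r1 r2 (_ : (m - l.+1 = r)%N); last by rewrite mE -addSnnS addKn.
  exact: frac_corner_le.
rewrite -mulr_sumr; apply: le_trans (ltW (hN (m - l.+1)%N _)).
  by rewrite -mulrA ler_wpM2l ?powR_ge0.
by rewrite leq_subRL// addnC.
Qed.

(** By uniform boundedness it is enough to treat finitely supported sequences,
    that is, unit vectors. *)
Lemma frac_part_cvg y : ellq q y -> forall e : R, 0 < e ->
  exists N, forall m, (N <= m)%N ->
  ellq_norm q (fun i => y i - frac_part m y i) < e.
Proof.
move=> hy.
have [C C0 hC] := frac_part_bounded.
have alg (u v : R) : u <= C * v -> 2 * (v + u) <= 2 * (1 + C) * v by lra.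
pose err (z : nat -> K) m : nat -> K := fun i => z i - frac_part m z i.
have err_lin (c : K) (z z' : nat -> K) m : err (fun n => c * z n + z' n) m = fun i => c * err z m i + err z' m i.
  apply/funext => i; rewrite /err frac_part_lin mulrBr opprD; exact: addrACA.
have err_le (z : nat -> K) m : ellq q z -> ellq q (err z m) /\
    ellq_norm q (err z m) <= 2 * (1 + C) * ellq_norm q z.
  move=> hz; have [h1 h2] := hC m z hz; have [h3 h4] := ellqB q1 hz h1.
  split; first exact: h3.
  suff h : 2 * (ellq_norm q z + ellq_norm q (frac_part m z)) <=
      2 * (1 + C) * ellq_norm q z by exact: (le_trans h4 h).
  exact: alg h2.
have fin N : forall e : R, 0 < e -> exists M, forall m, (M <= m)%N ->
    ellq_norm q (err (trunc_to N y) m) < e.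
  elim: N => [|N IH] e e0.
    exists 0%N => m _; have E : trunc_to 0 y = fun=> 0 by [].
    have [z1 z2] := @ellq0 R k q q1; have [_ h] := err_le (fun=> 0) m z1.
    by rewrite E (le_lt_trans h)// z2 mulr0.
  pose c := rabs (y N).
  have c0 : 0 <= c by exact: rabs_ge0.
  pose e' := e / (2 * (c + 1)).
  have e'0 : 0 < e' by rewrite divr_gt0// mulr_gt0//; lra.
  have eE : 2 * (c + 1) * e' = e by rewrite /e' mulrC divfK// gt_eqF// mulr_gt0//; lra.
  have [M1 h1] := IH _ e'0; have [M2 h2] := frac_part_unit_vec N e'0.
  exists (maxn M1 M2) => m; rewrite geq_max => /andP[/h1 m1 /h2 [m2 m3]].
  have -> : trunc_to N.+1 y = fun n => y N * unit_vec N n + trunc_to N y n.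
    apply/funext => n; rewrite /trunc_to /unit_vec ltnS.
    by case: (ltngtP n N) => [nN|nN|->]; rewrite ?mulr0 ?mulr1 ?add0r ?addr0.
  rewrite err_lin.
  have [u1 u2] := ellqZ q1 (y N) m2.
  have [w1 _] := err_le _ m (@trunc_to_ellq R k q q1 N y).
  have [_ t] := ellqD q1 u1 w1.
  exact: le_lt_trans t (eps_step c0 eE u2 m3 m1).
move=> e e0.
pose e' := e / (8 * (1 + C)).
have e'0 : 0 < e' by rewrite divr_gt0// mulr_gt0//; lra.
have eE : 8 * (1 + C) * e' = e by rewrite /e' mulrC divfK// gt_eqF// mulr_gt0//; lra.
have [N hN] := trunc_from_cvg0 q1 hy e'0.
have e40 : 0 < e / 4 by rewrite divr_gt0.
have [M hM] := fin N _ e40.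
exists M => m /hM h1; have h2 := hN N (leqnn N).
have yE : y = fun n => 1 * trunc_to N y n + trunc_from N y n.
  apply/funext => n; rewrite /trunc_to /trunc_from mul1r ltnNge.
  by case: leqP => _; rewrite ?addr0 ?add0r.
have : ellq_norm q (err y m) < e; last by [].
rewrite {1}yE err_lin.
have [w1 _] := err_le _ m (@trunc_to_ellq R k q q1 N y).
have [w2 w3] := err_le _ m (@trunc_from_ellq R k q q1 N y hy).1.
have -> : (fun i => 1 * err (trunc_to N y) m i + err (trunc_from N y) m i) =
  fun i => err (trunc_to N y) m i + err (trunc_from N y) m i.
  by apply/funext => i; rewrite mul1r.
have [_ t] := ellqD q1 w1 w2.
exact: le_lt_trans t (eps_split C0 eE w3 h2 h1).
Qed.

(** Below the diagonal the vector is the column of the corner kernel next to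
    the corner. *)
Lemma frac_vec_bounded : exists2 C : R, 0 < C & forall j,
  ellq q (frac_vec j) /\ ellq_norm q (frac_vec j) <= C.
Proof.
have [C C0 hC] := corner_column q1 s_gt s_lt.
pose D := 1 + 4 `^ q * C.
have D0 : 0 < D by rewrite /D ltr_pwDl// mulr_ge0 ?powR_ge0.
exists (D `^ q^-1); first by rewrite powR_gt0.
move=> j; apply: ellq_norm_le => //; first exact: powR_ge0.
move=> n; rewrite powR_invK ?(ltW D0)//.
apply: (@le_trans _ _ (qsum q (frac_vec j) (j + n.+1)%N)).
  by apply: qsum_nd; rewrite addnS ltnW// ltnS leq_addl.
rewrite /qsum big_split_ord /= big1 ?add0r; last first.
  move=> i _; rewrite /frac_vec /tri leqNgt ltn_ord /= of_real0 rabs0 powR0//.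
  by rewrite gt_eqF.
rewrite big_ord_recl /= addn0 /frac_vec /tri leqnn subnn /=.
rewrite of_real1 rabs1 powR1 lerD2l.
apply: (@le_trans _ _ (\sum_(x < n) 4 `^ q * corner_kernel s x 0 `^ q)).
  apply: ler_sum => x _; rewrite leq_addr addKn /bump /= ?add1n rabs_of_real.
  rewrite -powRM ?corner_kernel_ge0// ge0_ler_powR ?(ltW q0) ?nnegrE ?mulr_ge0 ?corner_kernel_ge0//.
  have := frac_corner_le x 0 s1 s2; rewrite frac_prod0 mulr1 add0n.
  exact.
rewrite -mulr_sumr ler_wpM2l ?powR_ge0//.
by have := hC n 0%N; rewrite powR1 mulr1.
Qed.

Lemma frac_vec_diag j : frac_vec j j = 1.
Proof. by rewrite /frac_vec /tri leqnn subnn of_real1. Qed.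

(** The same triangular product as for the partial sums, with the two inverse
    matrices exchanged. *)
Lemma frac_biorth i j : frac_fun (frac_vec i) j = (i == j)%:R.
Proof.
pose m := maxn i.+1 j.+1.
have jm : (j < m)%N by rewrite /m leq_maxr.
have im : (i < m)%N by rewrite /m leq_maxl.
rewrite (frac_fun_wide _ jm).
have := @tri_prod (- s) m j i im; rewrite jm opprK eq_sym => h.
rewrite -(@of_real_nat R k (i == j)) -h of_real_sum; apply: eq_bigr => l _.
by rewrite /frac_vec of_realM.
Qed.

(** The matrix has 1 on its diagonal, so that the coefficient [j] is the [j]-th
    coordinate of a difference of two consecutive partial sums. *)
Lemma frac_fun_bounded : exists2 C : R, 0 < C & forall y j, ellq q y ->
  rabs (frac_fun y j) <= C * ellq_norm q y.
Proof.
have [C C0 hC] := frac_part_bounded.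
exists (2 * C); first by rewrite mulr_gt0.
move=> y j hy.
have -> : frac_fun y j = frac_part j.+1 y j - frac_part j y j.
  by rewrite /frac_part big_ord_recr /= frac_vec_diag mulr1 addrAC subrr add0r.
have [h1 h2] := hC j.+1 y hy; have [h3 h4] := hC j y hy.
apply: (le_trans (rabsD _ _)); rewrite rabsN.
rewrite -mulrA mulr_natl mulr2n; apply: lerD.
  exact: le_trans (rabs_le_norm q1 j h1) h2.
exact: le_trans (rabs_le_norm q1 j h3) h4.
Qed.

End FractionalBasis.

(** * Interleaving and rotating bases *)

Section CombiningSystems.
Variables (R : realType) (k : scalar_kind).
Local Notation K := (scalars R k).
Variable X : completeNormedModType K.
Implicit Types (x y z : nat -> X) (a b c : X -> nat -> K) (P Q : X -> X).

Definition alternate (T : Type) (x y : nat -> T) : nat -> T :=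
  fun n => if odd n then y n./2 else x n./2.

Lemma psum_alternate x y (a b : nat -> K) n :
  psum (alternate x y) (alternate a b) n = psum x a (uphalf n) + psum y b n./2.
Proof.
elim: n => [|n IH]; first by rewrite /psum !big_ord0 addr0.
rewrite psumS IH /alternate [uphalf n.+1]/= uphalf_half.
have -> : n.+1./2 = (odd n + n./2)%N by rewrite -uphalf_half.
case: (odd n); rewrite ?add1n ?add0n !psumS; first by rewrite addrA.
by rewrite addrAC.
Qed.

Lemma coord_system_alternate x y a b P Q :
  coord_system x a P -> coord_system y b Q ->
  (forall i j, a (y i) j = 0) -> (forall i j, b (x i) j = 0) ->
  coord_system (alternate x y) (fun f => alternate (a f) (b f)) (fun f => P f + Q f).
Proof.
move=> hx hy ay bx; split.
- move=> f; have -> : psum (alternate x y) (alternate (a f) (b f)) =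
      fun n => psum x (a f) (uphalf n) + psum y (b f) n./2.
    by apply/funext => n; exact: psum_alternate.
  apply: tendsD => e e0.
    have [N hN] := coord_tends hx f e0; exists N.*2 => n Nn; apply: hN.
    by have := uphalf_leq Nn; rewrite uphalf_double.
  have [N hN] := coord_tends hy f e0; exists N.*2 => n Nn; apply: hN.
  by have := half_leq Nn; rewrite doubleK.
- move=> c f g j; rewrite /alternate; case: ifP => _.
    exact: coord_lin hy _ _ _ _.
  exact: coord_lin hx _ _ _ _.
- have [C C0 hC] := coord_bounded hx; have [C' C'0 hC'] := coord_bounded hy.
  exists (C + C'); first by rewrite addr_gt0.
  move=> f j; rewrite mulrDl /alternate; case: ifP => _.
    by apply: (le_trans (hC' f _)); rewrite lerDr mulr_ge0 ?rnorm_ge0 ?ltW.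
  by apply: (le_trans (hC f _)); rewrite lerDl mulr_ge0 ?rnorm_ge0 ?ltW.
- move=> i j; rewrite /alternate.
  have -> : (i == j) = (odd i == odd j) && (i./2 == j./2).
    apply/eqP/andP => [->|[/eqP h1 /eqP h2]]; first by rewrite !eqxx.
    by rewrite -(odd_double_half i) -(odd_double_half j) h1 h2.
  case: (odd i); case: (odd j) => //=; first by rewrite (coord_biorth hy).
  by rewrite (coord_biorth hx).
- have [C hC] := coord_norm hx; have [C' hC'] := coord_norm hy.
  exists (Num.max C C') => j; rewrite /alternate le_max.
  by case: ifP => _; rewrite ?hC ?hC' ?orbT.
Qed.

(** The term of index [n] is a difference of consecutive partial sums, and the
    coefficient is recovered from it by the bounded functional [c]. *)
Lemma coord_system_null z c Q : coord_system z c Q -> forall f (e : R), 0 < e ->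
  exists N, forall n, (N <= n)%N -> rabs (c f n) < e.
Proof.
move=> hz f e e0; have [C C0 hC] := coord_bounded hz.
have e20 : 0 < e / C / 2 by rewrite !divr_gt0.
have [N hN] := coord_tends hz f e20.
exists N => n Nn.
have -> : c f n = c (c f n *: z n) n.
  have := coord_lin hz (c f n) (z n) 0 n; rewrite addr0 (coord_biorth hz) eqxx mulr1.
  have := coord_psum hz (fun=> 0) 0 n; rewrite /psum big_ord0 => -> ->.
  by rewrite addr0.
apply: (le_lt_trans (hC _ n)); rewrite mulrC -ltr_pdivlMr//.
have -> : c f n *: z n = (Q f - psum z (c f) n) - (Q f - psum z (c f) n.+1).
  by rewrite psumS !opprD !opprK addrACA subrr add0r addrA addNr add0r.
apply: (le_lt_trans (rnormB _ _)).
have := hN n Nn; have := hN n.+1 (leqW Nn).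
move: (rnorm _) (rnorm _) => u v; lra.
Qed.

(** Rotating each pair [z (2 j)], [z (2 j + 1)] into its sum and its difference
    preserves partial sums of even length. *)
Definition rotate z : nat -> X := fun n =>
  if odd n then z n.-1 - z n else z n + z n.+1.

Definition rotate_coef (c : nat -> K) : nat -> K := fun n =>
  if odd n then (c n.-1 - c n) / 2 else (c n + c n.+1) / 2.

Let half_sum (u v : K) : (u + v) / 2 + (u - v) / 2 = u.
Proof. by field. Qed.

Let half_diff (u v : K) : (u + v) / 2 - (u - v) / 2 = v.
Proof. by field. Qed.

Lemma psum_rotate z (c : nat -> K) n :
  psum (rotate z) (rotate_coef c) n.*2 = psum z c n.*2.
Proof.
elim: n => [|n IH]; first by rewrite /psum !big_ord0.
rewrite doubleS !psumS IH -!addrA; congr (_ + _).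
rewrite /rotate /rotate_coef /= odd_double /=.
rewrite scalerDr scalerBr addrACA -scalerDl -scalerBl half_sum half_diff.
by [].
Qed.

Let rabs_half : rabs (2^-1 : K) = 2^-1.
Proof.
have -> : (2^-1 : K) = of_real k 2^-1 by rewrite of_realV of_real_nat.
by rewrite rabs_of_real gtr0_norm.
Qed.

(** A partial sum of odd length differs from one of even length by a single
    term, which tends to 0 with the coefficients. *)
Lemma coord_system_rotate z c Q : coord_system z c Q ->
  coord_system (rotate z) (fun f => rotate_coef (c f)) Q.
Proof.
move=> hz; have [B hB] := coord_norm hz.
have B0 : 0 <= B by apply: le_trans (hB 0%N); exact: rnorm_ge0.
have rot_norm n : rnorm (rotate z n) <= 2 * B.
  rewrite /rotate; case: ifP => _.
    by apply: (le_trans (rnormB _ _)); have := hB n.-1; have := hB n; lra.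
  by apply: (le_trans (rnormD _ _)); have := hB n.+1; have := hB n; lra.
split.
- move=> f e e0.
  pose e' := e / 2 / (2 * B + 1).
  have e'0 : 0 < e' by rewrite !divr_gt0//; lra.
  have e20 : 0 < e / 2 by rewrite divr_gt0.
  have [N1 h1] := coord_tends hz f e20.
  have [N2 h2] := coord_system_null hz f e'0.
  exists (N1 + N2).+2 => n; rewrite -(odd_double_half n).
  move: n./2 (odd n) => l b Nn.
  have n1 : (N1 <= l.*2)%N by case: b Nn => /=; lia.
  have n2 : (N2 <= l.*2)%N by case: b Nn => /=; lia.
  have := h1 _ n1; case: b {Nn}; last first.
    by rewrite add0n psum_rotate => h; apply: lt_trans h _; lra.
  rewrite add1n psumS psum_rotate opprD addrA => h.
  apply: (le_lt_trans (rnormB _ _)); rewrite rnormZ.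
  have a1 := h2 _ n2; have a2 := h2 _ (leqW n2).
  have : rabs (rotate_coef (c f) l.*2) <= e'.
    rewrite /rotate_coef odd_double rabsM rabs_half.
    have := rabsD (c f l.*2) (c f l.*2.+1).
    by move: (rabs _) (rabs _) (rabs _) a1 a2 => u v w; lra.
  have := rot_norm l.*2; have := rnorm_ge0 (rotate z l.*2).
  have : e' * (2 * B + 1) = e / 2 by rewrite /e' divfK// gt_eqF//; lra.
  have := rabs_ge0 (rotate_coef (c f) l.*2).
  move: (rabs (rotate_coef _ _)) (rnorm (rotate _ _)) (rnorm _) h => u v w h.
  move=> u0 E v0 vB ue; have : u * v <= e' * (2 * B) by apply: ler_pM.
  by lra.
- move=> d f g j; rewrite /rotate_coef; case: ifP => _; rewrite !(coord_lin hz).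
    by rewrite mulrA -mulrDl; congr (_ / 2); rewrite mulrBr opprD addrACA.
  by rewrite mulrA -mulrDl; congr (_ / 2); rewrite mulrDr addrACA.
- have [C C0 hC] := coord_bounded hz; exists C => // f j.
  have h (u v : K) : rabs u <= C * rnorm f -> rabs v <= C * rnorm f ->
      rabs ((u + v) / 2) <= C * rnorm f.
    by rewrite rabsM rabs_half; have := rabsD u v; lra.
  rewrite /rotate_coef; case: ifP => _; apply: h; rewrite ?rabsN; exact: hC.
- have z0 j : c 0 j = 0.
    by have := coord_psum hz (fun=> 0) 0 j; rewrite /psum big_ord0.
  have cD f g j : c (f + g) j = c f j + c g j.
    by rewrite -[f]scale1r (coord_lin hz) scale1r mul1r.
  have cB f g j : c (f - g) j = c f j - c g j.
    by rewrite addrC -scaleN1r (coord_lin hz) mulN1r addrC.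
  have rotE i : exists m, exists2 b : bool, i = (b + m.*2)%N & odd i = b.
    by exists i./2; exists (odd i); rewrite ?odd_double_half.
  move=> i j; have [m [b iE ob]] := rotE i; have [l [d jE od]] := rotE j.
  rewrite /rotate_coef /rotate ob od.
  have e1 : (m.*2 == l.*2) = (m == l) by rewrite -!muln2 eqn_pmul2r.
  have e2 : (m.*2.+1 == l.*2) = false.
    by apply/eqP => h; have := congr1 odd h; rewrite /= !odd_double.
  have e3 : (m.*2 == l.*2.+1) = false.
    by apply/eqP => h; have := congr1 odd h; rewrite /= !odd_double.
  case: b d iE jE {ob od} => -[] -> ->; rewrite ?add1n ?add0n /= ?eqSS;
    rewrite ?cB ?cD !(coord_biorth hz) ?eqSS ?e1 ?e2 ?e3;
    case: (m == l); rewrite /= ?mulr1n ?mulr0n. 1-8: by field.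
- by exists (2 * B).
Qed.

End CombiningSystems.

(** * Sums of the fractional bases *)

Section PowerSums.
Variable R : realType.

(** Convexity of [x ^ (p + 1)] between consecutive integers; the lower bounds
    telescope. *)
Lemma sum_powR_ge (p : R) n : 0 < p ->
  n%:R `^ (p + 1) / (p + 1) <= \sum_(i < n) i.+1%:R `^ p.
Proof.
move=> p0; have p1 : 0 < p + 1 by rewrite addr_gt0.
rewrite ler_pdivrMr//.
elim: n => [|n IH]; first by rewrite big_ord0 mul0r powR0// gt_eqF.
rewrite big_ord_recr /= mulrDl.
suff : n.+1%:R `^ (p + 1) - n%:R `^ (p + 1) <= n.+1%:R `^ p * (p + 1) by lra.
have zp : 0 < n.+1%:R :> R by rewrite ltr0n.
have nE : n%:R = n.+1%:R * (1 - n.+1%:R^-1) :> R.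
  by rewrite mulrBr mulr1 mulfV ?gt_eqF// -natr1 addrK.
have u0 : 0 <= 1 - n.+1%:R^-1 :> R by rewrite subr_ge0 invf_le1// ler1n.
have vz : n.+1%:R * n.+1%:R^-1 = 1 :> R by rewrite mulfV ?gt_eqF.
move: (n.+1%:R) (n.+1%:R^-1) zp nE u0 vz => z v zp nE u0 vz.
have z1 : z `^ (p + 1) = z `^ p * z.
  by rewrite powRD ?(gt_eqF zp) ?implybT// powRr1// ltW.
rewrite nE powRM ?(ltW zp)// z1.
have pz := powR_ge0 z p.
have p11 : 1 < p + 1 by rewrite ltrDr.
have := powR_tangent p11 u0 ler01; rewrite !powR1 !mulr1 addrK => h.
have -> : z `^ p * z - z `^ p * z * (1 - v) `^ (p + 1) =
  z `^ p * (z * (1 - (1 - v) `^ (p + 1))) by ring.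
rewrite ler_wpM2l//.
apply: (@le_trans _ _ (z * ((p + 1) * v))).
  by rewrite ler_wpM2l ?(ltW zp)//; move: h; move: (_ `^ _) => w; lra.
by rewrite mulrCA vz mulr1.
Qed.

End PowerSums.

Section FractionalSums.
Variables (R : realType) (k : scalar_kind) (q s : R).
Hypotheses (q1 : 1 < q) (s_gt : - q^-1 < s) (s_lt : s < 1 - q^-1).
Local Notation K := (scalars R k).

Let q0 : 0 < q. Proof. exact: lt_trans q1. Qed.

(** The coefficients 1 present the sum of the first [n] vectors as a linear
    combination, to which linear maps on [ellq] apply directly. *)
Definition frac_sum n : nat -> K := fun i => \sum_(j < n) 1 * frac_vec k s j i.

Lemma frac_sum_lt n i : (i < n)%N -> frac_sum n i = of_real k (frac_prod s i).
Proof.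
move=> i_n; rewrite -frac_coef_sum of_real_sum /frac_sum.
rewrite [RHS](reindex_inj rev_ord_inj) /=.
rewrite -(@sum_cut _ n i (fun j => of_real k (frac_coef s (i.+1 - j.+1))))//.
apply: eq_bigr => j _; rewrite mul1r /frac_vec /tri subSS.
by case: ifP => // _; rewrite of_real0.
Qed.

Lemma frac_sum_ellq n : ellq q (frac_sum n).
Proof.
have [C C0 hC] := frac_vec_bounded k q1 s_gt s_lt.
rewrite /frac_sum; elim: n => [|n IH].
  have -> : (fun i => \sum_(j < 0) 1 * frac_vec k s j i) = fun=> 0.
    by apply/funext => i; rewrite big_ord0.
  by have [] := @ellq0 R k q q1.
have -> : (fun i => \sum_(j < n.+1) 1 * frac_vec k s j i) =
    fun i => 1 * frac_vec k s n i + \sum_(j < n) 1 * frac_vec k s j i.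
  by apply/funext => i; rewrite big_ord_recr addrC.
exact: (@ellq_lin R k q q1 1 _ _ (hC n).1 IH).
Qed.

Lemma frac_sum_ge n : 0 < s ->
  (n%:R `^ (s * q + 1) / (s * q + 1)) `^ q^-1 <= ellq_norm q (frac_sum n).
Proof.
move=> s0; have sq : 0 < s * q by rewrite mulr_gt0.
have s1 : s <= 1 by apply: (le_trans (ltW s_lt)); rewrite lerBlDr lerDl invr_ge0 ltW.
have n0 : 0 <= n%:R `^ (s * q + 1) / (s * q + 1).
  by rewrite divr_ge0 ?powR_ge0// addr_ge0// ltW.
have hn := @qsum_le_norm R k q q1 (frac_sum n) n (@frac_sum_ellq n).
rewrite -(powR_leE q1 (powR_ge0 _ _) (ellq_norm_ge0 _ _)) (powR_invK q1 n0).
apply: (le_trans (sum_powR_ge n sq)); apply: (le_trans _ hn).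
apply: ler_sum => i _; rewrite frac_sum_lt// rabs_of_real powRrM.
have h := frac_prod_ge i (ltW s0) s1.
by rewrite ge0_ler_powR ?nnegrE ?(ltW q0) ?powR_ge0// ger0_norm// (le_trans (powR_ge0 _ _) h).
Qed.

(** [frac_sum n] is the [n]-th partial sum of its own truncation to the first
    [n] coordinates, whose norm is explicit. *)
Lemma frac_sum_le : s < 0 -> exists2 C : R, 0 < C & forall n,
  ellq_norm q (frac_sum n) <= C * (n%:R `^ (1 + s * q)) `^ q^-1.
Proof.
move=> s0.
have [C C0 hC] := frac_part_bounded k q1 s_gt s_lt.
have b0 : 0 < - (s * q) by rewrite oppr_gt0 nmulr_rlt0.
have b1 : - (s * q) < 1.
  by rewrite -mulNr -ltr_pdivlMr// mul1r ltrNl.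
have b2 : 0 < 1 + s * q by move: b1; rewrite -subr_gt0 opprK.
exists (C * ((1 + s * q)^-1) `^ q^-1).
  by rewrite mulr_gt0// powR_gt0// invr_gt0.
move=> n.
have -> : frac_sum n = frac_part s n (trunc_to n (frac_sum n)).
  apply/funext => i; rewrite /frac_part /frac_sum; apply: eq_bigr => j _.
  congr (_ * _); have E : frac_fun s (frac_sum n) j = 1.
    rewrite /frac_fun /frac_sum.
    under eq_bigr => l _ do rewrite mulr_sumr.
    rewrite exchange_big /= (bigD1 j) //= [X in _ + X]big1 ?addr0.
      under eq_bigr => l _ do rewrite mul1r.
      by have := frac_biorth k s j j; rewrite /frac_fun eqxx.
    move=> l lj; under eq_bigr => m _ do rewrite mul1r.
    have := frac_biorth k s l j; rewrite /frac_fun => ->.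
    by rewrite (_ : (l == j :> nat) = false)//; apply: contraNF lj => /eqP/val_inj ->.
  rewrite -[LHS]E /frac_fun; apply: eq_bigr => l _; congr (_ * _).
  by rewrite /trunc_to (leq_trans (ltn_ord l) (ltn_ord j)).
have ht := @trunc_to_ellq R k q q1 n (frac_sum n).
have [_ h] := hC n _ ht; apply: (le_trans h).
rewrite -mulrA ler_wpM2l ?(ltW C0)//.
rewrite (@finite_ellq_norm R k q q1 _ n); last first.
  by move=> i ni; rewrite /trunc_to ltnNge ni.
rewrite -powRM ?invr_ge0 ?powR_ge0 ?(ltW b2)//.
rewrite ge0_ler_powR ?nnegrE ?invr_ge0 ?(ltW q0) ?qsum_ge0 ?mulr_ge0 ?powR_ge0 ?invr_ge0 ?(ltW b2)//.
have h2 := sum_powRN_le n b0 b1; rewrite opprK in h2.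
rewrite mulrC; apply: le_trans h2; apply: ler_sum => i _.
have s1 : -1 < s by apply: lt_trans s_gt; rewrite ltrN2 invf_lt1.
rewrite /trunc_to ltn_ord frac_sum_lt// rabs_of_real powRrM.
have h1 := frac_prod_le_neg i s1 (ltW s0).
by rewrite ge0_ler_powR ?nnegrE ?(ltW q0) ?powR_ge0// ger0_norm// ltW// frac_prod_gt0.
Qed.

End FractionalSums.

(** * A highly conditional basis *)

Section ConditionalBasis.
Variables (R : realType) (k : scalar_kind) (q : R).
Hypothesis q1 : 1 < q.
Local Notation K := (scalars R k).
Variable X : completeNormedModType K.
Implicit Types (x : nat -> X) (f g : X).

Lemma psum_map (E : X -> X) x (a : nat -> K) n :
  (forall c f g, E (c *: f + g) = c *: E f + E g) ->
  E (psum x a n) = psum (E \o x) a n.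
Proof.
move=> Elin; elim: n => [|n IH].
  rewrite /psum !big_ord0.
  by have := Elin (-1) 0 0; rewrite !scaleN1r !addNr.
by rewrite !psumS addrC Elin IH addrC.
Qed.

Lemma coord_system_of_basis (x : nat -> X) (D E : X -> X) (M : R) : is_basis x ->
  0 < M ->
  (forall c f g, D (c *: f + g) = c *: D f + D g) ->
  (forall c f g, E (c *: f + g) = c *: E f + E g) ->
  (forall f, rnorm (D f) <= M * rnorm f) -> (forall f, rnorm (E f) <= M * rnorm f) ->
  cancel E D ->
  coord_system (E \o x) (fun f => coef x (D f)) (fun f => E (D f)).
Proof.
move=> [sx nx] M0 Dlin Elin DM EM DE.
have /semi_normalizedP[c [B [c0 hcB]]] := nx.
have EB f g : E (f - g) = E f - E g.
  by rewrite addrC -scaleN1r Elin scaleN1r addrC.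
split.
- move=> f e e0; have [N hN] := coef_tends sx (D f) (divr_gt0 e0 M0).
  exists N => n Nn; rewrite -(psum_map _ _ _ Elin) -EB.
  by apply: (le_lt_trans (EM _)); rewrite mulrC -ltr_pdivlMr// hN.
- by move=> d f g j; rewrite Dlin coef_lin.
- have [C C0 hC] := coef_bounded sx c0 (fun j => (hcB j).1).
  exists (C * M); first by rewrite mulr_gt0.
  move=> f j; apply: (le_trans (hC _ _)); rewrite -mulrA ler_wpM2l ?(ltW C0)//.
- by move=> i j; rewrite /= DE coef_basis.
- exists (M * B) => j; apply: (le_trans (EM _)); rewrite ler_wpM2l ?(ltW M0)//.
  exact: (hcB j).2.
Qed.

(** A complemented copy of [ellq], with coordinate map [S] and embedding [J],
    inherits the fractional basis. *)
Lemma frac_coord_system (s M : R) (S : X -> nat -> K) (J : (nat -> K) -> X) :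
  - q^-1 < s -> s < 1 - q^-1 -> 0 < M -> ellq_linear q J ->
  (forall y, ellq q y -> rnorm (J y) <= M * ellq_norm q y) ->
  (forall c f g n, S (c *: f + g) n = c * S f n + S g n) ->
  (forall f, ellq q (S f)) -> (forall f, ellq_norm q (S f) <= M * rnorm f) ->
  (forall y, ellq q y -> S (J y) = y) ->
  coord_system (fun j => J (frac_vec k s j)) (fun f => frac_fun s (S f)) (fun f => J (S f)).
Proof.
move=> sg sl M0 Jlin JM Slin Sq SM SJ.
have [C C0 hC] := frac_vec_bounded k q1 sg sl.
have hv j : ellq q (frac_vec k s j) := (hC j).1.
have [C' C'0 hC'] := frac_part_bounded k q1 sg sl.
split.
- move=> f e e0.
  have [N hN] := frac_part_cvg q1 sg sl (Sq f) (divr_gt0 e0 M0).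
  exists N => m Nm.
  have -> : psum (fun j => J (frac_vec k s j)) (frac_fun s (S f)) m =
      J (frac_part s m (S f)).
    by have [_ ->] := ellq_linear_sum q1 Jlin (index_enum 'I_m) xpredT
      (fun j : 'I_m => frac_fun s (S f) j) (fun j : 'I_m => hv j).
  have [h1 _] := hC' m _ (Sq f).
  rewrite -(ellq_linearB Jlin (Sq f) h1).
  have [h2 _] := ellqB q1 (Sq f) h1.
  apply: (le_lt_trans (JM _ h2)); rewrite mulrC -ltr_pdivlMr//.
  exact: hN.
- move=> c f g j; rewrite -frac_fun_lin; congr frac_fun.
  by apply/funext => n; exact: Slin.
- have [C2 C20 hC2] := frac_fun_bounded k q1 sg sl.
  exists (C2 * M); first by rewrite mulr_gt0.
  move=> f j; apply: (le_trans (hC2 _ j (Sq f))).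
  by rewrite -mulrA ler_wpM2l ?(ltW C20).
- by move=> i j; rewrite (SJ _ (hv i)) frac_biorth.
- exists (M * C) => j; apply: (le_trans (JM _ (hv j))).
  apply: (ler_wpM2l (ltW M0)); exact: (hC j).2.
Qed.

Lemma psum_quad x (a : nat -> K) n : psum x a (4 * n) =
  \sum_(j < n) (a (4 * j)%N *: x (4 * j)%N + a (4 * j + 1)%N *: x (4 * j + 1)%N +
    a (4 * j + 2)%N *: x (4 * j + 2)%N + a (4 * j + 3)%N *: x (4 * j + 3)%N).
Proof.
elim: n => [|n IH]; first by rewrite muln0 /psum !big_ord0.
rewrite big_ord_recr /= -IH mulnSr !addnS addn0 !psumS.
by rewrite !addrA.
Qed.

(** Inside [ellq], written as the sum of two copies of itself, the fractional
    bases with parameters [a (1 - 1 / q)] and [- a / q] are put in duality: the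
    vectors [u j] of the first have large sums, of order [n ^ (1 / q + a (1 - 1 / q))],
    and the vectors [v j] of the second small sums, of order [n ^ (1 / q - a / q)].
    In the rotated basis with vectors [u j + v j] and [u j - v j], dropping the
    terms [u j - v j] from the expansion of [2 v 0 + ... + 2 v (n - 1)] therefore
    multiplies the norm by [n ^ a], up to a constant. *)
Lemma conditional_basis (x0 : nat -> X) D E cc La M (a : R) :
  is_basis x0 -> @ellq_splitting R k q X D E cc La M -> 0 < a -> a < 1 ->
  exists x (c : R), [/\ is_basis x, 0 < c & forall n, (0 < n)%N ->
    exists (al : nat -> K) (A : pred nat),
      psum x al (4 * n) != 0 /\
      c * n%:R `^ a * rnorm (psum x al (4 * n)) <=
      rnorm (psum x (fun j => if A j then al j else 0) (4 * n))].
Proof.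
move=> bx0 spl a0 a1.
have M0 := spl_gt0 spl.
have q0 : 0 < q by apply: lt_trans q1.
have qi0 : 0 < q^-1 by rewrite invr_gt0.
have qi1 : q^-1 < 1 by rewrite invf_lt1.
pose s := a * (1 - q^-1); pose r := a * q^-1.
have s0 : 0 < s by rewrite mulr_gt0// subr_gt0.
have r0 : 0 < r by rewrite mulr_gt0.
have sl : s < 1 - q^-1 by rewrite -[X in _ < X]mul1r ltr_pM2r// subr_gt0.
have sg : - q^-1 < s by apply: lt_trans s0; rewrite oppr_lt0.
have rg : - q^-1 < - r by rewrite ltrN2 -[X in _ < X]mul1r ltr_pM2r.
have rl : - r < 1 - q^-1 by apply: (@lt_trans _ _ 0); rewrite ?oppr_lt0 ?subr_gt0.
have [z1 z2] := @ellq0 R k q q1.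
have iev (y : nat -> K) : ellq q y -> ellq q (interleave y (fun=> 0)) /\
    ellq_norm q (interleave y (fun=> 0)) <= ellq_norm q y.
  move=> hy; have [h1 h2] := @ellq_interleave R k q q1 y (fun=> 0) hy z1.
  split; first exact: h1.
  by rewrite z2 addr0 in h2.
have iod (y : nat -> K) : ellq q y -> ellq q (interleave (fun=> 0) y) /\
    ellq_norm q (interleave (fun=> 0) y) <= ellq_norm q y.
  move=> hy; have [h1 h2] := @ellq_interleave R k q q1 (fun=> 0) y z1 hy.
  split; first exact: h1.
  by rewrite z2 add0r in h2.
pose Ju (y : nat -> K) := La (interleave y (fun=> 0)).
pose Jv (y : nat -> K) := La (interleave (fun=> 0) y).
have sysB := coord_system_of_basis bx0 M0 (spl_Dlin spl) (spl_Elin spl)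
  (spl_Dle spl) (spl_Ele spl) (spl_DE spl).
have hcc : forall f, ellq q (cc f) by move=> f; apply: (spl_cc spl).
have ccev f : ellq q (evens (cc f)) /\ ellq_norm q (evens (cc f)) <= M * rnorm f.
  have [h1 h2] := ellq_evens q1 (hcc f).
  by split; [exact: h1 | exact: le_trans h2 (spl_ccle spl f)].
have ccod f : ellq q (odds (cc f)) /\ ellq_norm q (odds (cc f)) <= M * rnorm f.
  have [h1 h2] := ellq_odds q1 (hcc f).
  by split; [exact: h1 | exact: le_trans h2 (spl_ccle spl f)].
have Ju_lin : ellq_linear q Ju.
  move=> c y y' hy hy'; rewrite /Ju -(spl_Lalin spl _ (iev _ hy).1 (iev _ hy').1).
  congr La; rewrite -interleave_lin; congr interleave.
  by apply/funext => n; rewrite mulr0 addr0.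
have Jv_lin : ellq_linear q Jv.
  move=> c y y' hy hy'; rewrite /Jv -(spl_Lalin spl _ (iod _ hy).1 (iod _ hy').1).
  congr La; rewrite -interleave_lin; congr interleave.
  by apply/funext => n; rewrite mulr0 addr0.
have Ju_le y : ellq q y -> rnorm (Ju y) <= M * ellq_norm q y.
  move=> hy; apply: (le_trans (spl_Lale spl (iev _ hy).1)).
  apply: (ler_wpM2l (ltW M0)); exact: (iev _ hy).2.
have Jv_le y : ellq q y -> rnorm (Jv y) <= M * ellq_norm q y.
  move=> hy; apply: (le_trans (spl_Lale spl (iod _ hy).1)).
  apply: (ler_wpM2l (ltW M0)); exact: (iod _ hy).2.
have ccJu y : ellq q y -> cc (Ju y) = interleave y (fun=> 0).
  by move=> hy; exact: spl_ccLa spl _ (iev _ hy).1.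
have ccJv y : ellq q y -> cc (Jv y) = interleave (fun=> 0) y.
  by move=> hy; exact: spl_ccLa spl _ (iod _ hy).1.
have sysU := @frac_coord_system s M (fun f => evens (cc f)) Ju sg sl M0 Ju_lin Ju_le
  (fun c f g n => spl_cclin spl c f g n.*2) (fun f => (ccev f).1) (fun f => (ccev f).2)
  (fun y hy => etrans (congr1 (@evens R k) (ccJu y hy)) (evens_interleave y (fun=> 0))).
have sysV := @frac_coord_system (- r) M (fun f => odds (cc f)) Jv rg rl M0 Jv_lin Jv_le
  (fun c f g n => spl_cclin spl c f g n.*2.+1) (fun f => (ccod f).1) (fun f => (ccod f).2)
  (fun y hy => etrans (congr1 (@odds R k) (ccJv y hy)) (odds_interleave (fun=> 0) y)).
have [Cu _ hu] := frac_vec_bounded k q1 sg sl.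
have [Cv _ hv] := frac_vec_bounded k q1 rg rl.
have fun0 (t : R) j : frac_fun t (fun=> 0 : K) j = 0.
  by rewrite /frac_fun big1// => l _; rewrite mulr0.
have sysUV := coord_system_alternate sysU sysV
  (fun i j => etrans (congr1 (fun y => frac_fun s y j)
     (etrans (congr1 (@evens R k) (ccJv _ (hv i).1)) (evens_interleave _ _))) (fun0 s j))
  (fun i j => etrans (congr1 (fun y => frac_fun (- r) y j)
     (etrans (congr1 (@odds R k) (ccJu _ (hu i).1)) (odds_interleave _ _))) (fun0 (- r) j)).
have {sysUV} sysW := coord_system_rotate sysUV.
pose w := rotate (alternate (fun j => Ju (frac_vec k s j)) (fun j => Jv (frac_vec k (- r) j))).
have wE0 j : w (2 * j)%N = Ju (frac_vec k s j) + Jv (frac_vec k (- r) j).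
  rewrite mul2n /w /rotate /alternate odd_double /= odd_double /= doubleK.
  by rewrite uphalf_double.
have wE1 j : w (2 * j).+1 = Ju (frac_vec k s j) - Jv (frac_vec k (- r) j).
  rewrite mul2n /w /rotate /alternate /= odd_double /= doubleK.
  by rewrite uphalf_double.
have coef00 : coef x0 0 = fun=> 0.
  have [sx0 _] := bx0; apply: (coef_unique sx0) => e e0; exists 0%N => n _.
  by rewrite /psum big1 ?subrr ?rnorm0// => j _; rewrite scale0r.
have DLa0 i : D (w i) = 0.
  have DD f g : D f = 0 -> D g = 0 -> D (f + g) = 0.
    by move=> h1 h2; rewrite -[f]scale1r (spl_Dlin spl) h1 h2 scaler0 addr0.
  have DN f : D f = 0 -> D (- f) = 0.
    move=> h1; have D0 : D 0 = 0.
      by have := spl_Dlin spl (-1) 0 0; rewrite !scaleN1r !addNr.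
    by rewrite -[- f]addr0 -scaleN1r (spl_Dlin spl) h1 D0 scaler0 addr0.
  have Du j : D (Ju (frac_vec k s j)) = 0 by exact: spl_DLa spl _ (iev _ (hu j).1).1.
  have Dv j : D (Jv (frac_vec k (- r) j)) = 0 by exact: spl_DLa spl _ (iod _ (hv j).1).1.
  have alt j : D (alternate (fun j => Ju (frac_vec k s j)) (fun j => Jv (frac_vec k (- r) j)) j) = 0.
    by rewrite /alternate; case: ifP => _; [exact: Dv | exact: Du].
  rewrite /w /rotate; case: ifP => _; apply: DD; rewrite ?alt//.
  by apply: DN; rewrite alt.
have ccE0 i : (fun f => rotate_coef (alternate (frac_fun s (evens (cc f)))
    (frac_fun (- r) (odds (cc f))))) (E (x0 i)) = fun=> 0.
  apply/funext => j; rewrite /rotate_coef (spl_ccE spl).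
  have alt l : alternate (frac_fun s (@evens R k (fun=> 0)))
      (frac_fun (- r) (@odds R k (fun=> 0))) l = 0.
    by rewrite /alternate; case: ifP => _; exact: fun0.
  by rewrite !alt subrr addr0 mul0r; case: ifP.
have sys := coord_system_alternate sysB sysW
  (fun i j => etrans (congr1 (fun g => coef x0 g j) (DLa0 i)) (congr1 (@^~ j) coef00))
  (fun i j => congr1 (@^~ j) (ccE0 i)).
have idE : (fun f => E (D f) + (Ju (evens (cc f)) + Jv (odds (cc f)))) = id.
  apply/funext => f; rewrite /Ju /Jv.
  rewrite -(ellq_linearD (spl_Lalin spl) (iev _ (ccev f).1).1 (iod _ (ccod f).1).1).
  have -> : (fun n => interleave (evens (cc f)) (fun=> 0) n +
      interleave (fun=> 0) (odds (cc f)) n) = cc f.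
    rewrite -[RHS]interleaveK; apply/funext => n; rewrite /interleave.
    by case: ifP => _; rewrite ?addr0 ?add0r.
  exact: spl_id spl f.
rewrite idE in sys.
pose x := alternate (E \o x0) w.
have xE1 j : x (4 * j + 1)%N = Ju (frac_vec k s j) + Jv (frac_vec k (- r) j).
  rewrite -wE0 /x /alternate addn1 /= mulnC (_ : (4 = 2.*2)%N)// -doubleMr odd_double /=.
  by rewrite uphalf_double mulnC.
have xE3 j : x (4 * j + 3)%N = Ju (frac_vec k s j) - Jv (frac_vec k (- r) j).
  rewrite -wE1 /x /alternate addn3 /= negbK mulnC (_ : (4 = 2.*2)%N)// -doubleMr odd_double /=.
  by rewrite uphalf_double mulnC.
have rn : - r < 0 by rewrite oppr_lt0.
have [C C0 hC] := frac_sum_le k q1 rg rl rn.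
have e1 : 1 + - r * q = 1 - a.
  by rewrite /r mulNr -mulrA mulVf ?gt_eqF// mulr1.
have e2 : s * q + 1 = 1 + a * (q - 1).
  by rewrite /s -mulrA mulrBl mul1r mulVf ?gt_eqF// addrC.
have d0 : 0 < s * q + 1 by rewrite addr_gt0// mulr_gt0.
pose L := ((s * q + 1)^-1) `^ q^-1.
have L0 : 0 < L by rewrite powR_gt0// invr_gt0.
exists x, (L / (2 * (M * (M * C)))); split.
- exact: (basis_of_coord_system sys).1.
- by rewrite divr_gt0// !mulr_gt0.
move=> n n0.
(* The vectors u j + v j and u j - v j of w stand at the places 4 j + 1 and
   4 j + 3 of x, the even places being taken by x0. *)
pose al j : K := if (j %% 4 == 1)%N then 1 else if (j %% 4 == 3)%N then -1 else 0.
pose A : pred nat := fun j => (j %% 4 == 1)%N.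
have m40 j : ((4 * j) %% 4 = 0)%N by rewrite modnMr.
have m41 j : ((4 * j + 1) %% 4 = 1)%N by rewrite mulnC modnMDl.
have m42 j : ((4 * j + 2) %% 4 = 2)%N by rewrite mulnC modnMDl.
have m43 j : ((4 * j + 3) %% 4 = 3)%N by rewrite mulnC modnMDl.
have fsum (t : R) (J : (nat -> K) -> X) : ellq_linear q J ->
    (forall j, ellq q (frac_vec k t j)) ->
    J (frac_sum k t n) = \sum_(j < n) J (frac_vec k t j).
  move=> Jlin ht.
  have [_ ->] := ellq_linear_sum q1 Jlin (index_enum 'I_n) xpredT
    (fun=> 1) (fun j : 'I_n => ht j).
  by apply: eq_bigr => j _; rewrite scale1r.
have fE : psum x al (4 * n) = 2 *: Jv (frac_sum k (- r) n).
  rewrite psum_quad (fsum _ _ Jv_lin (fun j => (hv j).1)) scaler_sumr.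
  apply: eq_bigr => j _; rewrite /al m40 m41 m42 m43 /= !scale0r add0r addr0.
  rewrite scale1r xE1 xE3 scaleN1r opprB addrC addrA subrK.
  by rewrite scaler_nat mulr2n.
have gE : psum x (fun j => if A j then al j else 0) (4 * n) =
    Ju (frac_sum k s n) + Jv (frac_sum k (- r) n).
  rewrite psum_quad (fsum _ _ Jv_lin (fun j => (hv j).1)).
  rewrite (fsum _ _ Ju_lin (fun j => (hu j).1)) -big_split.
  apply: eq_bigr => j _; rewrite /A /al m40 m41 m42 m43 /= !scale0r add0r !addr0.
  by rewrite scale1r xE1.
exists al, A; split.
  apply/eqP => f0.
  have := coord_psum sys al (4 * n) 1.
  rewrite -/x f0 (_ : (1 < 4 * n)%N); last by rewrite mulnC (leq_trans (_ : 1 < 1 * 4)%N)// leq_mul2r n0.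
  have -> : al 1%N = 1 by [].
  have := coord_psum sys (fun=> 0) 0 1; rewrite /psum big_ord0 /= => -> /eqP.
  by rewrite eq_sym oner_eq0.
rewrite fE gE.
have hus := @frac_sum_ellq R k q s q1 sg sl n.
have hvs := @frac_sum_ellq R k q (- r) q1 rg rl n.
have up : rnorm (2 *: Jv (frac_sum k (- r) n)) <=
    2 * (M * (C * (n%:R `^ (1 - a)) `^ q^-1)).
  rewrite rnormZ -(@of_real_nat R k 2) rabs_of_real ger0_norm// ler_wpM2l//.
  apply: (le_trans (Jv_le _ hvs)); apply: (ler_wpM2l (ltW M0)); rewrite -e1.
  exact: hC.
have lo : L * (n%:R `^ (1 + a * (q - 1))) `^ q^-1 <=
    M * rnorm (Ju (frac_sum k s n) + Jv (frac_sum k (- r) n)).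
  apply: le_trans (ccev _).2.
  have -> : evens (cc (Ju (frac_sum k s n) + Jv (frac_sum k (- r) n))) = frac_sum k s n.
    rewrite -[X in cc (X + _)]scale1r.
    have -> : cc (1 *: Ju (frac_sum k s n) + Jv (frac_sum k (- r) n)) =
      fun i => 1 * interleave (frac_sum k s n) (fun=> 0) i + interleave (fun=> 0) (frac_sum k (- r) n) i.
      by apply/funext => i; rewrite (spl_cclin spl) (ccJu _ hus) (ccJv _ hvs).
    rewrite -interleave_lin evens_interleave; apply/funext => i.
    by rewrite mul1r addr0.
  apply: (le_trans _ (@frac_sum_ge R k q s q1 sg sl n s0)).
  rewrite e2 powRM ?powR_ge0 ?invr_ge0 -?e2 ?(ltW d0)//.
  by rewrite mulrC.
have nn0 : n%:R != 0 :> R by rewrite pnatr_eq0 -lt0n.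
have na : (n%:R `^ (1 + a * (q - 1))) `^ q^-1 = n%:R `^ a * (n%:R `^ (1 - a)) `^ q^-1 :> R.
  rewrite -!powRrM -powRD ?(negbTE nn0) ?implybT//; congr (_ `^ _).
  by field; rewrite gt_eqF.
rewrite na in lo.
move: up lo; move: (rnorm _) (rnorm _) (n%:R `^ a) (powR_ge0 n%:R a) => U V na' na0.
move: (_ `^ q^-1) => W up lo.
have c0 : 0 <= L / (2 * (M * (M * C))) * na'.
  by rewrite mulr_ge0// ltW// divr_gt0// !mulr_gt0.
apply: (le_trans (ler_wpM2l c0 up)).
rewrite -(ler_pM2l M0); apply: le_trans lo.
rewrite le_eqVlt; apply/orP; left; apply/eqP; field.
by rewrite !gt_eqF.
Qed.

End ConditionalBasis.

(** * Almost greedy bases from bounds on coefficients *)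

Section FiniteSets.
Variables (R : realType) (k : scalar_kind).
Variable X : completeNormedModType (scalars R k).

Lemma fset_bounded (A : {fset nat}) : exists n, forall j, j \in A -> (j < n)%N.
Proof.
exists (\max_(j <- A) j).+1 => j jA; rewrite ltnS.
by apply: (@leq_bigmax_seq _ (enum_fset A) xpredT id j).
Qed.

Lemma fset_sum (V : nmodType) (F : nat -> V) n (A : {fset nat}) :
  (forall j, j \in A -> (j < n)%N) ->
  \sum_(j <- A) F j = \sum_(j < n | nat_of_ord j \in A) F j.
Proof.
move=> An; rewrite -(big_mkord (fun j => j \in A)) -big_filter.
apply: perm_big; apply: uniq_perm; rewrite ?filter_uniq ?iota_uniq ?fset_uniq//.
move=> j; rewrite mem_filter mem_index_iota /=.
by have [/An ->|] := boolP (j \in A).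
Qed.

Lemma fset_card n (A : {fset nat}) : (forall j, j \in A -> (j < n)%N) ->
  #|` A| = (\sum_(j < n | nat_of_ord j \in A) 1)%N.
Proof. by move=> An; rewrite -(@fset_sum nat (fun=> 1%N) n)// sum1_size. Qed.

Lemma basis_proj_finite (x : nat -> X) (S : set nat) f n :
  (forall j, (n <= j)%N -> j \in S -> coef x f j = 0) ->
  basis_proj x S f = \sum_(j < n | nat_of_ord j \in S) coef x f j *: x j.
Proof.
move=> h; rewrite /basis_proj; apply: cvg_lim => //.
apply/tendsP => e e0; exists n => m nm.
rewrite /series /= big_mkord -(subnKC nm) big_split_ord /= [X in _ - (_ + X)]big1.
  by rewrite addr0 [X in X - _]big_mkcond subrr rnorm0.
move=> j _; case: ifP => // jS.
by rewrite (h _ (leq_addr _ _) jS) scale0r.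
Qed.

Lemma coef_psum (x : nat -> X) (a : nat -> scalars R k) n j : schauder_basis x ->
  coef x (psum x a n) j = if (j < n)%N then a j else 0.
Proof.
move=> sx.
suff -> : coef x (psum x a n) = fun j => if (j < n)%N then a j else 0 by [].
apply: (coef_unique sx) => e e0; exists n => m nm.
rewrite /psum -(subnKC nm) big_split_ord /= [X in _ - (_ + X)]big1 ?addr0.
  rewrite [X in _ - X](eq_bigr (fun j : 'I_n => a j *: x j)) ?subrr ?rnorm0//.
  by move=> i _; rewrite ltn_ord.
by move=> i _; rewrite ltnNge leq_addr scale0r.
Qed.

End FiniteSets.

Section GreedyEstimates.
Variables (R : realType) (k : scalar_kind) (q : R).
Hypothesis q1 : 1 < q.
Local Notation K := (scalars R k).

Let q0 : 0 < q. Proof. exact: lt_trans q1. Qed.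
Let qi0 : 0 < q^-1. Proof. by rewrite invr_gt0. Qed.
Let b0 : 0 < 1 - q^-1. Proof. by rewrite subr_gt0 invf_lt1. Qed.
Let b1 : 1 - q^-1 < 1. Proof. by rewrite ltrBlDr ltrDl. Qed.

Definition card_below (P : pred nat) n : nat := \sum_(j < n | P j) 1.

(** The reciprocal of the norm, in the dual of [ellq], of the indicator of
    [j + 1] indices. *)
Definition weight (j : nat) : R := j.+1%:R `^ (- (1 - q^-1)).

Let weight_ge0 j : 0 <= weight j. Proof. exact: powR_ge0. Qed.

Lemma card_below_le P n : (card_below P n <= n)%N.
Proof.
rewrite /card_below big_mkcond /= -[X in (_ <= X)%N]card_ord -sum1_card.
by apply: leq_sum => j _; case: ifP.
Qed.

Lemma card_belowE (P : pred nat) n : (card_below P n)%:R = \sum_(j < n | P j) (1 : R).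
Proof. by rewrite /card_below natr_sum. Qed.

(** As the weights decrease, the worst set of [m] indices is the first [m]. *)
Lemma weight_sum_le (P : pred nat) n :
  \sum_(j < n | P j) weight j <= (q + 1) * (card_below P n)%:R `^ q^-1.
Proof.
set m := card_below P n.
have [m0|m0] := posnP m.
  rewrite big1 ?mulr_ge0 ?powR_ge0// ?addr_ge0 ?(ltW q0)// => j Pj.
  by move/eqP: m0; rewrite /m /card_below (bigD1 j Pj).
have mp : 0 < m%:R :> R by rewrite ltr0n.
have mn : (m <= n)%N := card_below_le P n.
apply: (@le_trans _ _ (\sum_(j < n | P j)
    ((if (j < m)%N then weight j else 0) + m%:R `^ (- (1 - q^-1))))).
  apply: ler_sum => j _; case: ltnP => jm; first by rewrite lerDl powR_ge0.
  rewrite add0r /weight !powRN lef_pV2 ?posrE ?powR_gt0 ?ltr0n//.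
  rewrite ge0_ler_powR ?nnegrE ?(ltW b0)//.
  by rewrite ler_nat ltnW.
rewrite big_split /= mulrDl; apply: lerD.
  apply: (@le_trans _ _ (\sum_(j < m) weight j)).
    apply: (@le_trans _ _ (\sum_(j < n) (if (j < m)%N then weight j else 0))).
      rewrite big_mkcond /=; apply: ler_sum => j _; case: ifP => // _.
      by case: ifP => // _; exact: weight_ge0.
    rewrite -(subnKC mn) big_split_ord /= [X in _ + X]big1 ?addr0.
      by apply: ler_sum => j _; rewrite ltn_ord.
    by move=> j _; rewrite ltnNge leq_addr.
  apply: (le_trans (sum_powRN_le m b0 b1)).
  have -> : 1 - (1 - q^-1) = q^-1 by rewrite subKr.
  by rewrite invrK mulrC.
have -> : \sum_(j < n | P j) m%:R `^ (- (1 - q^-1)) =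
    m%:R * m%:R `^ (- (1 - q^-1)) :> R.
  transitivity ((\sum_(j < n | P j) (1 : R)) * m%:R `^ (- (1 - q^-1))).
    by rewrite mulr_suml; apply: eq_bigr => j _; rewrite mul1r.
  by rewrite -card_belowE.
have -> : - (1 - q^-1) = q^-1 - 1 by rewrite opprB.
by rewrite mulr_powRB1 ?mul1r// ltW.
Qed.

(** Jensen's inequality with all weights equal to 1. *)
Lemma hoelder_card (P : pred nat) n (b : nat -> R) : (forall j, 0 <= b j) ->
  \sum_(j < n | P j) b j <=
  (card_below P n)%:R `^ (1 - q^-1) * (\sum_(j < n | P j) b j `^ q) `^ q^-1.
Proof.
move=> hb.
have S0 : 0 <= \sum_(j < n | P j) b j `^ q.
  by apply: sumr_ge0 => j _; exact: powR_ge0.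
have T0 : 0 <= \sum_(j < n | P j) b j by exact: sumr_ge0.
rewrite -(powR_leE q1) ?mulr_ge0 ?powR_ge0// powRM ?powR_ge0// powR_invK//.
rewrite -powRrM (_ : (1 - q^-1) * q = q - 1); last first.
  by rewrite mulrBl mul1r mulVf// gt_eqF.
have := @jensen_powR R 'I_n (index_enum 'I_n) P (fun=> 1) (fun j => b j) q q1
  (fun _ _ => ler01) (fun j _ => hb j).
rewrite -card_belowE.
have -> : \sum_(j < n | P j) 1 * b j = \sum_(j < n | P j) b j.
  by apply: eq_bigr => j _; rewrite mul1r.
have -> // : \sum_(j < n | P j) 1 * b j `^ q = \sum_(j < n | P j) b j `^ q.
by apply: eq_bigr => j _; rewrite mul1r.
Qed.

Lemma ellq_sub_sum (h : nat -> K) (P : pred nat) n : ellq q h ->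
  \sum_(j < n | P j) rabs (h j) `^ q <= ellq_norm q h `^ q.
Proof.
move=> hh; apply: le_trans (qsum_le_norm q1 n hh).
rewrite /qsum big_mkcond /=; apply: ler_sum => j _.
by case: ifP => // _; exact: powR_ge0.
Qed.

Variable X : completeNormedModType K.
Variable x : nat -> X.
Hypothesis bx : is_basis x.
Variables CU CL CB : R.
Hypotheses (CU0 : 0 < CU) (CL0 : 0 < CL) (CB0 : 0 < CB).

(** On coefficients of equal size, and these are what greedy sums see, the
    following two bounds agree with those of the unit vector basis of [ellq]. *)
Hypothesis upper : forall n (P : pred nat) (b : nat -> K),
  rnorm (\sum_(j < n | P j) b j *: x j) <=
  CU * (\sum_(j < n | P j) weight j * rabs (b j) +
        (\sum_(j < n | P j) rabs (b j) `^ q) `^ q^-1).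

Hypothesis lower : forall f, exists h : nat -> K, [/\ ellq q h,
  ellq_norm q h <= CL * rnorm f &
  forall j, rabs (coef x f j - h j) <= CL * rnorm f * j.+1%:R `^ (- q^-1)].

Hypothesis partial : forall f n, rnorm (psum x (coef x f) n) <= CB * rnorm f.

Let sx : schauder_basis x := bx.1.

(** Both terms of [upper] are largest when all the coefficients equal [t]. *)
Lemma bounded_coef_norm_le n (P : pred nat) (b : nat -> K) (t : R) : 0 <= t ->
  (forall j, P j -> rabs (b j) <= t) ->
  rnorm (\sum_(j < n | P j) b j *: x j) <=
  CU * (q + 2) * (t * (card_below P n)%:R `^ q^-1).
Proof.
move=> t0 hb; apply: (le_trans (upper n P b)).
rewrite -mulrA; apply: (ler_wpM2l (ltW CU0)).
have -> : (q + 2) * (t * (card_below P n)%:R `^ q^-1) =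
  t * ((q + 1) * (card_below P n)%:R `^ q^-1) + t * (card_below P n)%:R `^ q^-1.
  by ring.
apply: lerD.
  apply: (@le_trans _ _ (t * \sum_(j < n | P j) weight j)).
    rewrite mulr_sumr; apply: ler_sum => j Pj; rewrite mulrC.
    by apply: (ler_wpM2r (weight_ge0 j)); exact: hb.
  by apply: (ler_wpM2l t0); exact: weight_sum_le.
have S0 : 0 <= \sum_(j < n | P j) rabs (b j) `^ q.
  by apply: sumr_ge0 => j _; exact: powR_ge0.
rewrite -(powR_leE q1) ?mulr_ge0 ?powR_ge0// (powR_invK q1 S0).
rewrite powRM ?powR_ge0// (powR_invK q1)// card_belowE mulr_sumr.
apply: ler_sum => j Pj; rewrite mulr1 (powR_leE q1) ?rabs_ge0//.
exact: hb.
Qed.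

Section Threshold.
Variables (f : X) (t : R).
Hypothesis t0 : 0 < t.

Let R0 : R := (2 * (CL * rnorm f) / t) `^ q.
Let N := Num.Def.truncn R0.

Let D0 : 0 <= CL * rnorm f. Proof. by rewrite mulr_ge0 ?rnorm_ge0// ltW. Qed.
Let E0 : 0 <= 2 * (CL * rnorm f) / t.
Proof. by rewrite divr_ge0 ?(ltW t0)// mulr_ge0// D0. Qed.

Let N_le : N%:R <= R0.
Proof. by have := @truncn_le R R0; rewrite powR_ge0. Qed.

Let R0_root : t * R0 `^ q^-1 = 2 * (CL * rnorm f).
Proof.
by rewrite /R0 -powRrM mulfV ?gt_eqF// powRr1// mulrC divfK// gt_eqF.
Qed.

(** Beyond the index [N] the bound on [coef - h] has dropped below [t / 2]. *)
Let beyond (h : nat -> K) : (forall j, rabs (coef x f j - h j) <=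
     CL * rnorm f * j.+1%:R `^ (- q^-1)) ->
  forall j, (N <= j)%N -> t <= rabs (coef x f j) ->
  t / 2 <= rabs (h j) /\ rabs (coef x f j) <= 2 * rabs (h j).
Proof.
move=> hh j Nj tj.
have lt : R0 < j.+1%:R.
  by apply: (lt_le_trans (truncnS_gt R0)); rewrite ler_nat ltnS.
have le : CL * rnorm f * j.+1%:R `^ (- q^-1) <= t / 2.
  rewrite powRN ler_pdivrMr ?powR_gt0// mulrAC ler_pdivlMr// mulrC -R0_root.
  apply: (ler_wpM2l (ltW t0)).
  by rewrite ge0_ler_powR ?nnegrE ?powR_ge0 ?(ltW qi0)// ltW.
have h1 := le_trans (hh j) le; have h2 := rabsB_le (coef x f j) (h j).
by move: tj h1 h2; move: (rabs _) (rabs _) (rabs _) => u v w tj h1 h2; split; lra.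
Qed.

Let card_beyond (P : pred nat) n : (forall j, P j -> t <= rabs (coef x f j)) ->
  (card_below (fun j => P j && (N <= j)%N) n <= N)%N.
Proof.
move=> hP; have [h [hh hn hd]] := lower f.
suff : (card_below (fun j => P j && (N <= j)%N) n)%:R <= R0.
  move=> le; rewrite -(ler_nat R) ; apply: (@le_trans _ _ N%:R) => //.
  by rewrite ler_nat -ltnS -(ltr_nat R); apply: le_lt_trans le (truncnS_gt R0).
have t20 : 0 < t / 2 by rewrite divr_gt0.
have tq0 : 0 < (t / 2) `^ q by rewrite powR_gt0.
have E : R0 = (CL * rnorm f) `^ q / (t / 2) `^ q.
  rewrite /R0 (_ : 2 * (CL * rnorm f) / t = CL * rnorm f * (t / 2)^-1); last first.
    by field; rewrite gt_eqF.
  rewrite powRM ?invr_ge0 ?(ltW t20)//; congr (_ * _).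
  by rewrite -(powR_inv1 (ltW t20)) powRAC powR_inv1 ?powR_ge0.
rewrite E ler_pdivlMr// card_belowE mulr_suml.
apply: (@le_trans _ _ (ellq_norm q h `^ q)); last first.
  by rewrite (powR_leE q1) ?ellq_norm_ge0.
apply: le_trans (ellq_sub_sum (fun j => P j && (N <= j)%N) n hh).
apply: ler_sum => j /andP[Pj Nj]; rewrite mul1r.
rewrite (powR_leE q1) ?rabs_ge0 ?(ltW t20)//.
by have [] := beyond hd Nj (hP j Pj).
Qed.

(** At most [N] indices lie below [N]; beyond [N] the large coefficients come
    from [h], and their number is bounded by the norm of [h]. *)
Lemma large_coef_card (P : pred nat) n : (forall j, P j -> t <= rabs (coef x f j)) ->
  t * (card_below P n)%:R `^ q^-1 <= 4 * CL * rnorm f.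
Proof.
move=> hP; have hc := card_beyond n hP.
have le : (card_below P n)%:R <= 2 * R0.
  apply: (@le_trans _ _ (N + N)%:R); last by rewrite natrD; have := N_le; lra.
  rewrite ler_nat /card_below (bigID (fun j : 'I_n => (j < N)%N)) /=.
  apply: leq_add.
    apply: (@leq_trans (card_below (fun j => j < N)%N n)).
      rewrite /card_below [X in (X <= _)%N]big_mkcond [X in (_ <= X)%N]big_mkcond /=.
      by apply: leq_sum => j _; case: (P j) => //=; case: ifP.
    have [nN|/ltnW Nn] := leqP n N; first exact: leq_trans (card_below_le _ _) nN.
    rewrite /card_below -(subnKC Nn) big_mkcond big_split_ord /=.
    rewrite [X in (_ + X)%N]big1 ?addn0; last by move=> j _; rewrite ltnNge leq_addr.
    rewrite -[X in (_ <= X)%N]card_ord -sum1_card.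
    by apply: leq_sum => j _; case: ifP.
  rewrite (eq_bigl (fun j : 'I_n => P j && (N <= j)%N)) => [//|j].
  by rewrite -leqNgt.
have m0 : 0 <= (card_below P n)%:R :> R by [].
apply: (@le_trans _ _ (t * (2 * R0 `^ q^-1))); last first.
  by rewrite mulrCA R0_root !mulrA; have := D0; lra.
apply: (ler_wpM2l (ltW t0)).
apply: (@le_trans _ _ ((2 * R0) `^ q^-1)).
  by rewrite ge0_ler_powR ?nnegrE ?(ltW qi0) ?mulr_ge0 ?powR_ge0.
rewrite powRM ?powR_ge0//; apply: ler_wpM2r; first exact: powR_ge0.
by apply: ler1_powR; rewrite ?ler1n// ltW// invf_lt1.
Qed.

(** A greedy sum is compared with the [N]-th partial sum: what has to be
    removed from the partial sum has at most [N] coefficients, of size at most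
    [t], and what has to be added is dominated by the [ellq] part [h] of the
    coefficients. *)
Lemma greedy_sum_le (P : pred nat) n : (forall j, P j -> (j < n)%N) ->
  (forall j, P j -> t <= rabs (coef x f j)) ->
  (forall j, ~~ P j -> rabs (coef x f j) <= t) ->
  rnorm (\sum_(j < n | P j) coef x f j *: x j) <=
  (CB + CU * (q + 2) * (2 * CL) + CU * (4 * CL)) * rnorm f.
Proof.
move=> Pn large small; have [h [hh hn hd]] := lower f.
have hc := card_beyond (n + N) large.
pose F j := coef x f j *: x j.
have -> : \sum_(j < n | P j) coef x f j *: x j = \sum_(j < n + N | P j) F j.
  rewrite [RHS]big_mkcond big_split_ord /= [X in _ + X]big1 ?addr0.
    by rewrite big_mkcond.
  by move=> j _; case: ifP => // /Pn; rewrite ltnNge leq_addr.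
have -> : \sum_(j < n + N | P j) F j =
    psum x (coef x f) N - \sum_(j < N | ~~ P j) F j +
    \sum_(j < n + N | P j && (N <= j)%N) F j.
  rewrite (bigID (fun j : 'I_(n + N) => (j < N)%N)) /=; congr (_ + _); last first.
    by apply: eq_bigl => j; rewrite -leqNgt.
  rewrite /psum (bigID (fun j : 'I_N => P j)) /= addrK.
  rewrite [LHS]big_mkcond [RHS]big_mkcond /= addnC big_split_ord /=.
  rewrite [X in _ + X]big1 ?addr0; last first.
    by move=> j _; rewrite ltnNge leq_addr andbF.
  by apply: eq_bigr => j _; rewrite ltn_ord andbT.
rewrite mulrDl; apply: (le_trans (rnormD _ _)); apply: lerD.
  rewrite mulrDl; apply: (le_trans (rnormB _ _)); apply: lerD; first exact: partial.
  apply: (le_trans (bounded_coef_norm_le N (ltW t0) small)).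
  rewrite -!mulrA; apply: (ler_wpM2l (ltW CU0)); apply: ler_wpM2l.
    by rewrite addr_ge0// ltW.
  rewrite -R0_root; apply: (ler_wpM2l (ltW t0)).
  rewrite ge0_ler_powR ?nnegrE ?(ltW qi0) ?powR_ge0//.
  apply: le_trans N_le; rewrite ler_nat; exact: card_below_le.
apply: (le_trans (upper _ (fun j => P j && (N <= j)%N) _)).
rewrite -mulrA; apply: (ler_wpM2l (ltW CU0)).
set S := (\sum_(j < n + N | _) _ `^ q) `^ q^-1.
have S0 : 0 <= \sum_(j < n + N | P j && (N <= j)%N) rabs (coef x f j) `^ q.
  by apply: sumr_ge0 => j _; exact: powR_ge0.
have S_le : S <= 2 * (CL * rnorm f).
  rewrite -(powR_leE q1) ?powR_ge0 ?mulr_ge0 ?rnorm_ge0 ?(ltW CL0)//.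
  rewrite /S (powR_invK q1 S0) powRM ?D0//.
  apply: (@le_trans _ _ (2 `^ q * ellq_norm q h `^ q)); last first.
    apply: (ler_wpM2l (powR_ge0 _ _)).
    by rewrite (powR_leE q1) ?ellq_norm_ge0.
  apply: le_trans (ler_wpM2l (powR_ge0 _ _)
    (ellq_sub_sum (fun j => P j && (N <= j)%N) (n + N) hh)).
  rewrite mulr_sumr; apply: ler_sum => j /andP[Pj Nj].
  rewrite -powRM ?rabs_ge0// (powR_leE q1) ?mulr_ge0 ?rabs_ge0//.
  by have [] := beyond hd Nj (large j Pj).
have W_le : \sum_(j < n + N | P j && (N <= j)%N) weight j * rabs (coef x f j) <= S.
  apply: (@le_trans _ _ (weight N * \sum_(j < n + N | P j && (N <= j)%N) rabs (coef x f j))).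
    rewrite mulr_sumr; apply: ler_sum => j /andP[_ Nj].
    apply: (ler_wpM2r (rabs_ge0 _)).
    rewrite /weight !powRN lef_pV2 ?posrE ?powR_gt0 ?ltr0n//.
    by rewrite ge0_ler_powR ?nnegrE ?(ltW b0)// ler_nat.
  have := @hoelder_card (fun j => P j && (N <= j)%N) (n + N)
    (fun j => rabs (coef x f j)) (fun j => rabs_ge0 _).
  rewrite -/S => /(ler_wpM2l (weight_ge0 N)) /le_trans; apply.
  rewrite mulrA -[X in _ <= X]mul1r; apply: ler_wpM2r; first exact: powR_ge0.
  rewrite /weight powRN mulrC ler_pdivrMr ?powR_gt0// mul1r.
  rewrite ge0_ler_powR ?nnegrE ?(ltW b0)//.
  by rewrite ler_nat leqW.
have -> : 4 * CL * rnorm f = 2 * (CL * rnorm f) + 2 * (CL * rnorm f) by ring.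
by apply: lerD => //; exact: le_trans W_le S_le.
Qed.

End Threshold.
Let FU := CU * (q + 2).
Let FG := CB + CU * (q + 2) * (2 * CL) + CU * (4 * CL).

(** Let [g] be [f] without its terms in [A]. Then [F] minus [A] is a greedy set
    of [g], and the terms of [A] outside [F] are no larger and no more numerous
    than those of [F] outside [A], whose size and number are bounded by the
    norm of [g]. *)
Lemma greedy_exchange_le f n (A F : pred nat) :
  (forall j, A j -> (j < n)%N) -> (forall j, F j -> (j < n)%N) ->
  (card_below A n <= card_below F n)%N ->
  (forall i j, ~~ F i -> F j -> rabs (coef x f i) <= rabs (coef x f j)) ->
  rnorm (f - \sum_(j < n | F j) coef x f j *: x j) <=
  (1 + FG + FU * (4 * CL)) * rnorm (f - \sum_(j < n | A j) coef x f j *: x j).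
Proof.
move=> An Fn cAF greedy.
have FU0 : 0 < FU by rewrite mulr_gt0// addr_gt0.
have FG0 : 0 < FG by rewrite !addr_gt0 ?mulr_gt0// addr_gt0.
set T := \sum_(j < n | F j) _; set g := f - \sum_(j < n | A j) _.
have C1 : 1 <= 1 + FG + FU * (4 * CL).
  by rewrite -addrA lerDl addr_ge0 ?(ltW FG0)// mulr_ge0 ?(ltW FU0)// mulr_ge0// ltW.
have card_split (P Q : pred nat) : card_below P n =
    (card_below (predI P Q) n + card_below (predI P (predC Q)) n)%N.
  by rewrite /card_below (bigID (fun j : 'I_n => Q j)).
have cD : (card_below (predI A (predC F)) n <= card_below (predI F (predC A)) n)%N.
  move: cAF; rewrite (card_split A F) (card_split F A).
  have -> : card_below (predI F A) n = card_below (predI A F) n.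
    by apply: eq_bigl => j; rewrite /= andbC.
  by rewrite leq_add2l.
have coef_g j : coef x g j = if A j then 0 else coef x f j.
  rewrite /g (coefB sx).
  have -> : \sum_(j < n | A j) coef x f j *: x j =
      psum x (fun j => if A j then coef x f j else 0) n.
    rewrite /psum big_mkcond; apply: eq_bigr => i _.
    by case: ifP => //; rewrite scale0r.
  rewrite (coef_psum _ _ _ sx); case: (ltnP j n) => jn.
    by case: ifP => _; rewrite ?subrr ?subr0.
  rewrite subr0; case: ifP => // /An; by rewrite ltnNge jn.
have sumE : f - T = (g - \sum_(j < n | predI F (predC A) j) coef x g j *: x j) +
    \sum_(j < n | predI A (predC F) j) coef x f j *: x j.
  have -> : \sum_(j < n | predI F (predC A) j) coef x g j *: x j =
      \sum_(j < n | predI F (predC A) j) coef x f j *: x j.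
    by apply: eq_bigr => j /andP[_ /= /negbTE Aj]; rewrite coef_g Aj.
  set v := \sum_(j < n | _) _; set w := \sum_(j < n | _) _.
  pose u := \sum_(j < n | F j && A j) coef x f j *: x j.
  have HF : T = u + v by rewrite /T (bigID (fun j : 'I_n => A j)).
  have HA : \sum_(j < n | A j) coef x f j *: x j = u + w.
    rewrite (bigID (fun j : 'I_n => F j)) /=; congr (_ + _).
    by apply: eq_bigl => j; rewrite andbC.
  by rewrite /g HF HA !opprD !addrA [RHS]addrAC subrK.
have [m0|mp] := posnP (card_below (predI F (predC A)) n).
  have none (P : pred nat) (G : nat -> X) : card_below P n = 0%N -> \sum_(j < n | P j) G j = 0.
    rewrite /card_below => /eqP; rewrite sum_nat_eq0 => /forallP h.
    by rewrite big1// => j Pj; have := h j; rewrite Pj.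
  rewrite sumE (none _ (fun j => coef x g j *: x j) m0).
  rewrite (none _ (fun j => coef x f j *: x j)); last first.
    by apply/eqP; rewrite -leqn0 -m0.
  rewrite subr0 addr0 -[X in X <= _]mul1r; apply: ler_wpM2r => //.
  exact: rnorm_ge0.
(* The smallest coefficient in F minus A is the threshold. If it vanishes, all
   coefficients outside F do, and the left-hand side is 0. *)
have [j0 [Fj0 minj0]] : exists j0, predI F (predC A) j0 /\
    forall j, predI F (predC A) j -> rabs (coef x f j0) <= rabs (coef x f j).
  have [i Pi] : exists i : 'I_n, predI F (predC A) i.
    apply: contrapT => nh; move: mp; rewrite /card_below big1// => i Pi.
    by exfalso; apply: nh; exists i.
  have [j Pj hj] := @arg_minP _ _ _ i (fun j : 'I_n => predI F (predC A) j)
    (fun j : 'I_n => rabs (coef x f j)) Pi.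
  exists j; split => // l Pl.
  have ln : (l < n)%N by apply: Fn; move: Pl => /andP[].
  exact: (hj (Ordinal ln) Pl).
have /andP[F0 A0] := Fj0.
pose t := rabs (coef x f j0).
have [t0|tn0] := eqVneq t 0.
  have -> : f - T = 0.
    apply: (tends_unique (coef_tends sx (f - T))).
    have -> : coef x (f - T) = fun=> 0.
      apply/funext => j; rewrite (coefB sx).
      have -> : T = psum x (fun j => if F j then coef x f j else 0) n.
        rewrite /T /psum big_mkcond; apply: eq_bigr => i _.
        by case: ifP => //; rewrite scale0r.
      rewrite (coef_psum _ _ _ sx).
      have [Fj|Fj] := boolP (F j); first by rewrite (Fn _ Fj) subrr.
      have /eqP : rabs (coef x f j) = 0.
        by apply/eqP; rewrite eq_le rabs_ge0 andbT -t0; exact: greedy.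
      by move=> /eqP/rabs_eq0 ->; rewrite if_same subrr.
    move=> e e0; exists 0%N => l _.
    by rewrite /psum big1 ?subrr ?rnorm0// => i _; rewrite scale0r.
  rewrite rnorm0 mulr_ge0 ?rnorm_ge0//; exact: le_trans C1.
have tp : 0 < t by rewrite lt_neqAle eq_sym tn0 rabs_ge0.
have large j : predI F (predC A) j -> t <= rabs (coef x g j).
  by move=> Pj; have /andP[_ /= /negbTE Aj] := Pj; rewrite coef_g Aj; exact: minj0.
have small j : ~~ predI F (predC A) j -> rabs (coef x g j) <= t.
  rewrite coef_g; case: (boolP (A j)) => Aj; first by rewrite rabs0 ltW.
  by rewrite /= Aj andbT => Fj; exact: greedy.
have h1 := @greedy_sum_le g t tp (predI F (predC A)) n
  (fun j Pj => Fn j (andP Pj).1) large small.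
have h2 := @large_coef_card g t tp (predI F (predC A)) n large.
have h3 := @bounded_coef_norm_le n (predI A (predC F)) (coef x f) t (ltW tp)
  (fun j Pj => greedy j j0 (andP Pj).2 F0).
rewrite sumE; apply: (le_trans (rnormD _ _)).
rewrite mulrDl; apply: lerD.
  by apply: (le_trans (rnormB _ _)); rewrite mulrDl mul1r lerD2l.
apply: (le_trans h3); rewrite -/FU -mulrA; apply: (ler_wpM2l (ltW FU0)).
apply: le_trans h2; apply: (ler_wpM2l (ltW tp)).
by rewrite ge0_ler_powR ?nnegrE ?(ltW qi0)// ler_nat.
Qed.

Lemma almost_greedy_of_bounds : almost_greedy x.
Proof.
exists (1 + FG + FU * (4 * CL)) => f A F cAF greedy.
have [nA hA] := fset_bounded A; have [nF hF] := fset_bounded F.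
pose n := maxn nA nF.
have An j : j \in A -> (j < n)%N by move=> /hA h; rewrite leq_max h.
have Fn j : j \in F -> (j < n)%N by move=> /hF h; rewrite leq_max h orbT.
have proj (B : {fset nat}) : (forall j, j \in B -> (j < n)%N) ->
    basis_proj x [set` B] f = \sum_(j < n | nat_of_ord j \in B) coef x f j *: x j.
  move=> Bn; rewrite (@basis_proj_finite _ _ _ _ _ _ n); last first.
    by move=> j nj; rewrite mem_setE => /Bn; rewrite ltnNge nj.
  by apply: eq_bigl => j; rewrite mem_setE.
rewrite (proj F Fn) (proj A An).
apply: (@greedy_exchange_le f n (mem A) (mem F)) => //.
by rewrite /card_below -!fset_card.
Qed.

(** A sum of [m] basis vectors is the case of [m] coefficients bounded by 1, and
    the first [m] of them are [m] coefficients which are at least 1. *)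
Lemma fundamental_of_bounds :
  equivalent (fundamental x) (fun m => (m%:R `^ q^-1)%:E).
Proof.
have FU0 : 0 < FU by rewrite mulr_gt0// addr_gt0.
split.
  exists FU => m m0; apply: ge_ereal_sup => _ [A /= cA <-].
  rewrite -EFinM lee_fin.
  have [n hn] := fset_bounded A.
  rewrite (@fset_sum _ _ n)//.
  have -> : \sum_(j < n | nat_of_ord j \in A) x j = \sum_(j < n | nat_of_ord j \in A) 1 *: x j.
    by apply: eq_bigr => j _; rewrite scale1r.
  have r1 (j : nat) : mem A j -> rabs (1 : K) <= 1 by rewrite rabs1.
  have := @bounded_coef_norm_le n (mem A) (fun=> 1) 1 ler01 r1.
  rewrite mul1r => /le_trans; apply.
  apply: (ler_wpM2l (ltW FU0)).
  rewrite ge0_ler_powR ?nnegrE ?(ltW qi0)//.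
  by rewrite ler_nat /card_below -fset_card.
exists (4 * CL) => m m0.
pose A : {fset nat} := seq_fset tt (iota 0 m).
have memA j : (j \in A) = (j < m)%N by rewrite seq_fsetE mem_iota add0n.
have cA : #|` A| = m.
  by rewrite size_seq_fset undup_id ?iota_uniq// size_iota.
have h : (\sum_(j <- A) x j) = psum x (fun=> 1) m.
  rewrite (@fset_sum _ _ m) => [|j]; last by rewrite memA.
  rewrite /psum; apply: eq_big => j; first by rewrite memA ltn_ord.
  by rewrite scale1r.
apply: (@le_trans _ _ ((4 * CL)%:E * (rnorm (\sum_(j <- A) x j))%:E)%E).
  rewrite -EFinM lee_fin h.
  have := @large_coef_card (psum x (fun=> 1) m) 1 ltr01 (fun j => j < m)%N m.
  rewrite mul1r (_ : card_below _ m = m); last first.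
    rewrite /card_below (eq_bigl xpredT); last by move=> j; rewrite ltn_ord.
    by rewrite sum1_card card_ord.
  apply=> j jm; by rewrite (coef_psum _ _ _ sx) jm rabs1.
apply: lee_wpmul2l; first by rewrite lee_fin mulr_ge0// ltW.
by apply: ereal_sup_ubound; exists A => //=; rewrite cA.
Qed.

End GreedyEstimates.

(** * Averages over dyadic blocks *)

Section Blocks.

(** The [n]-th block consists of the [2 ^ n] indices from [2 ^ n - 1] on. *)
Definition block (j : nat) : nat := trunc_log 2 j.+1.
Definition block_pos (n i : nat) : nat := (2 ^ n).-1 + i.

Lemma pow2_gt0 n : (0 < 2 ^ n)%N. Proof. by rewrite expn_gt0. Qed.

Lemma block_bounds j : (2 ^ block j <= j.+1 < 2 ^ (block j).+1)%N.
Proof. exact: trunc_log_bounds. Qed.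

Lemma block_posK n i : (i < 2 ^ n)%N -> block (block_pos n i) = n.
Proof.
move=> hi; apply: trunc_log_eq => //; rewrite /block_pos -addSn prednK ?pow2_gt0//.
by rewrite leq_addr expnS mul2n -addnn ltn_add2l.
Qed.

Lemma block_pos_of j : exists2 i, (i < 2 ^ block j)%N & j = block_pos (block j) i.
Proof.
have /andP[h1 h2] := block_bounds j; exists (j.+1 - 2 ^ block j)%N.
  by rewrite ltn_subLR// addnn -mul2n -expnS.
by apply: succn_inj; rewrite /block_pos -addSn prednK ?pow2_gt0// subnKC.
Qed.

Lemma pow2S_pred n : ((2 ^ n.+1).-1 = (2 ^ n).-1 + 2 ^ n)%N.
Proof. by rewrite expnS mul2n -addnn -{1}(prednK (pow2_gt0 n)) addSn. Qed.

Lemma sum_blocks (V : nmodType) (F : nat -> V) N :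
  \sum_(j < (2 ^ N).-1) F j = \sum_(n < N) \sum_(i < 2 ^ n) F (block_pos n i).
Proof.
elim: N => [|N IH]; first by rewrite !big_ord0.
by rewrite big_ord_recr /= -IH pow2S_pred big_split_ord.
Qed.

Lemma ltn_pow2_pred N j : (j < (2 ^ N).-1)%N = (block j < N)%N.
Proof.
have /andP[h1 h2] := block_bounds j.
have -> : (j < (2 ^ N).-1)%N = (j.+1 < 2 ^ N)%N by rewrite -ltnS prednK ?pow2_gt0.
apply/idP/idP => [h|h]; last by apply: (leq_trans h2); rewrite leq_exp2l.
by rewrite -(@ltn_exp2l 2)//; exact: leq_ltn_trans h1 h.
Qed.

End Blocks.

Section BlockAverages.
Variables (R : realType) (k : scalar_kind) (q : R).
Hypothesis q1 : 1 < q.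
Local Notation K := (scalars R k).
Implicit Types (y t : nat -> K).

Let q0 : 0 < q. Proof. exact: lt_trans q1. Qed.
Let qi0 : 0 < q^-1. Proof. by rewrite invr_gt0. Qed.

Let d (n : nat) : R := (2 ^ n)%:R.
Let d_gt0 n : 0 < d n. Proof. by rewrite ltr0n pow2_gt0. Qed.
Let d_ge1 n : 1 <= d n. Proof. by rewrite ler1n pow2_gt0. Qed.

(** The [ellq] norm of the indicator of the [n]-th block. *)
Definition block_norm n : R := d n `^ q^-1.
(** The reciprocal of the norm of that indicator in the dual of [ellq]. *)
Definition block_dual n : R := d n `^ (- (1 - q^-1)).

Lemma block_norm_gt0 n : 0 < block_norm n.
Proof. exact: powR_gt0. Qed.

Lemma block_norm_ge1 n : 1 <= block_norm n.
Proof.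
rewrite /block_norm -[X in X <= _](powRr0 (d n)); apply: ler_powR => //.
exact: ltW.
Qed.

Lemma block_dual_gt0 n : 0 < block_dual n.
Proof. exact: powR_gt0. Qed.

Lemma block_dualE n : block_dual n * d n = block_norm n.
Proof.
rewrite /block_dual /block_norm -{2}(powRr1 (ltW (d_gt0 n))).
by rewrite -powRD ?(gt_eqF (d_gt0 n)) ?implybT//; congr (_ `^ _); ring.
Qed.

(** Averages normalized so that [block_const] is an isometric right inverse. *)
Definition block_mean y : nat -> K :=
  fun n => of_real k (block_dual n) * \sum_(i < 2 ^ n) y (block_pos n i).

Definition block_const t : nat -> K :=
  fun j => of_real k (block_norm (block j))^-1 * t (block j).

Definition block_fluct y : nat -> K := fun j => y j - block_const (block_mean y) j.

Lemma block_mean_lin (c : K) y y' : block_mean (fun j => c * y j + y' j) =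
  fun n => c * block_mean y n + block_mean y' n.
Proof.
apply/funext => n; rewrite /block_mean big_split /= -mulr_sumr mulrDr.
by rewrite [X in X + _]mulrCA.
Qed.

Lemma block_const_lin (c : K) t t' : block_const (fun j => c * t j + t' j) =
  fun n => c * block_const t n + block_const t' n.
Proof. by apply/funext => n; rewrite /block_const mulrDr mulrCA. Qed.

Lemma block_fluct_lin (c : K) y y' : block_fluct (fun j => c * y j + y' j) =
  fun n => c * block_fluct y n + block_fluct y' n.
Proof.
apply/funext => n; rewrite /block_fluct block_mean_lin block_const_lin.
by rewrite mulrBr opprD addrACA.
Qed.

Lemma block_constK t : block_mean (block_const t) = t.
Proof.
apply/funext => n; rewrite /block_mean /block_const.
rewrite (eq_bigr (fun=> of_real k (block_norm n)^-1 * t n)); last first.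
  by move=> i _; rewrite block_posK.
rewrite sumr_const card_ord -[_ *+ 2 ^ n]mulr_natr -(of_real_nat R k).
rewrite [X in _ * X]mulrAC !mulrA -!of_realM.
rewrite mulrAC block_dualE mulfV ?of_real1 ?mul1r//.
by rewrite gt_eqF// block_norm_gt0.
Qed.

Lemma block_mean_fluct y : block_mean (block_fluct y) = fun=> 0.
Proof.
have -> : block_fluct y = fun j => (-1) * block_const (block_mean y) j + y j.
  by apply/funext => j; rewrite /block_fluct mulN1r addrC.
rewrite block_mean_lin block_constK; apply/funext => n.
by rewrite mulN1r addNr.
Qed.

Lemma block_fluct_const t : block_fluct (block_const t) = fun=> 0.
Proof. by apply/funext => j; rewrite /block_fluct block_constK subrr. Qed.

Lemma block_fluct_id y : block_mean y = (fun=> 0) -> block_fluct y = y.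
Proof.
move=> h; apply/funext => j.
by rewrite /block_fluct h /block_const mulr0 subr0.
Qed.

(** Jensen's inequality on each block; the factor [2 ^ (n (q - 1))] which it
    produces is undone by the normalization. *)
Lemma block_mean_ellq y : ellq q y -> ellq q (block_mean y) /\
  ellq_norm q (block_mean y) <= ellq_norm q y.
Proof.
move=> hy; apply: ellq_norm_le => //; first exact: ellq_norm_ge0.
move=> N; apply: le_trans (qsum_le_norm q1 (2 ^ N).-1 hy).
rewrite /qsum (sum_blocks (fun j => rabs (y j) `^ q)); apply: ler_sum => n _.
rewrite /block_mean rabsM rabs_of_real gtr0_norm ?block_dual_gt0//.
rewrite powRM ?rabs_ge0 ?(ltW (block_dual_gt0 _))//.
have S0 : 0 <= \sum_(i < 2 ^ n) rabs (y (block_pos n i)) `^ q.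
  by apply: sumr_ge0 => i _; exact: powR_ge0.
have h : (rabs (\sum_(i < 2 ^ n) y (block_pos n i))) `^ q <=
    d n `^ (q - 1) * \sum_(i < 2 ^ n) rabs (y (block_pos n i)) `^ q.
  apply: (@le_trans _ _ ((\sum_(i < 2 ^ n) 1 * rabs (y (block_pos n i))) `^ q)).
    rewrite (powR_leE q1) ?rabs_ge0//.
      by apply: (le_trans (rabs_sum _ _ _)); apply: ler_sum => i _; rewrite mul1r.
    by apply: sumr_ge0 => i _; rewrite mul1r rabs_ge0.
  apply: (le_trans (@jensen_powR R _ _ _ (fun=> 1) _ _ q1 _ _)) => //.
  - by move=> i _; exact: rabs_ge0.
  rewrite sumr_const card_ord -/(d n) le_eqVlt; apply/orP; left; apply/eqP.
  by congr (_ * _); apply: eq_bigr => i _; rewrite mul1r.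
apply: (le_trans (ler_wpM2l (powR_ge0 _ _) h)).
rewrite mulrA /block_dual -powRrM -powRD ?(gt_eqF (d_gt0 n)) ?implybT//.
rewrite (_ : _ + _ = 0) ?powRr0 ?mul1r//.
by rewrite mulNr mulrBl mul1r mulVf ?gt_eqF// addNr.
Qed.

Lemma block_const_ellq t : ellq q t -> ellq q (block_const t) /\
  ellq_norm q (block_const t) <= ellq_norm q t.
Proof.
move=> ht; apply: ellq_norm_le => //; first exact: ellq_norm_ge0.
move=> N; apply: le_trans (qsum_le_norm q1 N ht).
apply: (@le_trans _ _ (qsum q (block_const t) (2 ^ N).-1)).
  by apply: qsum_nd; rewrite -ltnS prednK ?pow2_gt0// ltn_expl.
rewrite /qsum (sum_blocks (fun j => rabs (block_const t j) `^ q)); apply: ler_sum => n _.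
rewrite (eq_bigr (fun=> (d n)^-1 * rabs (t n) `^ q)); last first.
  move=> i _; rewrite /block_const block_posK// rabsM rabs_of_real.
  rewrite gtr0_norm ?invr_gt0 ?block_norm_gt0//.
  rewrite powRM ?rabs_ge0 ?invr_ge0 ?(ltW (block_norm_gt0 _))//; congr (_ * _).
  rewrite -(powR_inv1 (ltW (block_norm_gt0 n))) powRAC (powR_invK q1) ?(ltW (d_gt0 n))//.
  by rewrite powR_inv1 ?(ltW (d_gt0 n)).
rewrite sumr_const card_ord -[_ *+ 2 ^ n]mulr_natl mulrA -/(d n) mulfV ?mul1r//.
by rewrite gt_eqF.
Qed.

Lemma block_fluct_ellq y : ellq q y -> ellq q (block_fluct y) /\
  ellq_norm q (block_fluct y) <= 4 * ellq_norm q y.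
Proof.
move=> hy; have [h1 h2] := block_mean_ellq hy; have [h3 h4] := block_const_ellq h1.
have [h5 h6] := ellqB q1 hy h3; split; first exact: h5.
apply: (le_trans h6); rewrite (_ : 4 = 2 * 2 :> R); last by rewrite -natrM.
rewrite -mulrA; apply: (ler_wpM2l (ler0n _ 2)); rewrite mulr_natl mulr2n.
exact: lerD (lexx _) (le_trans h4 h2).
Qed.

Lemma block_mean_trunc y N : block_mean (trunc_to (2 ^ N).-1 y) =
  trunc_to N (block_mean y).
Proof.
apply/funext => n; rewrite /block_mean /trunc_to.
have -> : \sum_(i < 2 ^ n) (if (block_pos n i < (2 ^ N).-1)%N then y (block_pos n i) else 0)
    = \sum_(i < 2 ^ n) (if (n < N)%N then y (block_pos n i) else 0).
  by apply: eq_bigr => i _; rewrite ltn_pow2_pred block_posK.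
by case: ifP => // _; rewrite big1 ?mulr0.
Qed.

Lemma block_fluct_trunc y N : block_fluct (trunc_to (2 ^ N).-1 y) =
  trunc_to (2 ^ N).-1 (block_fluct y).
Proof.
apply/funext => j; rewrite /block_fluct block_mean_trunc /trunc_to /block_const.
by rewrite ltn_pow2_pred; case: ifP => _; rewrite ?mulr0 ?subr0.
Qed.

Lemma block_mean_unit (i : nat) : block_mean (unit_vec R k i) =
  fun n => of_real k (block_dual n) * (n == block i)%:R.
Proof.
apply/funext => n; rewrite /block_mean; congr (_ * _).
have [r hr iE] := block_pos_of i.
have [->|nb] := eqVneq n (block i).
  rewrite (bigD1 (Ordinal hr)) //= /unit_vec -iE eqxx big1 ?addr0// => l lr.
  case: eqP => // h; exfalso; move/eqP: lr; apply; apply/val_inj => /=.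
  by apply: (@addnI (2 ^ block i).-1); rewrite -/(block_pos _ _) -/(block_pos _ _) -iE.
rewrite big1// => l _; rewrite /unit_vec; case: eqP => // h.
by move/eqP: nb; case; rewrite -h block_posK.
Qed.

(** Replacing the dyadic size of the block of [j] by [j + 1] costs a factor 2. *)
Lemma block_norm_inv_le j : (block_norm (block j))^-1 <= 2 * j.+1%:R `^ (- q^-1).
Proof.
have /andP[_ h2] := block_bounds j.
have le : j.+1%:R <= 2 * d (block j).
  by rewrite -natrM ler_nat -expnS ltnW.
rewrite powRN -ler_pdivrMr ?invr_gt0 ?powR_gt0// invrK mulrC ler_pdivrMr ?block_norm_gt0//.
apply: (@le_trans _ _ ((2 * d (block j)) `^ q^-1)).
  by rewrite ge0_ler_powR ?nnegrE ?(ltW qi0)// mulr_ge0// ltW.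
rewrite powRM ?(ltW (d_gt0 _))//; apply: ler_wpM2r; first exact: powR_ge0.
by apply: ler1_powR; rewrite ?ler1n// ltW// invf_lt1.
Qed.

Lemma block_dual_le j : block_dual (block j) <= 2 * weight q j.
Proof.
have /andP[_ h2] := block_bounds j.
have b0 : 0 < 1 - q^-1 by rewrite subr_gt0 invf_lt1.
have le : j.+1%:R <= 2 * d (block j).
  by rewrite -natrM ler_nat -expnS ltnW.
rewrite /weight /block_dual !powRN.
rewrite -ler_pdivrMr ?invr_gt0 ?powR_gt0// invrK mulrC ler_pdivrMr ?powR_gt0//.
apply: (@le_trans _ _ ((2 * d (block j)) `^ (1 - q^-1))).
  by rewrite ge0_ler_powR ?nnegrE ?(ltW b0)// mulr_ge0// ltW.
rewrite powRM ?(ltW (d_gt0 _))//; apply: ler_wpM2r; first exact: powR_ge0.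
by apply: ler1_powR; rewrite ?ler1n// lerBlDr lerDl ltW.
Qed.

End BlockAverages.

(** * The blocked basis *)

Section BlockSplitting.
Variables (R : realType) (k : scalar_kind) (q : R).
Hypothesis q1 : 1 < q.
Local Notation K := (scalars R k).
Variable X : completeNormedModType K.
Implicit Types (f g : X) (h y : nat -> K).

(** An isomorphism of [X] onto the direct sum of [X] and the sequences of
    [ellq] with null block means: [f |-> (G f, H f)], with inverse [Th]. *)
Record block_splitting (G : X -> X) (H : X -> nat -> K) (Th : X -> (nat -> K) -> X)
    (M : R) : Prop := BlockSplitting {
  bspl_gt0 : 0 < M;
  bspl_Glin : forall c f g, G (c *: f + g) = c *: G f + G g;
  bspl_Hlin : forall c f g n, H (c *: f + g) n = c * H f n + H g n;
  bspl_Thlin : forall (c : K) g g' h h', ellq q h -> ellq q h' ->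
    Th (c *: g + g') (fun j => c * h j + h' j) = c *: Th g h + Th g' h';
  bspl_H : forall f, ellq q (H f);
  bspl_Gle : forall f, rnorm (G f) <= M * rnorm f;
  bspl_Hle : forall f, ellq_norm q (H f) <= M * rnorm f;
  bspl_Thle : forall g h, ellq q h -> rnorm (Th g h) <= M * (rnorm g + ellq_norm q h);
  bspl_mean : forall f, block_mean q (H f) = fun=> 0;
  bspl_GTh : forall g h, ellq q h -> block_mean q h = (fun=> 0) -> G (Th g h) = g;
  bspl_HTh : forall g h, ellq q h -> block_mean q h = (fun=> 0) -> H (Th g h) = h;
  bspl_id : forall f, Th (G f) (H f) = f
}.

Let combine_le (M v w : R) : 0 < M -> 0 <= v -> 0 <= w ->
  M * (M * v) + M * (2 * (M * v + w)) <= (3 * (M * M) + 4 * M) * (v + w).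
Proof.
move=> M0 v0 w0.
have := mulr_ge0 (ltW M0) v0; have := mulr_ge0 (ltW M0) w0.
have := mulr_ge0 (mulr_ge0 (ltW M0) (ltW M0)) w0; lra.
Qed.

Let const_le (M : R) : 0 < M -> M * M + M * M <= 3 * M * M + 4 * M.
Proof. by move=> M0; have := mulr_gt0 M0 M0; lra. Qed.

(** Every block mean is a coordinate of a second copy of [ellq]; that copy is
    absorbed by [X], which contains its own complemented [ellq]. *)
Lemma block_splitting_of_ellq D E cc La M : @ellq_splitting R k q X D E cc La M ->
  exists G H Th M', block_splitting G H Th M'.
Proof.
move=> spl; have M0 := spl_gt0 spl.
have hcc : forall f, ellq q (cc f) by move=> f; apply: (spl_cc spl).
have Llin := spl_Lalin spl.
pose G f := E (D f) + La (block_mean q (cc f)).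
pose H f := block_fluct q (cc f).
pose Th g (h : nat -> K) := E (D g) + La (fun j => block_const q (cc g) j + h j).
have hm f := block_mean_ellq q1 (hcc f).
have hf f := block_fluct_ellq q1 (hcc f).
have hk f := block_const_ellq q1 (hcc f).
have ED c f g : E (D (c *: f + g)) = c *: E (D f) + E (D g).
  by rewrite (spl_Dlin spl) (spl_Elin spl).
have cc_lin c f g : cc (c *: f + g) = fun n => c * cc f n + cc g n.
  by apply/funext => n; rewrite (spl_cclin spl).
have Dadd f g : D (f + g) = D f + D g.
  by rewrite -[f]scale1r (spl_Dlin spl) !scale1r.
have ccadd f g : cc (f + g) = fun n => cc f n + cc g n.
  by rewrite -[f]scale1r cc_lin scale1r; apply/funext => n; rewrite mul1r.
have ck g h : ellq q h -> ellq q (fun j => block_const q (cc g) j + h j).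
  by move=> hh; exact: (ellqD q1 (hk g).1 hh).1.
have DG f : D (G f) = D f.
  by rewrite /G Dadd (spl_DE spl) (spl_DLa spl (hm f).1) addr0.
have ccG f : cc (G f) = block_mean q (cc f).
  rewrite /G ccadd (spl_ccE spl) (spl_ccLa spl (hm f).1).
  by apply/funext => n; rewrite add0r.
have DTh g h : ellq q h -> D (Th g h) = D g.
  by move=> hh; rewrite /Th Dadd (spl_DE spl) (spl_DLa spl (ck g _ hh)) addr0.
have ccTh g h : ellq q h -> cc (Th g h) = fun j => 1 * block_const q (cc g) j + h j.
  move=> hh; rewrite /Th ccadd (spl_ccE spl) (spl_ccLa spl (ck g _ hh)).
  by apply/funext => n; rewrite add0r mul1r.
have ED_le f : rnorm (E (D f)) <= M * (M * rnorm f).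
  apply: (le_trans (spl_Ele spl _)); apply: (ler_wpM2l (ltW M0)).
  exact: spl_Dle spl f.
have MM0 : 0 < M * M by rewrite mulr_gt0.
exists G, H, Th, (3 * (M * M) + 4 * M); split.
- by rewrite addr_gt0 ?mulr_gt0.
- move=> c f g; rewrite /G ED cc_lin block_mean_lin.
  by rewrite (Llin _ _ _ (hm f).1 (hm g).1) scalerDr addrACA.
- by move=> c f g n; rewrite /H cc_lin block_fluct_lin.
- move=> c g g' h h' hh hh'; rewrite /Th ED cc_lin block_const_lin.
  rewrite scalerDr addrACA -(Llin _ _ _ (ck g _ hh) (ck g' _ hh')).
  congr (_ + La _); apply/funext => j; rewrite mulrDr; exact: addrACA.
- by move=> f; exact: (hf f).1.
- move=> f; apply: (le_trans (rnormD _ _)).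
  have h1 := ED_le f; have h2 := spl_Lale spl (hm f).1.
  have h3 := ler_wpM2l (ltW M0) (le_trans (hm f).2 (spl_ccle spl f)).
  apply: (le_trans (lerD h1 (le_trans h2 h3))).
  rewrite !mulrA -mulrDl; apply: (ler_wpM2r (rnorm_ge0 f)).
  exact: const_le M0.
- move=> f; apply: (le_trans (hf f).2).
  apply: (@le_trans _ _ (4 * (M * rnorm f))).
    by apply: (ler_wpM2l (ler0n _ 4)); exact: spl_ccle spl f.
  rewrite mulrA; apply: (ler_wpM2r (rnorm_ge0 f)).
  by rewrite lerDr mulr_ge0// ltW.
- move=> g h hh; apply: (le_trans (rnormD _ _)).
  have [h1 h2] := ellqD q1 (hk g).1 hh.
  have h3 := le_trans (hk g).2 (spl_ccle spl g).
  have h4 := le_trans (spl_Lale spl h1) (ler_wpM2l (ltW M0) h2).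
  have h5 : M * (2 * (ellq_norm q (block_const q (cc g)) + ellq_norm q h)) <=
      M * (2 * (M * rnorm g + ellq_norm q h)).
    by apply: (ler_wpM2l (ltW M0)); apply: (ler_wpM2l (ler0n _ 2)); rewrite lerD2r.
  apply: (le_trans (lerD (ED_le g) (le_trans h4 h5))).
  exact: combine_le M0 (rnorm_ge0 g) (ellq_norm_ge0 q h).
- by move=> f; exact: block_mean_fluct.
- move=> g h hh mh; rewrite /G (DTh _ _ hh) (ccTh _ _ hh) block_mean_lin mh.
  rewrite block_constK.
  have -> : (fun n => 1 * cc g n + 0) = cc g.
    by apply/funext => n; rewrite mul1r addr0.
  exact: spl_id spl g.
- move=> g h hh mh; rewrite /H (ccTh _ _ hh) block_fluct_lin block_fluct_const.
  by rewrite (block_fluct_id mh); apply/funext => n; rewrite mulr0 add0r.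
- move=> f; rewrite /Th DG ccG /H.
  have -> : (fun j => block_const q (block_mean q (cc f)) j +
      block_fluct q (cc f) j) = cc f.
    by apply/funext => j; rewrite /block_fluct addrC subrK.
  exact: spl_id spl f.
Qed.

End BlockSplitting.

Section BlockedBasis.
Variables (R : realType) (k : scalar_kind) (q : R).
Hypothesis q1 : 1 < q.
Local Notation K := (scalars R k).
Variable X : completeNormedModType K.
Variables (b : nat -> X) (G : X -> X) (H : X -> nat -> K)
  (Th : X -> (nat -> K) -> X) (M : R).
Hypotheses (bb : is_basis b) (spl : @block_splitting R k q X G H Th M).
Implicit Types (f g : X) (y h : nat -> K).

Let q0 : 0 < q. Proof. exact: lt_trans q1. Qed.
Let M0 : 0 < M := bspl_gt0 spl.
Let sb : schauder_basis b := bb.1.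
Let hH f : ellq q (H f). Proof. apply: (bspl_H spl). Qed.
Let dual j : K := of_real k (block_dual q (block j)).

(** On the [n]-th block, of length [2 ^ n], the vectors average to a multiple
    of [b n], and their differences span a copy of the null-mean part of
    [ellq]. *)
Definition blocked_basis (j : nat) : X :=
  Th (dual j *: b (block j)) (block_fluct q (unit_vec R k j)).

Definition blocked_coef f (j : nat) : K :=
  block_const q (coef b (G f)) j + H f j.

Let unit_ellq j : ellq q (unit_vec R k j).
Proof.
apply: (@finite_ellq R k q q1 _ j.+1) => n jn.
by rewrite /unit_vec gtn_eqF.
Qed.

Let fluct_ellq y : ellq q y -> ellq q (block_fluct q y).
Proof. by move=> hy; exact: (block_fluct_ellq q1 hy).1. Qed.

Let trunc_ellq n y : ellq q (trunc_to n y).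
Proof. exact: (@trunc_to_ellq R k q q1 n y). Qed.

Let Th0 : Th 0 (fun=> 0) = 0.
Proof.
have [z1 _] := @ellq0 R k q q1.
have h := bspl_Thlin spl (-1) 0 0 z1 z1; rewrite !scaleN1r !addNr in h.
by rewrite -[RHS]h; congr Th; apply/funext => n; rewrite mulr0 addr0.
Qed.

Lemma psum_blocked n y : psum blocked_basis y n =
  Th (\sum_(j < n) (dual j * y j) *: b (block j)) (block_fluct q (trunc_to n y)).
Proof.
elim: n => [|n IH].
  rewrite /psum !big_ord0 -[LHS]Th0; congr Th; apply/funext => j.
  by rewrite /block_fluct /block_const /block_mean /trunc_to big1 ?mulr0 ?subr0.
rewrite psumS IH addrC /blocked_basis.
rewrite -(bspl_Thlin spl _ _ _ (fluct_ellq (@unit_ellq n)) (fluct_ellq (@trunc_ellq n y))).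
congr Th; first by rewrite big_ord_recr /= addrC scalerA [y n * _]mulrC.
rewrite -block_fluct_lin; congr block_fluct; apply/funext => j.
rewrite /trunc_to /unit_vec ltnS.
by case: (ltngtP j n) => [jn|jn|->]; rewrite ?mulr0 ?mulr1 ?add0r ?addr0.
Qed.

Lemma psum_blocked_pow2 N y : psum blocked_basis y (2 ^ N).-1 =
  Th (psum b (block_mean q y) N) (trunc_to (2 ^ N).-1 (block_fluct q y)).
Proof.
rewrite psum_blocked block_fluct_trunc; congr Th.
rewrite (sum_blocks (fun j => (dual j * y j) *: b (block j))).
apply: eq_bigr => n _; rewrite /block_mean mulr_sumr scaler_suml.
by apply: eq_bigr => i _; rewrite /dual block_posK.
Qed.

Let Bb : exists2 B : R, 0 < B & forall j, rnorm (b j) <= B.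
Proof.
have [_ /semi_normalizedP[c [B [c0 h]]]] := bb.
exists B; last by move=> j; have [] := h j.
by apply: (lt_le_trans c0); have [h1 h2] := h 0%N; exact: le_trans h1 h2.
Qed.

Let low : exists2 c : R, 0 < c & forall j, c <= rnorm (b j).
Proof.
have [_ /semi_normalizedP[c [B [c0 h]]]] := bb.
by exists c => // j; have [] := h j.
Qed.

(** The vectors [b n] are bounded, which gives the weighted sum; the rest is the
    sequence of coefficients with its block means removed, a bounded operation
    on [ellq]. *)
Lemma blocked_upper : exists2 C : R, 0 < C &
  forall n (P : pred nat) (a : nat -> K),
  rnorm (\sum_(j < n | P j) a j *: blocked_basis j) <=
  C * (\sum_(j < n | P j) weight q j * rabs (a j) +
        (\sum_(j < n | P j) rabs (a j) `^ q) `^ q^-1).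
Proof.
have [B B0 hB] := Bb.
exists (M * (2 * B + 4)); first by rewrite mulr_gt0// addr_gt0// mulr_gt0.
move=> n P a; pose y j := if P j then a j else 0.
have -> : \sum_(j < n | P j) a j *: blocked_basis j = psum blocked_basis y n.
  rewrite /psum big_mkcond; apply: eq_bigr => j _; rewrite /y.
  by case: ifP => // _; rewrite scale0r.
rewrite psum_blocked.
have [h1 h2] := block_fluct_ellq q1 (@trunc_ellq n y).
apply: (le_trans (bspl_Thle spl _ h1)).
rewrite -mulrA; apply: (ler_wpM2l (ltW M0)).
set S1 := \sum_(j < n | P j) weight q j * _.
set S2 := (\sum_(j < n | P j) _) `^ q^-1.
have S10 : 0 <= S1.
  by apply: sumr_ge0 => j _; rewrite mulr_ge0 ?rabs_ge0// powR_ge0.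
have S20 : 0 <= S2 by exact: powR_ge0.
have e1 : rnorm (\sum_(j < n) (dual j * y j) *: b (block j)) <= 2 * B * S1.
  apply: (le_trans (rnorm_sum _ _ _)); rewrite /S1 mulr_sumr [X in _ <= X]big_mkcond.
  apply: ler_sum => j _; rewrite rnormZ rabsM /dual rabs_of_real /y.
  case: ifP => _; last by rewrite rabs0 mulr0 mul0r.
  rewrite gtr0_norm ?block_dual_gt0//.
  have h3 := block_dual_le q1 j; have h4 := hB (block j).
  have -> : 2 * B * (weight q j * rabs (a j)) =
      2 * weight q j * rabs (a j) * B by ring.
  apply: ler_pM => //; rewrite ?mulr_ge0 ?rabs_ge0 ?rnorm_ge0 ?(ltW (block_dual_gt0 _ _))//.
  by apply: (ler_wpM2r (rabs_ge0 _)).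
have e2 : ellq_norm q (trunc_to n y) = S2.
  rewrite (@finite_ellq_norm R k q q1 _ n); last first.
    by move=> j nj; rewrite /trunc_to ltnNge nj.
  rewrite /S2 /qsum [in RHS]big_mkcond; congr (_ `^ _).
  apply: eq_bigr => j _; rewrite /trunc_to ltn_ord /y; case: ifP => // _.
  by rewrite rabs0 powR0// gt_eqF.
rewrite e2 in h2; apply: (le_trans (lerD e1 h2)).
rewrite [X in _ <= X]mulrDr; apply: lerD.
  by apply: (ler_wpM2r S10); rewrite lerDl.
by apply: (ler_wpM2r S20); rewrite lerDr mulr_ge0// ltW.
Qed.

(** The part of a coefficient coming from [b] is a bounded number divided by the
    norm of the indicator of the block. *)
Lemma blocked_lower : exists2 C : R, 0 < C & forall f, exists h, [/\ ellq q h,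
  ellq_norm q h <= C * rnorm f &
  forall j, rabs (blocked_coef f j - h j) <= C * rnorm f * j.+1%:R `^ (- q^-1)].
Proof.
have [c c0 hc] := low; have [C C0 hC] := coef_bounded sb c0 hc.
exists (M + 2 * (C * M)); first by rewrite addr_gt0 ?mulr_gt0.
move=> f; exists (H f); split; first exact: hH.
  apply: (le_trans (bspl_Hle spl f)); apply: (ler_wpM2r (rnorm_ge0 f)).
  by rewrite lerDl !mulr_ge0// ltW.
move=> j; rewrite /blocked_coef addrK /block_const rabsM rabs_of_real.
rewrite gtr0_norm ?invr_gt0 ?block_norm_gt0//.
have h1 : rabs (coef b (G f) (block j)) <= C * (M * rnorm f).
  by apply: (le_trans (hC _ _)); apply: (ler_wpM2l (ltW C0)); exact: bspl_Gle spl f.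
have h2 := block_norm_inv_le q1 j.
have n0 : 0 <= (block_norm q (block j))^-1 by rewrite invr_ge0 ltW// block_norm_gt0.
apply: (le_trans (ler_pM n0 (rabs_ge0 _) h2 h1)).
have -> : 2 * j.+1%:R `^ (- q^-1) * (C * (M * rnorm f)) =
  2 * (C * M) * rnorm f * j.+1%:R `^ (- q^-1) by ring.
apply: ler_wpM2r; first exact: powR_ge0.
by apply: (ler_wpM2r (rnorm_ge0 f)); rewrite lerDr ltW.
Qed.

Lemma blocked_coef_lin (c : K) f g j :
  blocked_coef (c *: f + g) j = c * blocked_coef f j + blocked_coef g j.
Proof.
rewrite /blocked_coef (bspl_Hlin spl) (bspl_Glin spl).
have -> : coef b (c *: G f + G g) = fun j => c * coef b (G f) j + coef b (G g) j.
  by apply/funext => n; exact: coef_lin.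
by rewrite block_const_lin mulrDr addrACA.
Qed.

Lemma blocked_mean f : block_mean q (blocked_coef f) = coef b (G f).
Proof.
have -> : blocked_coef f = fun j => 1 * block_const q (coef b (G f)) j + H f j.
  by apply/funext => j; rewrite mul1r.
rewrite block_mean_lin block_constK (bspl_mean spl).
by apply/funext => n; rewrite mul1r addr0.
Qed.

Lemma blocked_fluct f : block_fluct q (blocked_coef f) = H f.
Proof.
apply/funext => j; rewrite /block_fluct blocked_mean /blocked_coef.
by rewrite addrC addKr.
Qed.

Lemma blocked_biorth i j : blocked_coef (blocked_basis i) j = (i == j)%:R.
Proof.
rewrite /blocked_coef /blocked_basis.
have hu := fluct_ellq (@unit_ellq i).
have mu : block_mean q (block_fluct q (unit_vec R k i)) = fun=> 0.
  exact: block_mean_fluct.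
rewrite (bspl_GTh spl _ hu mu) (bspl_HTh spl _ hu mu).
rewrite /block_fluct block_mean_unit.
have -> : coef b (dual i *: b (block i)) =
    fun n => of_real k (block_dual q (block i)) * (n == block i)%:R.
  apply/funext => n; have := coef_lin sb (dual i) (b (block i)) 0 n.
  have -> : coef b 0 n = 0.
    by have := coef_psum (fun=> 0) 0 n sb; rewrite /psum big_ord0.
  by rewrite !addr0 => ->; rewrite (coef_basis sb) eq_sym.
rewrite addrCA.
have -> : block_const q (fun n => of_real k (block_dual q (block i)) * (n == block i)%:R) j =
   block_const q (fun n => of_real k (block_dual q n) * (n == block i)%:R) j.
  rewrite /block_const; congr (_ * _).
  by have [->|_] := eqVneq (block j) (block i); rewrite ?mulr0.
by rewrite subrr addr0 /unit_vec eq_sym.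
Qed.

Let coef_null f (e : R) : 0 < e ->
  exists N, forall n, (N <= n)%N -> rabs (coef b f n) < e.
Proof.
move=> e0; have [c c0 hc] := low.
have ce0 : 0 < c * e / 2 by rewrite divr_gt0// mulr_gt0.
have [N hN] := coef_tends sb f ce0; exists N => n Nn.
have h1 := hN n Nn; have h2 := hN n.+1 (leqW Nn).
have h3 : rabs (coef b f n) * rnorm (b n) < c * e.
  rewrite -rnormZ.
  have -> : coef b f n *: b n =
      (f - psum b (coef b f) n) - (f - psum b (coef b f) n.+1).
    by rewrite psumS !opprD !opprK addrACA subrr add0r addrA addNr add0r.
  by apply: (le_lt_trans (rnormB _ _)); lra.
rewrite -(ltr_pM2l c0); apply: le_lt_trans h3; rewrite mulrC.
by apply: (ler_wpM2l (rabs_ge0 _)).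
Qed.

(** At the end of a block the error splits along [G] and [H]; inside the last
    block the additional terms are bounded by the [ellq] norm of the
    coefficients on that block. *)
Lemma blocked_tends f : tends (psum blocked_basis (blocked_coef f)) f.
Proof.
have [C C0 hC] := blocked_upper.
pose y := blocked_coef f.
pose u N := trunc_from (2 ^ N).-1 (H f).
pose err N := M * (rnorm (G f - psum b (coef b (G f)) N) + ellq_norm q (u N)) +
  C * (2 * (2 * (rabs (coef b (G f) N) + ellq_norm q (u N)))).
have hu N : ellq q (u N) := (@trunc_from_ellq R k q q1 _ _ (@hH f)).1.
have err_small e : 0 < e -> exists N, forall n, (N <= n)%N -> err n < e.
  move=> e0; pose e' := e / (2 * M + 8 * C + 1).
  have D0 : 0 < 2 * M + 8 * C + 1 by move: M0 C0; lra.
  have e'0 : 0 < e' by rewrite divr_gt0.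
  have eE : (2 * M + 8 * C + 1) * e' = e by rewrite /e' mulrC divfK// gt_eqF.
  have [N1 h1] := coef_tends sb (G f) e'0.
  have [N2 h2] := trunc_from_cvg0 q1 (@hH f) e'0.
  have [N3 h3] := coef_null (G f) e'0.
  exists (maxn N1 (maxn N2 N3)) => n; rewrite !geq_max => /and3P[/h1 n1 n2 /h3 n3].
  have {h2} n2 := h2 (2 ^ n).-1 (leq_trans n2 _).
  have le : (n <= (2 ^ n).-1)%N by rewrite -ltnS prednK ?pow2_gt0// ltn_expl.
  have {le} n2 := n2 le; rewrite -/(u n) in n2.
  rewrite /err -eE; move: n1 n2 n3; clear -M0 C0 e'0.
  move: (rnorm _) (ellq_norm _ _) (rabs _) => v w z n1 n2 n3.
  have := mulr_gt0 M0 (_ : 0 < e' - v); rewrite subr_gt0 => /(_ n1).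
  have := mulr_gt0 M0 (_ : 0 < e' - w); rewrite subr_gt0 => /(_ n2).
  have := mulr_gt0 C0 (_ : 0 < e' - z); rewrite subr_gt0 => /(_ n3).
  have := mulr_gt0 C0 (_ : 0 < e' - w); rewrite subr_gt0 => /(_ n2).
  by nra.
have main n : exists2 N, (n <= 2 ^ N.+1)%N &
    rnorm (f - psum blocked_basis y n) <= err N.
  have /andP[b1 b2] := block_bounds n; set N := block n in b1 b2.
  exists N; first exact: ltnW (ltnW b2).
  have [r nE] : exists r, (n = (2 ^ N).-1 + r)%N.
    by exists (n - (2 ^ N).-1)%N; rewrite subnKC// -ltnS prednK ?pow2_gt0.
  have rN : (r <= 2 ^ N)%N.
    move: b2; rewrite nE -addSn prednK ?pow2_gt0// expnS mul2n -addnn ltn_add2l.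
    exact: ltnW.
  have -> : psum blocked_basis y n = psum blocked_basis y (2 ^ N).-1 +
     \sum_(j < n | ((2 ^ N).-1 <= j)%N) y j *: blocked_basis j.
    rewrite /psum nE big_split_ord /=; congr (_ + _).
    rewrite [RHS]big_mkcond big_split_ord /= [X in X + _]big1 ?add0r.
      by apply: eq_bigr => i _; rewrite leq_addr.
    by move=> i _; rewrite leqNgt ltn_ord.
  rewrite opprD addrA; apply: (le_trans (rnormB _ _)); apply: lerD.
    rewrite psum_blocked_pow2 /y blocked_mean blocked_fluct.
    have -> : f - Th (psum b (coef b (G f)) N) (trunc_to (2 ^ N).-1 (H f)) =
        Th (G f - psum b (coef b (G f)) N) (u N).
      have tq := @trunc_ellq (2 ^ N).-1 (H f).
      have -> : f - Th (psum b (coef b (G f)) N) (trunc_to (2 ^ N).-1 (H f)) =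
          (-1) *: Th (psum b (coef b (G f)) N) (trunc_to (2 ^ N).-1 (H f)) + Th (G f) (H f).
        by rewrite (bspl_id spl) scaleN1r addrC.
      rewrite -(bspl_Thlin spl _ _ _ tq (@hH f)); congr Th.
        by rewrite scaleN1r addrC.
      apply/funext => j; rewrite /u /trunc_from /trunc_to mulN1r ltnNge.
      by case: leqP => _; rewrite ?addNr ?oppr0 ?add0r.
    exact: (bspl_Thle spl _ (hu N)).
  apply: (le_trans (hC n (fun j => (2 ^ N).-1 <= j)%N y)).
  apply: (ler_wpM2l (ltW C0)).
  set S := (\sum_(j < n | _) _ `^ q) `^ q^-1.
  have c_le : (card_below (fun j => (2 ^ N).-1 <= j)%N n <= 2 ^ N)%N.
    apply: leq_trans rN; rewrite /card_below big_mkcond nE big_split_ord /=.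
    rewrite big1 ?add0n; last by move=> i _; rewrite leqNgt ltn_ord.
    rewrite -[X in (_ <= X)%N]card_ord -sum1_card.
    by apply: leq_sum => i _; case: ifP.
  have b0 : 0 <= 1 - q^-1 by rewrite subr_ge0 invf_le1// ltW.
  have W_le : \sum_(j < n | ((2 ^ N).-1 <= j)%N) weight q j * rabs (y j) <= S.
    apply: (@le_trans _ _ (block_dual q N *
        \sum_(j < n | ((2 ^ N).-1 <= j)%N) rabs (y j))).
      rewrite mulr_sumr; apply: ler_sum => j Nj; apply: (ler_wpM2r (rabs_ge0 _)).
      rewrite /weight /block_dual !powRN lef_pV2 ?posrE ?powR_gt0 ?ltr0n ?pow2_gt0//.
      by rewrite ge0_ler_powR ?nnegrE// ler_nat -(prednK (pow2_gt0 N)) ltnS.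
    have := @hoelder_card R q q1 (fun j => (2 ^ N).-1 <= j)%N n
      (fun j => rabs (y j)) (fun j => rabs_ge0 _).
    move=> /(ler_wpM2l (ltW (block_dual_gt0 q N))) /le_trans; apply.
    rewrite mulrA -[X in _ <= X]mul1r; apply: ler_wpM2r; first exact: powR_ge0.
    rewrite /block_dual powRN mulrC ler_pdivrMr ?powR_gt0 ?ltr0n ?pow2_gt0// mul1r.
    by rewrite ge0_ler_powR ?nnegrE// ler_nat.
  pose z j := block_const q (fun i => coef b (G f) N * unit_vec R k N i) j + u N j.
  have [k1 k2] := block_const_ellq q1 (ellqZ q1 (coef b (G f) N) (@unit_ellq N)).1.
  have [z1 z2] := ellqD q1 k1 (hu N).
  have S_le : S <= 2 * (rabs (coef b (G f) N) + ellq_norm q (u N)).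
    apply: (@le_trans _ _ (ellq_norm q z)).
      have S0 : 0 <= \sum_(j < n | ((2 ^ N).-1 <= j)%N) rabs (y j) `^ q.
        by apply: sumr_ge0 => j _; exact: powR_ge0.
      rewrite -(powR_leE q1 (powR_ge0 _ _) (ellq_norm_ge0 q z)) (powR_invK q1 S0).
      apply: le_trans (qsum_le_norm q1 n z1); rewrite /qsum big_mkcond.
      apply: ler_sum => j _; case: ifP => Nj; last exact: powR_ge0.
      have -> : y j = z j.
        rewrite /y /z /blocked_coef /u /trunc_from Nj; congr (_ + _).
        rewrite /block_const /unit_vec (_ : block j = N) ?eqxx ?mulr1//.
        apply: trunc_log_eq => //; rewrite -(prednK (pow2_gt0 N)) ltnS Nj.
        by apply: leq_ltn_trans b2; rewrite ltnS ltnW.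
      exact: lexx.
    apply: (le_trans z2); apply: (ler_wpM2l (ler0n _ 2)); rewrite lerD2r.
    apply: (le_trans k2); apply: (le_trans (ellqZ q1 (coef b (G f) N) (@unit_ellq N)).2).
    rewrite -[X in _ <= X]mulr1; apply: (ler_wpM2l (rabs_ge0 _)).
    rewrite (@finite_ellq_norm R k q q1 _ N.+1); last first.
      by move=> j nj; rewrite /unit_vec gtn_eqF.
    rewrite /qsum big_ord_recr /= /unit_vec eqxx rabs1 powR1 big1 ?add0r ?powR1// => j _.
    by rewrite ltn_eqF// rabs0 powR0// gt_eqF.
  by rewrite mulr_natl mulr2n; apply: lerD => //; exact: le_trans W_le S_le.
move=> e e0; have [N0 h0] := err_small e e0.
exists (2 ^ N0.+1).+1 => n Nn; have [N nN le] := main n.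
apply: (le_lt_trans le); apply: h0.
have := leq_trans Nn nN; rewrite ltn_exp2l// => h.
exact: ltnW.
Qed.

Lemma blocked_coord_system : coord_system blocked_basis blocked_coef id.
Proof.
have [c c0 hc] := low; have [B B0 hB] := coef_bounded sb c0 hc.
have [C C0 hC] := blocked_upper.
split.
- exact: blocked_tends.
- exact: blocked_coef_lin.
- exists (B * M + M); first by rewrite addr_gt0 ?mulr_gt0.
  move=> f j; rewrite /blocked_coef mulrDl; apply: (le_trans (rabsD _ _)).
  apply: lerD; last first.
    exact: le_trans (rabs_le_norm q1 j (@hH f)) (bspl_Hle spl f).
  rewrite /block_const rabsM rabs_of_real gtr0_norm ?invr_gt0 ?block_norm_gt0//.
  apply: (@le_trans _ _ (1 * rabs (coef b (G f) (block j)))).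
    apply: (ler_wpM2r (rabs_ge0 _)).
    by rewrite invf_le1 ?block_norm_gt0// block_norm_ge1.
  rewrite mul1r; apply: (le_trans (hB _ _)); rewrite -mulrA.
  by apply: (ler_wpM2l (ltW B0)); exact: bspl_Gle spl f.
- exact: blocked_biorth.
- exists (C * 2) => j.
  have := hC j.+1 (pred1 j) (fun=> 1).
  have s1 (V : nmodType) (F : nat -> V) : \sum_(i < j.+1 | pred1 j i) F i = F j.
    rewrite (eq_bigl (pred1 (ord_max : 'I_j.+1))) ?big_pred1_eq//.
  rewrite (s1 _ (fun i => 1 *: blocked_basis i)) (s1 _ (fun i => weight q i * rabs 1)).
  rewrite (s1 _ (fun i => rabs 1 `^ q)) scale1r rabs1 !powR1 mulr1.
  move/le_trans; apply; apply: (ler_wpM2l (ltW C0)).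
  rewrite (_ : 2 = 1 + 1 :> R)// lerD2r /weight -[X in _ <= X](powRr0 j.+1%:R).
  by apply: ler_powR; rewrite ?ler1n// oppr_le0 subr_ge0 invf_le1// ltW.
Qed.

(** A block-constant combination of the blocked basis is the corresponding
    combination of [b], transported by an isomorphism. *)
Lemma blocked_transfer N y : exists a : nat -> K, forall A : pred nat,
  let v := psum b (fun j => if A j then y j else 0) N in
  let w := psum blocked_basis (fun j => if A (block j) then a j else 0) (2 ^ N).-1 in
  rnorm w <= M * rnorm v /\ rnorm v <= M * rnorm w.
Proof.
exists (block_const q y) => A v w.
have [z1 z2] := @ellq0 R k q q1.
have wE : w = Th v (fun=> 0).
  rewrite /w.
  have -> : (fun j => if A (block j) then block_const q y j else 0) =
     block_const q (fun j => if A j then y j else 0).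
    by apply/funext => j; rewrite /block_const; case: ifP; rewrite ?mulr0.
  rewrite psum_blocked_pow2 block_constK block_fluct_const.
  by congr Th; apply/funext => j; rewrite /trunc_to if_same.
have mz : block_mean q (fun=> 0 : K) = fun=> 0.
  by apply/funext => n; rewrite /block_mean big1// mulr0.
split.
  rewrite wE; apply: (le_trans (bspl_Thle spl _ z1)).
  by rewrite z2 addr0.
by rewrite -{1}(bspl_GTh spl v z1 mz) -wE; exact: bspl_Gle spl w.
Qed.

End BlockedBasis.

(** * The conditionality parameters *)

Section Conditionality.
Variables (R : realType) (k : scalar_kind).
Variable X : completeNormedModType (scalars R k).

Lemma conditionality_ge (x : nat -> X) (a : nat -> scalars R k) (A : pred nat) n m :
  schauder_basis x -> (n <= m)%N -> psum x a n != 0 ->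
  ((rnorm (psum x (fun j => if A j then a j else 0)%R n) /
    rnorm (psum x a n))%:E <= conditionality x m)%E.
Proof.
move=> sx nm v0; apply: ereal_sup_ubound.
exists (psum x a n), [set j | A j]; split => //.
  by move=> j mj; rewrite (coef_psum _ _ _ sx) ltnNge (leq_trans nm mj).
congr ((rnorm _ / _)%:E).
rewrite (@basis_proj_finite _ _ _ _ _ _ n); last first.
  by move=> j nj _; rewrite (coef_psum _ _ _ sx) ltnNge nj.
rewrite [RHS]big_mkcond; apply: eq_bigr => j _.
rewrite mem_setE (coef_psum _ _ _ sx) ltn_ord.
have -> : (nat_of_ord j \in [pred j | A j]) = A j by [].
by case: ifP => // _; rewrite scale0r.
Qed.

Lemma conditionality_ge1 (x : nat -> X) m : schauder_basis x -> (0 < m)%N ->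
  (1 <= conditionality x m)%E.
Proof.
move=> sx m0; pose a (j : nat) : scalars R k := (0%N == j)%:R.
have a1 : psum x a 1 != 0.
  apply/eqP => h; have := coef_psum a 1 0 sx; rewrite h /a /=.
  have := coef_psum (fun=> 0) 0 0 sx; rewrite /psum big_ord0 /= => -> /eqP.
  by rewrite eq_sym oner_eq0.
have := @conditionality_ge x a xpredT 1 m sx m0 a1.
by rewrite mulfV// gt_eqF// rnorm_gt0.
Qed.

End Conditionality.

(** The index [m] reaches the end of block [4 n] only for [n] of order
    [log m]. *)
Lemma ln_le_block (R : realType) (m n : nat) : (0 < n)%N -> (block m < 4 * n.+1)%N ->
  ln m%:R <= 16 * n%:R :> R.
Proof.
move=> n0 h; have /andP[_ b2] := block_bounds m.
have [->|mp] := posnP m; first by rewrite ln0// mulr_ge0.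
have le : m%:R <= 2 ^+ (4 * n.+1) :> R.
  rewrite -natrX ler_nat; apply: leq_trans (leq_trans (ltnW (ltnSn m)) (ltnW b2)) _.
  by rewrite leq_exp2l.
have : ln m%:R <= ln (2 ^+ (4 * n.+1)) :> R.
  by rewrite ler_ln ?posrE ?ltr0n ?exprn_gt0.
move/le_trans; apply; rewrite lnXn//.
have l2 : ln 2 <= 2 :> R by apply/ltW/ln_sublinear.
rewrite -[ln 2 *+ _]mulr_natr; apply: (@le_trans _ _ (2 * (4 * n.+1)%:R)).
  exact: ler_wpM2r (ler0n _ _) _ _ l2.
rewrite -!natrM ler_nat; lia.
Qed.

Unset Implicit Arguments.

Theorem theorem4p4 (R : realType) (k : scalar_kind)
    (X : completeNormedModType (scalars R k)) (q : R) :
  (exists x : nat -> X, is_basis x) ->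
  1 < q ->
  (exists Y : set X, complemented Y /\ ellq_isomorphic_to q Y) ->
  forall a : R, 0 < a -> a < 1 ->
  exists x : nat -> X,
    [/\ is_basis x,
        almost_greedy x,
        equivalent (fundamental x) (fun m => (m%:R `^ q^-1)%:E) &
        dominated (fun m => (ln m%:R `^ a)%:E) (conditionality x)].
Proof.
move=> [x0 bx0] q1 [Y [cY iY]] a a0 a1.
have [D [E [cc [La [M0 spl]]]]] := ellq_splitting_of_complemented q1 cY iY.
have [b [c [bb c0 hb]]] := conditional_basis q1 bx0 spl a0 a1.
have [G [H [Th [M bspl]]]] := block_splitting_of_ellq q1 spl.
have M_gt0 := bspl_gt0 bspl.
pose x := blocked_basis q b Th.
have [bx coefE] := basis_of_coord_system (blocked_coord_system q1 bb bspl).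
have [CU CU0 upper] := blocked_upper q1 bb bspl.
have [CL CL0 lower] := blocked_lower q1 bb bspl.
have [sx /semi_normalizedP[d [B [d0 hd]]]] := bx.
have [CB CB0 partial] := basis_constant sx d0 (fun j => (hd j).1).
have lower' f : exists h : nat -> scalars R k, [/\ ellq q h,
    ellq_norm q h <= CL * rnorm f &
    forall j, rabs (coef x f j - h j) <= CL * rnorm f * j.+1%:R `^ (- q^-1)].
  by rewrite coefE; exact: lower.
exists x; split.
- exact: bx.
- exact: (almost_greedy_of_bounds q1 bx CU0 CL0 CB0 upper lower' partial).
- exact: (fundamental_of_bounds q1 bx CU0 CL0 upper lower').
have L0 : 0 <= 16 * (M * M) / c by rewrite divr_ge0 ?mulr_ge0// ltW.
exists (16 + 16 * (M * M) / c) => m m0.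
have C0 : 0 <= 16 + 16 * (M * M) / c by rewrite addr_ge0.
suff [r rL lr] : exists2 r : R, (r%:E <= conditionality x m)%E &
    ln m%:R `^ a <= (16 + 16 * (M * M) / c) * r.
  apply: (@le_trans _ _ ((16 + 16 * (M * M) / c)%:E * r%:E)%E).
    by rewrite -EFinM lee_fin.
  by apply: lee_wpmul2l; rewrite ?lee_fin.
have lnm0 : 0 <= ln m%:R :> R by rewrite ln_ge0// ler1n.
(* The blocks attached to the first 4 n vectors of b end before m. *)
pose n := (block m %/ 4)%N.
have hn : (block m < 4 * n.+1)%N by rewrite mulnC ltn_ceil.
have pow_le (u : R) : 1 <= u -> u `^ a <= u.
  by move=> u1; apply: ler1_powR => //; exact: ltW.
(* For n = 0 the index m is bounded, and the trivial bound 1 suffices. *)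
have [n0|np] := posnP n.
  exists 1; first exact: conditionality_ge1.
  rewrite mulr1; apply: (@le_trans _ _ 16); last by rewrite lerDl.
  apply: le_trans (pow_le 16 _); last by rewrite ler1n.
  rewrite ge0_ler_powR ?nnegrE ?(ltW a0)//.
  have : ln m%:R <= 16 * 1%:R :> R.
    by apply: ln_le_block => //; apply: leq_trans hn _; rewrite n0.
  by rewrite mulr1.
have [al [A [v0 hv]]] := hb n np.
have [w hw] := blocked_transfer q1 b bspl (4 * n) al.
have [h1 h2] := hw xpredT; have [_ h3] := hw A; move: h1 h2 h3 => /=.
set v := psum b al (4 * n) in v0 hv *; set ww := psum _ _ (2 ^ (4 * n)).-1.
set vA := psum b _ (4 * n) in hv *; set wA := psum _ _ (2 ^ (4 * n)).-1.
move=> h1 h2 h3.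
have rv := rnorm_gt0 v0.
have rw : 0 < rnorm ww.
  by rewrite -(pmulr_rgt0 _ M_gt0); exact: lt_le_trans rv h2.
have ww0 : ww != 0 by apply: contraL rw => /eqP ->; rewrite rnorm0 ltxx.
have le_m : ((2 ^ (4 * n)).-1 <= m)%N.
  have /andP[b1 _] := block_bounds m.
  rewrite -ltnS prednK ?pow2_gt0//; apply: leq_trans b1.
  by rewrite leq_exp2l// mulnC leq_trunc_div.
exists (rnorm wA / rnorm ww).
  exact: (@conditionality_ge R k X x w (fun j => A (block j)) _ m sx le_m ww0).
have p0 := powR_ge0 n%:R a.
have key : c * n%:R `^ a * rnorm ww <= M * M * rnorm wA.
  apply: (@le_trans _ _ (c * n%:R `^ a * (M * rnorm v))).
    by apply: ler_wpM2l h1; rewrite mulr_ge0// ltW.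
  rewrite mulrCA -mulrA; apply: (ler_wpM2l (ltW M_gt0)).
  exact: le_trans hv h3.
have p_le : 16 * n%:R `^ a <= 16 * (M * M) / c * (rnorm wA / rnorm ww).
  have -> : 16 * (M * M) / c * (rnorm wA / rnorm ww) =
      16 * (M * M * rnorm wA / (c * rnorm ww)).
    by field; rewrite !gt_eqF.
  apply: (ler_wpM2l (ler0n _ 16)); rewrite ler_pdivlMr ?mulr_gt0//.
  by rewrite mulrCA mulrA.
apply: (@le_trans _ _ ((16 * n%:R) `^ a)).
  rewrite ge0_ler_powR ?nnegrE ?(ltW a0) ?mulr_ge0//.
  exact: ln_le_block.
rewrite powRM//; apply: (@le_trans _ _ (16 * n%:R `^ a)).
  by apply: (ler_wpM2r p0); apply: pow_le; rewrite ler1n.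
apply: (le_trans p_le); apply: ler_wpM2r; last by rewrite lerDr.
by rewrite divr_ge0 ?rnorm_ge0.
Qed.
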